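(* Let $m>0$ and $p>1$ satisfy $\gamma := m(p-1)-1\ge 0$. Let $f\in C^1[0,1]$ with $f(0)=f(1)=0$, $f(u)>0$ for $u\in(0,1)$, and $f$ concave on $[0,1]$. Let $c_*(m,p)$ be the minimal travelling wave speed of $\partial_t u=\partial_x\left(|\partial_x u^m|^{p-2}\partial_x u^m\right)+f(u)$, and let $\mathcal{D}$ and $\mathcal{J}$ be the class of trial functions and the functional defined in the context. Then $$c_*(m,p)=\sup\{\mathcal{J}[g] : g\in\mathcal{D}\}.$$ Moreover: (i) If $\gamma>0$, there is a $\tilde g\in\mathcal{D}$ such that $\mathcal{J}[\tilde g]=\sup\{\mathcal{J}[g] : g\in\mathcal{D}\}$, and this maximizer $\tilde g$ is unique up to a multiplicative constant. (ii) If $\gamma=0$, the explicit functions $g_\alpha(u)=\frac{\alpha}{1-\alpha}\left(u^{\alpha-1}-1\right)$, $0<\alpha<1$, belong to $\mathcal{D}$ and form a maximizing family as $\alpha\to0^+$: $$\lim_{\alpha\to 0^+}\mathcal{J}[g_\alpha]=c_*(m,p)=\left(m^2p^{m+1}f'(0)\right)^{1/(m+1)}.$$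
   Context: Travelling waves and $c_*$: a travelling wave of speed $c>0$ joining the equilibria $0$ and $1$ is a (weak) solution $u(\xi)$, $\xi=x+ct$, of the equation $\partial_t u=\partial_x\left(|\partial_x u^m|^{p-2}\partial_x u^m\right)+f(u)$, with values in $[0,1]$, monotone increasing (with $u_\xi>0$ where $0<u<1$), $u\to0$ as $\xi\to-\infty$ and $u\to1$ as $\xi\to+\infty$; it satisfies $$c\,u_\xi=m^{p-1}\frac{d}{d\xi}\left(u^{(m-1)(p-1)}(u_\xi)^{p-1}\right)+f(u)$$ where $0<u<1$. The wave may be finite, i.e. vanish identically on a left half-line, with continuous flux. In terms of the phase-space coordinate $q(u)=u^{m-1}u_\xi$, regarded as a function of $u\in(0,1)$, the equation reads $$\frac{c}{m^{p-1}}=\frac{d}{du}\left(q(u)^{p-1}\right)+\frac{F(u)}{q(u)},$$ with $q>0$ on $(0,1)$, $q(0)=q(1)=0$, where $$F(u)=\frac{u^{m-1}f(u)}{m^{p-1}}.$$ For $\gamma\ge0$ it is known that there is a number $c_*(m,p)>0$ such that a travelling wave joining $0$ and $1$, unique up to translation, exists for every $c\ge c_*(m,p)$ and none exists for $0<c<c_*(m,p)$. This number is the minimal speed $c_*(m,p)$ (it depends on $f$ as well). Trial functions: $\mathcal{D}$ is the set of $g\in C^1(0,1)$ with $g(u)\ge0$ and $h(u):=-g'(u)>0$ for all $u\in(0,1)$, and $\int_0^1 g(u)\,du<\infty$. Functional: for $g\in\mathcal{D}$, with $h=-g'$ and $F(u)=\frac{u^{m-1}f(u)}{m^{p-1}}$,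 $$\mathcal{J}[g]=\frac{p\,m^{p-1}}{(p-1)^{(p-1)/p}}\;\frac{\int_0^1 h(u)^{1/p}F(u)^{(p-1)/p}g(u)^{(p-1)/p}\,du}{\int_0^1 g(u)\,du}.$$ *)

(* Defs.v *)
From mathcomp Require Import all_boot all_order all_algebra.
From mathcomp Require Import all_classical all_reals all_analysis.

Set Implicit Arguments.
Unset Strict Implicit.
Unset Printing Implicit Defensive.

Import Order.TTheory GRing.Theory Num.Theory.
Import numFieldNormedType.Exports.

Local Open Scope classical_set_scope.
Local Open Scope ring_scope.

(* [f] is C^1 on the closed interval [0, 1] with derivative [df]: the difference
   quotients are taken inside [0, 1], hence are one-sided at 0 and 1. Only the
   values of [f] and [df] on [0, 1] matter. *)
Definition C1_unit_itv (R : realType) (f df : R -> R) : Prop :=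
  (forall x, x \in `[0, 1]%R ->
     (f y - f x) / (y - x) @[y --> within `[0, 1] x^'] --> df x) /\
  {within `[0, 1], continuous df}.

Definition concave_unit_itv (R : realType) (f : R -> R) : Prop :=
  convex_function (`[0, 1]%classic : set R) (fun x : R => - f x).

Definition gamma (R : realType) (m p : R) : R := m * (p - 1) - 1.

(* |(u^m)'|^(p-2) (u^m)'. As 0 `^ a is 0 or 1, it vanishes where (u^m)' does,
   whatever the sign of p - 2. *)
Definition flux (R : realType) (m p : R) (u : R -> R) (x : R) : R :=
  let w := fun s : R => u s `^ m in
  `|derive1 w x| `^ (p - 2) * derive1 w x.

Definition test_fun (R : realType) (phi : R -> R) : Prop :=
  (forall (n : nat) (x : R), derivable (derive1n n phi) x 1) /\
  compact (closure [set x | phi x != 0]).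

(* Weak form of  c u' = (|(u^m)'|^(p-2) (u^m)')' + f(u)  on the whole line, that
   is, of the diffusion equation for the profile u(x + c t), with a flux defined
   and continuous everywhere, in particular across the edge of a finite wave. *)
Definition weak_profile (R : realType) (m p : R) (f : R -> R) (c : R)
    (u : R -> R) : Prop :=
  [/\ forall x : R, derivable (fun s : R => u s `^ m) x 1,
      continuous (flux m p u) &
      forall phi, test_fun phi ->
        \int[@lebesgue_measure R]_x
          ((flux m p u x - c * u x) * derive1 phi x - f (u x) * phi x) = 0].

Definition travelling_wave (R : realType) (m p : R) (f : R -> R) (c : R)
    (u : R -> R) : Prop :=
  [/\ forall x, 0 <= u x <= 1,
      {homo u : x y / x <= y},
      u x @[x --> -oo] --> (0 : R) /\ u x @[x --> +oo] --> (1 : R),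
      weak_profile m p f c u &
      forall x, 0 < u x < 1 ->
        let v := fun s : R => u s `^ ((m - 1) * (p - 1)) * (derive1 u s) `^ (p - 1) in
        [/\ derivable u x 1, 0 < derive1 u x, derivable v x 1 &
            c * derive1 u x = m `^ (p - 1) * derive1 v x + f (u x)] ].

Definition minimal_speed (R : realType) (m p : R) (f : R -> R) (cstar : R) :
    Prop :=
  [/\ 0 < cstar,
      forall c, cstar <= c -> exists u, travelling_wave m p f c u &
      forall c, 0 < c -> c < cstar -> ~ exists u, travelling_wave m p f c u].

(* Trial functions and the functional only involve the values on ]0, 1[. *)
Definition trial_fun (R : realType) : set (R -> R) :=
  [set g : R -> R |
           [/\ forall u : R, u \in `]0, 1[%R ->
                 derivable g u 1 /\ {for u, continuous (derive1 g)},
               forall u : R, u \in `]0, 1[%R -> 0 <= g u,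
               forall u : R, u \in `]0, 1[%R -> 0 < - derive1 g u &
               (\int[@lebesgue_measure R]_(u in `]0%R, 1%R[) (g u)%:E < +oo)%E]].

Definition reactF (R : realType) (m p : R) (f : R -> R) (u : R) : R :=
  u `^ (m - 1) * f u / m `^ (p - 1).

(* The numerator is an integral of a nonnegative function, a priori in [0, +oo];
   on trial functions the denominator is positive and finite. *)
Definition J (R : realType) (m p : R) (f g : R -> R) : \bar R :=
  ((p * m `^ (p - 1) / (p - 1) `^ ((p - 1) / p))%:E *
   ((\int[@lebesgue_measure R]_(u in `]0%R, 1%R[)
       ((- derive1 g u) `^ (1 / p) * reactF m p f u `^ ((p - 1) / p) *
        g u `^ ((p - 1) / p))%:E) /
    (\int[@lebesgue_measure R]_(u in `]0%R, 1%R[) (g u)%:E)))%E.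

Definition g_alpha (R : realType) (alpha u : R) : R :=
  alpha / (1 - alpha) * (u `^ (alpha - 1) - 1).

(* Main.v *)
(* In the phase plane, a wave of speed c is a positive solution Y = q^(p-1) of
   Y' = C - F Y^(-k), with C = c / m^(p-1) and k = 1/(p-1), vanishing at 0 and 1.
   For every C > 0 there is a unique solution vanishing at 1, it depends
   monotonically on C, and its limit at 0 is positive if c < c_*.

   Young's inequality bounds the integrand of J[g], up to constants, by
   h Y + g F Y^(-k) = C g - (g Y)', and the boundary terms of g Y are harmless;
   hence J[g] <= c_*. Equality forces g'/g = - k F Y^(-1-k), which determines g
   up to a factor.

   If gamma > 0, i.e. m > k, then Y dominates a line near 0, since the solutions of
   speed c < c_* do; so this g is bounded and it is a maximizer. If gamma = 0, i.e.
   m = k, concavity gives F <= D u^m with D = f'(0) / m^(p-1), and a line a u is a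
   supersolution for the claimed critical speed, so c_* is at most that speed; the
   functions g_alpha concentrate at 0 as alpha -> 0 and reach it in the limit. *)

Require Import Defs.
From mathcomp Require Import all_boot all_order all_algebra.
From mathcomp Require Import all_classical all_reals all_analysis.
From mathcomp Require Import measurable_realfun ring lra.

Set Implicit Arguments.
Unset Strict Implicit.
Unset Printing Implicit Defensive.

Import Order.TTheory GRing.Theory Num.Theory.
Import numFieldNormedType.Exports.

Local Open Scope classical_set_scope.
Local Open Scope ring_scope.

(** * Real analysis *)

(** The minimal speed is known only through the existence of waves, so both passages between waves
    and phase solutions are needed: a wave of speed [cstar] yields a solution vanishing at 0, and
    for [c < cstar] a solution vanishing at both ends is excluded because a wave could be built from
    it. The condition at 1 is never read off a wave: the solution built backward from 1 lies below
    the one coming from the wave, and so inherits the limit 0 at 0. The term [F Y^(- k)] is singular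
    where [Y] vanishes, that is at both ends. Existence is obtained after a change of unknown that
    leaves a merely Hoelder right-hand side, hence through Lipschitz truncations and a limit. The
    boundary terms of [g Y] play opposite roles: in the upper bound for [J] the one at 1 has a good
    sign and the one at 0 tends to 0; in the lower bound the roles are exchanged, and there the
    boundedness of the maximizer enters. *)

Lemma is_derive_continuous (R : realType) (f : R -> R) (x d : R) :
  is_derive x 1 f d -> {for x, continuous f}.
Proof.
by move=> [df _]; apply/differentiable_continuous/derivable1_diffP.
Qed.

Lemma MVT_is_derive (R : realType) (f df : R -> R) (a b : R) :
  a < b -> (forall x, a <= x <= b -> is_derive x 1 f (df x)) ->
  exists2 c, a < c < b & f b - f a = df c * (b - a).
Proof.
move=> ab fd; have [||c cab e] := @MVT R f df a b ab.
- by move=> x; rewrite in_itv/= => /andP[ax xb]; apply: fd; rewrite !ltW.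
- apply: derivable_within_continuous => x; rewrite in_itv/= => xab.
  by have [] := fd _ xab.
- by exists c; first by move: cab; rewrite in_itv.
Qed.

Lemma ge0_is_derive_le (R : realType) (f df : R -> R) (a b : R) :
  a <= b -> (forall x, a <= x <= b -> is_derive x 1 f (df x)) ->
  (forall x, a < x < b -> 0 <= df x) -> f a <= f b.
Proof.
rewrite le_eqVlt => /predU1P[->//|ab] fd fge0.
have [c cab e] := MVT_is_derive ab fd.
by rewrite -subr_ge0 e mulr_ge0 ?fge0// subr_ge0 ltW.
Qed.

Lemma le0_is_derive_ge (R : realType) (f df : R -> R) (a b : R) :
  a <= b -> (forall x, a <= x <= b -> is_derive x 1 f (df x)) ->
  (forall x, a < x < b -> df x <= 0) -> f b <= f a.
Proof.
move=> ab fd fle0; rewrite -lerN2.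
apply: (@ge0_is_derive_le R (- f) (fun x => - df x)) => // x xab.
- exact/is_deriveN/fd.
- by rewrite oppr_ge0 fle0.
Qed.

Lemma gt0_is_derive_lt (R : realType) (f df : R -> R) (a b : R) :
  a < b -> (forall x, a <= x <= b -> is_derive x 1 f (df x)) ->
  (forall x, a < x < b -> 0 < df x) -> f a < f b.
Proof.
move=> ab fd fgt0.
have [c cab e] := MVT_is_derive ab fd.
by rewrite -subr_gt0 e mulr_gt0 ?fgt0// subr_gt0.
Qed.

Lemma lt0_is_derive_gt (R : realType) (f df : R -> R) (a b : R) :
  a < b -> (forall x, a <= x <= b -> is_derive x 1 f (df x)) ->
  (forall x, a < x < b -> df x < 0) -> f b < f a.
Proof.
move=> ab fd flt0.
have [c cab e] := MVT_is_derive ab fd.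
by rewrite -subr_lt0 e pmulr_llt0 ?flt0// subr_gt0.
Qed.

Lemma is_derive_eq0_cst (R : realType) (f : R -> R) (a b : R) :
  (forall x, a < x < b -> is_derive x 1 f 0) ->
  forall x y, a < x < b -> a < y < b -> f x = f y.
Proof.
move=> fd x y; wlog xy : x y / x <= y.
  by move=> H; case: (leP x y) => [/H//|/ltW /H + xab yab]; move=> /(_ yab xab).
move=> /andP[ax _] /andP[_ yb].
have fxy z : x <= z <= y -> is_derive z 1 f 0.
  by move=> /andP[xz zy]; apply: fd; rewrite (lt_le_trans ax)// (le_lt_trans zy).
apply/eqP; rewrite eq_le; apply/andP; split.
- exact: (@ge0_is_derive_le R f (fun=> 0)).
- exact: (@le0_is_derive_ge R f (fun=> 0)).
Qed.

Lemma is_derive_sqr_max0 (R : realType) (z : R) :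
  is_derive z 1 (fun t : R => Num.max t 0 ^+ 2) (2 * Num.max z 0).
Proof.
have [z0|z0|z0] := ltgtP z 0.
- apply: (@near_eq_is_derive _ _ _ (cst 0)).
    near=> t; rewrite max_r ?expr0n//; apply: ltW; near: t; exact: lt_nbhsl.
  by rewrite mulr0; exact: is_derive_cst.
- apply: (@near_eq_is_derive _ _ _ (fun t : R => t ^+ 2)).
    near=> t; rewrite max_l//; apply: ltW; near: t; exact: lt_nbhsr.
  apply: (@near_eq_is_derive _ _ _ (fun t : R => t * t)).
    by near=> t; rewrite expr2.
  apply: (is_derive_eq (is_deriveM (is_derive_id z 1) (is_derive_id z 1))).
  by rewrite /GRing.scale/= mulr1 mulr_natl mulr2n.
- rewrite z0 mulr0.
  have cv : h^-1 *: (Num.max (h *: (1:R) + 0) 0 ^+ 2 - Num.max (0:R) 0 ^+ 2)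
      @[h --> (0:R)^'] --> (0:R).
    apply/cvgr0Pnorm_lt => e e0; near=> h.
    rewrite maxxx expr0n/= subr0 addr0 /GRing.scale/= mulr1.
    have h0 : h != 0 by near: h; exact: nbhs_dnbhs_neq.
    have he : `|h| < e by near: h; exact: dnbhs0_lt.
    apply: le_lt_trans he; rewrite normrM normfV normrX ler_pdivrMl ?normr_gt0//.
    rewrite -expr2; apply: lerXn2r; rewrite ?nnegrE//.
    by case: (leP h 0) => h1; rewrite ?normr0.
  split; first by apply/cvg_ex; exists 0.
  exact: cvg_lim cv.
Unshelve. all: by end_near. Qed.

(* The square of the positive part of [d] is C^1 and nondecreasing. *)
Lemma positive_part_growth (R : realType) (d dd : R -> R) (a b : R) :
  a <= b -> (forall x, a <= x <= b -> is_derive x 1 d (dd x)) ->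
  (forall x, a < x < b -> 0 < d x -> 0 <= dd x) -> 0 < d a -> d a <= d b.
Proof.
move=> ab dP dd0 da.
have : Num.max (d a) 0 ^+ 2 <= Num.max (d b) 0 ^+ 2.
  apply: (@ge0_is_derive_le _ (fun t => Num.max (d t) 0 ^+ 2)
    (fun t => 2 * Num.max (d t) 0 * dd t)) => // x xab.
    have dx := dP _ xab.
    exact: (is_derive1_comp (is_derive_sqr_max0 (d x)) dx).
  case: (ltP 0 (d x)) => dx; last by rewrite mulr0 mul0r.
  by rewrite mulr_ge0 ?dd0// mulr_ge0// ltW.
rewrite (max_l (ltW da)) ler_sqr ?nnegrE ?(ltW da)//; last first.
  by rewrite le_max lexx orbT.
by rewrite le_max => /orP[//|]; rewrite leNgt da.
Qed.

(* The first time [d] reaches [0], its left difference quotients are positive. *)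
Lemma ge0_derive_at_crossing (R : realType) (d dd : R -> R) (a b : R) :
  a < b -> (forall x, a <= x <= b -> is_derive x 1 d (dd x)) ->
  d a < 0 -> 0 <= d b ->
  exists2 x, a < x <= b & d x = 0 /\ 0 <= dd x.
Proof.
move=> ab dP da db.
have dc x : a <= x <= b -> {for x, continuous d}.
  by move=> /dP; exact: is_derive_continuous.
pose E := [set x | a <= x <= b /\ forall y, a <= y <= x -> d y < 0].
have Ea : E a.
  split; first by rewrite lexx ltW.
  by move=> y; rewrite -eq_le => /eqP <-.
have Eb : ubound E b by move=> x [/andP[]].
have supE : has_sup E by split; [exists a|exists b].
pose x := sup E.
have ax : a <= x by apply: ub_le_sup => //; exists b.
have xb : x <= b by apply: ge_sup => //; exists a.
have neg y : a <= y < x -> d y < 0.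
  move=> /andP[ay yx].
  have [z [_ Ez] yz] := sup_adherent (ltac:(rewrite subr_gt0; exact: yx) : 0 < x - y) supE.
  apply: Ez; rewrite ay /=; apply: ltW; apply: le_lt_trans yz.
  by rewrite /x; lra.
have axb : a <= x <= b by rewrite ax.
have dx0 : d x = 0.
  apply/eqP; rewrite eq_le; apply/andP; split; last first.
  - rewrite leNgt; apply/negP => dxn.
    have xltb : x < b.
      rewrite lt_neqAle xb andbT; apply/eqP => xbE.
      by move: dxn; rewrite xbE ltNge db.
    have [e /= e0 He] : nbhs x [set t | d t < 0].
      exact: (dc x axb _ (lt_nbhsl dxn)).
    pose t := Num.min b (x + e / 2).
    have xt : x < t by rewrite lt_min xltb ltrDl divr_gt0.
    have : t <= x.
      apply: ub_le_sup; first by exists b.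
      split; first by rewrite (le_trans ax (ltW xt)) ge_min lexx.
      move=> y /andP[ay yt]; case: (ltP y x) => yx; first by apply: neg; rewrite ay.
      apply: He => /=; rewrite distrC ger0_norm ?subr_ge0//.
      have := le_trans yt (ltac:(by rewrite ge_min lexx orbT) : t <= x + e / 2).
      by move=> h; lra.
    by rewrite leNgt xt.
  - rewrite leNgt; apply/negP => dxp.
    have xgta : a < x.
      rewrite lt_neqAle ax andbT; apply/eqP => xaE.
      by move: dxp; rewrite -xaE ltNge ltW.
    have [e /= e0 He] : nbhs x [set t | 0 < d t].
      exact: (dc x axb _ (lt_nbhsr dxp)).
    pose t := Num.max a (x - e / 2).
    have tx : t < x by rewrite gt_max xgta /=; lra.
    have at_ : a <= t by rewrite le_max lexx.
    have := neg t; rewrite at_ tx => /(_ isT).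
    apply/negP; rewrite -leNgt; apply: ltW; apply: He => /=.
    rewrite ger0_norm ?subr_ge0 ?(ltW tx)//.
    have : x - e / 2 <= t by rewrite le_max lexx orbT.
    by move=> h; lra.
have xgta : a < x.
  by rewrite lt_neqAle ax andbT; apply/eqP => xaE; move: da; rewrite xaE dx0 ltxx.
exists x; first by rewrite xgta.
split => //.
have [dd1 <-] := dP x axb.
rewrite ['D_1 d x]cvg_at_leftE; last exact: dd1.
apply: limr_ge.
  exact: cvgP (cvg_dnbhs_at_left dd1).
near=> h.
have h0 : h < 0 by near: h; exact: nbhs_left_lt.
have h1 : a - x < h by near: h; apply: nbhs_left_gt; rewrite subr_lt0.
rewrite dx0 subr0 /GRing.scale/= mulr1.
have dn : d (h + x) <= 0 by apply: ltW; apply: neg; apply/andP; split; lra.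
by rewrite nmulr_rge0// invr_lt0.
Unshelve. all: by end_near. Qed.

(** * Bernoulli's and Young's inequalities *)

(** With [z] the right-hand side, the strict tangent bound [ln s < s - 1] is applied at [z^-1] and
    at [t / z]. Weighted by [1 - th] and [th], the tangent values sum to 0 and the logarithms to
    [th ln t - ln z]. *)
Lemma bernoulli_powR_lt (R : realType) (t th : R) :
  0 < t -> t != 1 -> 0 < th < 1 -> t `^ th < 1 + th * (t - 1).
Proof.
move=> t0 t1 /andP[th0 th1].
pose z := 1 + th * (t - 1).
have z0 : 0 < z by rewrite /z; nra.
have lnlt (s : R) : 0 < s -> s != 1 -> ln s < s - 1.
  move=> s0 s1; rewrite -ltr_expR lnK ?posrE//.
  have := @expR_gt1Dx R (s - 1) (ltac:(by rewrite subr_eq0)).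
  by rewrite addrC subrK.
have tz : t / z != 1.
  rewrite -subr_eq0 -[1](divff (lt0r_neq0 z0)) -mulrBl mulf_neq0 ?invr_neq0 ?(gt_eqF z0)//.
  have -> : t - z = (1 - th) * (t - 1) by rewrite /z; ring.
  by rewrite mulf_neq0// subr_eq0 // gt_eqF.
have z1 : z^-1 != 1.
  by rewrite invr_eq1 /z -subr_eq0 addrAC subrr add0r mulf_neq0 ?(gt_eqF th0)// subr_eq0.
have h1 := lnlt _ (ltac:(by rewrite invr_gt0) : 0 < z^-1) z1.
have h2 := lnlt _ (divr_gt0 t0 z0) tz.
rewrite -[X in X < _]lnK ?posrE ?powR_gt0// -[X in _ < X]lnK ?posrE//.
rewrite ltr_expR ln_powR.
rewrite lnV ?posrE// in h1; rewrite ln_div ?posrE// in h2.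
have : (1 - th) * (z^-1 - 1) + th * (t / z - 1) = 0.
  have -> : (1 - th) * (z^-1 - 1) + th * (t / z - 1) = z / z - 1.
    by rewrite /z; ring.
  by rewrite divff ?subrr// lt0r_neq0.
move: h1 h2; set a := ln z; set b := ln t; rewrite -/z -/a => h1 h2 h3.
nra.
Qed.

Lemma bernoulli_powR (R : realType) (t th : R) :
  0 < t -> 0 < th < 1 -> t `^ th <= 1 + th * (t - 1).
Proof.
move=> t0 th01; have [->|t1] := eqVneq t 1; last by rewrite ltW// bernoulli_powR_lt.
by rewrite powR1 subrr mulr0 addr0.
Qed.

(** Dividing [b] by its value in the equality case, [t = b / ((p - 1) a)], factors [p a] out of both
    sides and leaves Bernoulli's inequality with exponent [(p - 1) / p]. Its strict form identifies
    the equality case, on which the uniqueness of the maximizer rests. *)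
Lemma young_powR (R : realType) (p a b : R) : 1 < p -> 0 < a -> 0 < b ->
  p / (p - 1) `^ ((p - 1) / p) * (a `^ (1 / p) * b `^ ((p - 1) / p)) <= a + b
  ?= iff (b == (p - 1) * a).
Proof.
move=> p1 a0 b0.
have p0 : 0 < p by rewrite (lt_trans _ p1).
have pm0 : 0 < p - 1 by rewrite subr_gt0.
have th01 : 0 < (p - 1) / p < 1.
  by rewrite divr_gt0//= ltr_pdivrMr// mul1r; lra.
pose t := b / ((p - 1) * a).
have t0 : 0 < t by rewrite divr_gt0// mulr_gt0.
have bE : b = (p - 1) * a * t.
  by rewrite /t mulrCA mulfV ?mulr1// gt_eqF// mulr_gt0.
have -> : p / (p - 1) `^ ((p - 1) / p) * (a `^ (1 / p) * b `^ ((p - 1) / p))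
    = p * a * t `^ ((p - 1) / p).
  rewrite {1}bE (powRM _ (mulr_ge0 (ltW pm0) (ltW a0)) (ltW t0)) (powRM _ (ltW pm0) (ltW a0)).
  have -> : a `^ (1 / p) * ((p - 1) `^ ((p - 1) / p) * a `^ ((p - 1) / p) *
     t `^ ((p - 1) / p)) = (a `^ (1 / p) * a `^ ((p - 1) / p)) *
     (p - 1) `^ ((p - 1) / p) * t `^ ((p - 1) / p) by ring.
  rewrite -powRD ?(gt_eqF a0) ?implybT//.
  have -> : 1 / p + (p - 1) / p = 1 by field; rewrite gt_eqF.
  rewrite powRr1 ?ltW//; field.
  by rewrite gt_eqF// powR_gt0.
have -> : a + b = p * a * (1 + (p - 1) / p * (t - 1)).
  by rewrite {1}bE; field; rewrite gt_eqF.
have -> : (b == (p - 1) * a) = (t == 1).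
  rewrite {1}bE -[X in _ == X]mulr1 (inj_eq (mulfI _))//.
  by rewrite gt_eqF// mulr_gt0.
have pa0 : 0 < p * a by rewrite mulr_gt0.
split; first by rewrite ler_pM2l// bernoulli_powR.
rewrite (inj_eq (mulfI _)) ?(gt_eqF pa0)//.
have [->|t1] := eqVneq t 1; first by rewrite powR1 subrr mulr0 addr0 eqxx.
by rewrite lt_eqF// bernoulli_powR_lt.
Qed.

(** [f] may fail to be integrable at [a] and [b], so primitives are built on compact intervals and
    glued. [G x] is a primitive on an interval around both [x] and [c], normalized at [c]; two of
    them agree where they overlap, so the diagonal [G x x] is a primitive throughout. *)
Lemma continuous_primitive (R : realType) (f : R -> R) (a b c : R) :
  a < c < b -> (forall x, a < x < b -> {for x, continuous f}) ->
  exists2 F : R -> R, F c = 0 & forall x, a < x < b -> is_derive x 1 F (f x).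
Proof.
move=> /andP[ac cb] fc.
have local (l r : R) : a < l -> l < c -> c < r -> r < b ->
    exists F : R -> R, F c = 0 /\ forall x, l < x < r -> is_derive x 1 F (f x).
  move=> al lc cr rb.
  have fw : {within `[l, r], continuous f}.
    apply: continuous_in_subspaceT => x; rewrite inE/= in_itv/= => /andP[lx xr].
    by apply: fc; rewrite (lt_le_trans al lx) (le_lt_trans xr rb).
  pose F x := (\int[@lebesgue_measure R]_(t in `[l, x]) f t)%R.
  exists (fun x => F x - F c); split; first by rewrite subrr.
  move=> x /andP[lx xr].
  have [] := @continuous_FTC1_closed R f l x r xr _ lx _.
  - apply: continuous_compact_integrable => //; exact: segment_compact.
  - by apply: fc; rewrite (lt_trans al lx) (lt_trans xr rb).
  move=> dF Fx.
  have h : is_derive x 1 F (f x) by constructor; [exact: dF|rewrite -derive1E].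
  apply: (is_derive_eq (is_deriveB h (is_derive_cst (F c) x 1))).
  by rewrite subr0.
pose lb x := (a + Num.min x c) / 2; pose rb x := (b + Num.max x c) / 2.
have P x : exists F : R -> R, a < x < b -> F c = 0 /\
    forall y, lb x < y < rb x -> is_derive y 1 F (f y).
  case: (boolP (a < x < b)) => [/andP[ax xb]|_]; last by exists f.
  have [|||| F HF] := local (lb x) (rb x).
  - by rewrite /lb; case: (lerP x c); lra.
  - by rewrite /lb; case: (lerP x c); lra.
  - by rewrite /rb; case: (lerP x c); lra.
  - by rewrite /rb; case: (lerP x c); lra.
  by exists F.
have [G GP] := choice P.
have lbx x : a < x < b -> lb x < x < rb x.
  by move=> axb; rewrite /lb /rb; case: (lerP x c); lra.
have lbc x : a < x < b -> lb x < c < rb x.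
  by move=> axb; rewrite /lb /rb; case: (lerP x c); lra.
have GE x y : a < x < b -> a < y < b -> lb x < y < rb x -> G x y = G y y.
  move=> xab yab xy.
  have [Gx0 Gx] := GP _ xab; have [Gy0 Gy] := GP _ yab.
  have : G x y - G y y = G x c - G y c.
    apply: (@is_derive_eq0_cst _ (fun z => G x z - G y z)
      (Num.max (lb x) (lb y)) (Num.min (rb x) (rb y))).
    - move=> z; rewrite gt_max lt_min => /andP[/andP[h1 h2] /andP[h3 h4]].
      rewrite -(subrr (f z)); apply: is_deriveB; first by apply: Gx; rewrite h1.
      by apply: Gy; rewrite h2.
    - by rewrite gt_max lt_min; have := lbx _ yab; lra.
    - by rewrite gt_max lt_min; have := lbc _ yab; have := lbc _ xab; lra.
  by rewrite Gx0 Gy0 subrr => /eqP; rewrite subr_eq0 => /eqP.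
exists (fun x => G x x); first by have [] := GP c (ltac:(by rewrite ac)).
move=> x xab; have [_ Gx] := GP _ xab.
have /andP[h1 h2] := lbx _ xab; have /andP[h3 h4] := xab.
apply: (@near_eq_is_derive _ _ _ (G x)); last by apply: Gx; exact: lbx.
near=> y; apply: GE => //; apply/andP; split; near: y.
- exact: lt_nbhsr.
- exact: lt_nbhsl.
- exact: lt_nbhsr.
- exact: lt_nbhsl.
Unshelve. all: by end_near. Qed.

(** * Integrals over compact intervals and over the open unit interval *)

Lemma integral_cc_FTC2 (R : realType) (f F : R -> R) (a b : R) : a < b ->
  (forall x, a <= x <= b -> {for x, continuous f}) ->
  (forall x, a <= x <= b -> is_derive x 1 F (f x)) ->
  (\int[@lebesgue_measure R]_(x in `[a, b]) (f x)%:E = (F b - F a)%:E)%E.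
Proof.
move=> ab fc FP; rewrite (@continuous_FTC2 R f F)//.
- apply: continuous_in_subspaceT => x; rewrite inE/= in_itv/=; exact: fc.
- have Fc x : a <= x <= b -> {for x, continuous F}.
    by move=> /FP; exact: is_derive_continuous.
  split.
  + by move=> x; rewrite in_itv/= => /andP[ax xb]; have [] := FP x (ltac:(by rewrite !ltW)).
  + by apply: cvg_at_right_filter; apply: Fc; rewrite lexx ltW.
  + by apply: cvg_at_left_filter; apply: Fc; rewrite lexx ltW.
- move=> x; rewrite in_itv/= => /andP[ax xb].
  by rewrite derive1E; have [_ ->] := FP x (ltac:(by rewrite !ltW)).
Qed.

(** The shift by 3 keeps the value at most 1/3, so that the intervals
    [[oo_exhaust R n, 1 - oo_exhaust R n]] are never degenerate. *)
Definition oo_exhaust (R : realType) (n : nat) : R := n.+3%:R^-1.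
Arguments oo_exhaust R n : clear implicits.

Lemma oo_exhaust_bound (R : realType) n :
  0 < oo_exhaust R n < 1 - oo_exhaust R n /\ 1 - oo_exhaust R n < 1.
Proof.
have h0 : 0 < oo_exhaust R n by rewrite invr_gt0 ltr0n.
have h1 : oo_exhaust R n <= 3^-1.
  by rewrite /oo_exhaust lef_pV2 ?posrE ?ltr0n// ler_nat.
by split; [apply/andP; split|]; lra.
Qed.

Lemma oo_exhaust_cvg (R : realType) : oo_exhaust R n @[n --> \oo] --> (0:R)^'+.
Proof.
move=> A [e /= e0 eA].
have h := @cvg_harmonic R; move/cvgrPdist_lt : h => /(_ e e0) [N _ HN].
exists N => // n Nn; apply: eA => /=; last first.
  by have [/andP[]] := oo_exhaust_bound R n.
have := HN n.+2 (ltac:(by rewrite /= !leqW)).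
by rewrite /harmonic /=.
Qed.

Lemma integral_oo_cvg (R : realType) (f : R -> R) :
  (forall x : R, 0 < x < 1 -> {for x, continuous f}) ->
  (forall x : R, 0 < x < 1 -> 0 <= f x) ->
  (\int[@lebesgue_measure R]_(x in `[oo_exhaust R n, (1 - oo_exhaust R n)%R])
     (f x)%:E @[n --> \oo] -->
   \int[@lebesgue_measure R]_(x in `]0%R, 1%R[) (f x)%:E)%E.
Proof.
move=> fc f0.
have -> : `]0%R, 1%R[%classic =
    \bigcup_n `[oo_exhaust R n, (1 - oo_exhaust R n)%R]%classic.
  apply/seteqP; split => [x|x [n _]] /=; rewrite !in_itv/=.
    move=> /andP[x0 x1].
    have : \forall n \near \oo, oo_exhaust R n < Num.min x (1 - x).
      apply: (@oo_exhaust_cvg R [set y | y < _]); apply: nbhs_right_lt.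
      by rewrite lt_min x0 subr_gt0.
    move=> [N _ /(_ N (leqnn N))] /=; rewrite lt_min => /andP[h1 h2].
    by exists N => //=; rewrite in_itv/=; apply/andP; split; lra.
  have [/andP[h1 h2] h3] := oo_exhaust_bound R n.
  by move=> /andP[h4 h5]; apply/andP; split; lra.
have sub n x : x \in `[oo_exhaust R n, (1 - oo_exhaust R n)%R] -> 0 < x < 1.
  have [/andP[h1 h2] h3] := oo_exhaust_bound R n.
  by rewrite in_itv/= => /andP[h4 h5]; apply/andP; split; lra.
apply: ge0_nondecreasing_set_cvg_integral.
- move=> m n mn; rewrite subsetEset; apply: subset_itv; rewrite bnd_simp.
    by rewrite lef_pV2 ?posrE ?ltr0n// ler_nat.
  by rewrite lerD2l lerN2 lef_pV2 ?posrE ?ltr0n// ler_nat.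
- by move=> n; exact: measurable_itv.
- move=> n; apply/measurable_EFinP; apply: subspace_continuous_measurable_fun => //.
  by apply: continuous_in_subspaceT => x; rewrite inE/= => /sub; exact: fc.
- by move=> n x /= /sub /f0; rewrite lee_fin.
Qed.

Lemma integral_oo_FTC2 (R : realType) (f F : R -> R) (l r : R) :
  (forall x : R, 0 < x < 1 -> {for x, continuous f}) ->
  (forall x : R, 0 < x < 1 -> 0 <= f x) ->
  (forall x : R, 0 < x < 1 -> is_derive x 1 F (f x)) ->
  F x @[x --> (0:R)^'+] --> l -> F x @[x --> (1:R)^'-] --> r ->
  (\int[@lebesgue_measure R]_(x in `]0%R, 1%R[) (f x)%:E = (r - l)%:E)%E.
Proof.
move=> fc f0 FP Fl Fr.
apply: (cvg_unique _ (integral_oo_cvg fc f0)); first exact: ereal_hausdorff.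
have e_l : F (oo_exhaust R n) @[n --> \oo] --> l.
  exact: cvg_comp (@oo_exhaust_cvg R) Fl.
have e_r : F (1 - oo_exhaust R n) @[n --> \oo] --> r.
  apply: cvg_comp Fr; move=> A [e /= e0 eA].
  have : \forall n \near \oo, oo_exhaust R n < e.
    by apply: (@oo_exhaust_cvg R [set y | y < _]); exact: nbhs_right_lt.
  move=> [N _ HN]; exists N => // n /HN /= h; apply: eA => /=.
    have [/andP[h1 h2] h3] := oo_exhaust_bound R n.
    by rewrite opprB addrC subrK gtr0_norm.
  by have [/andP[h1 h2] h3] := oo_exhaust_bound R n.
have -> : (fun n => \int[@lebesgue_measure R]_(x in `[oo_exhaust R n, (1 - oo_exhaust R n)%R]) (f x)%:E)%E
    = EFin \o (fun n => F (1 - oo_exhaust R n) - F (oo_exhaust R n)).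
  apply/funext => n /=; have [/andP[h1 h2] h3] := oo_exhaust_bound R n.
  apply: integral_cc_FTC2 => // x /andP[h4 h5].
    by apply: fc; apply/andP; split; lra.
  by apply: FP; apply/andP; split; lra.
by apply: cvg_EFin; [exact: nearW|exact: cvgB].
Qed.

(** Both integrals may be infinite, so they are not subtracted. On each compact interval of the
    exhaustion they differ by an increment of [Q], eventually at most [e]; only the combined
    boundary contribution is controlled, not the limits of [Q] separately. *)
Lemma integral_oo_le (R : realType) (f g Q : R -> R) :
  (forall x : R, 0 < x < 1 -> {for x, continuous f}) ->
  (forall x : R, 0 < x < 1 -> 0 <= f x) ->
  (forall x : R, 0 < x < 1 -> {for x, continuous g}) ->
  (forall x : R, 0 < x < 1 -> 0 <= g x) ->
  (forall x : R, 0 < x < 1 -> is_derive x 1 Q (f x - g x)) ->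
  (forall e, 0 < e ->
     \forall x \near (0:R)^'+, Q (1 - x) - Q x <= e) ->
  (\int[@lebesgue_measure R]_(x in `]0%R, 1%R[) (f x)%:E <=
   \int[@lebesgue_measure R]_(x in `]0%R, 1%R[) (g x)%:E)%E.
Proof.
move=> fc f0 gc g0 QP Qe; apply/lee_addgt0Pr => e e0.
have [G _ GP] := @continuous_primitive R g 0 1 2^-1 (ltac:(apply/andP; split; lra)) gc.
apply: (@cvge_le _ _ _ _ _ _ _ _ (integral_oo_cvg fc f0)).
have [N _ HN] := @oo_exhaust_cvg R _ (Qe _ e0).
exists N => // n /HN /= QN.
have [/andP[h1 h2] h3] := oo_exhaust_bound R n.
have sub x : oo_exhaust R n <= x <= 1 - oo_exhaust R n -> 0 < x < 1.
  by move=> /andP[h4 h5]; apply/andP; split; lra.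
have GQP x : oo_exhaust R n <= x <= 1 - oo_exhaust R n ->
    is_derive x 1 (fun x => G x + Q x) (f x).
  move=> /sub xx; rewrite -(subrK (g x) (f x)) addrC.
  by apply: is_deriveD; [exact: GP|exact: QP].
rewrite (integral_cc_FTC2 h2 (fun x h => fc x (sub x h)) GQP).
apply: (@le_trans _ _ (\int[@lebesgue_measure R]_(x in `[oo_exhaust R n, (1 - oo_exhaust R n)%R]) (g x)%:E + e%:E)%E).
  rewrite (integral_cc_FTC2 h2 (fun x h => gc x (sub x h)) (fun x h => GP x (sub x h))).
  by rewrite -EFinD lee_fin; lra.
rewrite leeD2r//; apply: ge0_subset_integral => //.
- apply/measurable_EFinP; apply: open_continuous_measurable_fun => //.
  by move=> x; rewrite inE/= in_itv/=; exact: gc.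
Qed.

Lemma integral_oo_ge (R : realType) (f q Q : R -> R) (a b : R) :
  (forall x : R, 0 < x < 1 -> {for x, continuous f}) ->
  (forall x : R, 0 < x < 1 -> 0 <= f x) ->
  0 < a -> a < b -> b < 1 ->
  (forall x, a <= x <= b -> {for x, continuous q}) ->
  (forall x, a <= x <= b -> 0 <= q x <= f x) ->
  (forall x, a <= x <= b -> is_derive x 1 Q (q x)) ->
  ((Q b - Q a)%:E <= \int[@lebesgue_measure R]_(x in `]0%R, 1%R[) (f x)%:E)%E.
Proof.
move=> fc f0 a0 ab b1 qc qf QP.
have sub x : a <= x <= b -> 0 < x < 1.
  by move=> /andP[h4 h5]; apply/andP; split; lra.
rewrite -(integral_cc_FTC2 ab qc QP).
apply: (@le_trans _ _ (\int[@lebesgue_measure R]_(x in `[a, b]) (f x)%:E)%E).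
  apply: ge0_le_integral => //.
  - by move=> x /=; rewrite in_itv/= lee_fin => /qf /andP[].
  - apply/measurable_EFinP; apply: subspace_continuous_measurable_fun => //.
    by apply: continuous_in_subspaceT => x; rewrite inE/= in_itv/=; exact: qc.
  - apply/measurable_EFinP; apply: subspace_continuous_measurable_fun => //.
    by apply: continuous_in_subspaceT => x; rewrite inE/= in_itv/= => /sub; exact: fc.
  - by move=> x /=; rewrite in_itv/= lee_fin => /qf /andP[].
apply: ge0_subset_integral => //.
- apply/measurable_EFinP; apply: open_continuous_measurable_fun => //.
  by move=> x; rewrite inE/= in_itv/=; exact: fc.
Qed.

(** * A singular equation solved backward *)

Lemma geometric_small (R : realType) (b e : R) : 0 < e ->
  exists n : nat, b / 2 ^+ n < e.
Proof.
move=> e0; pose n := Num.bound `|b / e|.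
exists n; rewrite ltr_pdivrMr ?exprn_gt0// mulrC -ltr_pdivrMr//.
have h : b / e < n%:R by rewrite (le_lt_trans (ler_norm _))//; exact: archi_boundP.
by rewrite (lt_trans h)// -natrX ltr_nat ltn_expl.
Qed.

(** The intervals of radius [b / 2 ^ n] around [u n] are nested, and the supremum of their left ends
    lies in all of them. This gives the limit together with its rate. *)
Lemma geometric_cauchy (R : realType) (u : nat -> R) (b : R) : 0 <= b ->
  (forall n, `|u n.+1 - u n| <= b / 2 ^+ n.+1) ->
  exists l, forall n, `|l - u n| <= b / 2 ^+ n.
Proof.
move=> b0 ub.
have half n : b / 2 ^+ n = 2 * (b / 2 ^+ n.+1).
  by rewrite exprS invfM; field; rewrite expf_neq0.
pose v n := u n - b / 2 ^+ n; pose w n := u n + b / 2 ^+ n.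
have vS n : v n <= v n.+1.
  rewrite /v half; have := ub n; rewrite ler_norml => /andP[]; lra.
have wS n : w n.+1 <= w n.
  rewrite /w (half n); have := ub n; rewrite ler_norml => /andP[]; lra.
have vn : {homo v : i j / (i <= j)%N >-> i <= j}.
  by apply: homo_leq => //; exact: le_trans.
have wn : {homo w : i j / (i <= j)%N >-> j <= i}.
  by apply: homo_leq => //; move=> y x z h1 h2; exact: le_trans h2 h1.
have bn n : 0 <= b / 2 ^+ n by rewrite divr_ge0// exprn_ge0.
have vw i j : v i <= w j.
  apply: (@le_trans _ _ (v (maxn i j))); first by apply: vn; exact: leq_maxl.
  apply: (@le_trans _ _ (w (maxn i j))); last by apply: wn; exact: leq_maxr.
  by rewrite /v /w; have := bn (maxn i j); lra.
exists (sup (range v)) => n.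
have h1 : v n <= sup (range v).
  apply: ub_le_sup; last by exists n.
  by exists (w n) => _ [i _ <-]; exact: vw.
have h2 : sup (range v) <= w n.
  by apply: ge_sup; [exists (v 0); exists 0|move=> _ [i _ <-]; exact: vw].
by rewrite ler_norml; apply/andP; split; rewrite /v /w in h1 h2; lra.
Qed.

Lemma geometric_limit_continuous (R : realType) (Y : nat -> R -> R) (Z : R -> R)
    (B a b x : R) : a < x < b ->
  (forall n t, a < t < b -> `|Z t - Y n t| <= B / 2 ^+ n) ->
  (forall n, {for x, continuous (Y n)}) -> {for x, continuous Z}.
Proof.
move=> axb ZY Yc; apply/cvgrPdist_lt => e e0.
have e3 : 0 < e / 3 by rewrite divr_gt0.
have [n Hn] := geometric_small B e3.
have := Yc n; move/cvgrPdist_lt => /(_ _ e3) Hc.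
have bnd t : a < t < b -> `|Z t - Y n t| < e / 3.
  by move=> /ZY h; exact: le_lt_trans Hn.
have /andP[ax xb] := axb.
near=> t.
have h1 := bnd x axb.
have h2 : `|Z t - Y n t| < e / 3.
  by apply: bnd; apply/andP; split; near: t; [exact: lt_nbhsr|exact: lt_nbhsl].
have h3 : `|Y n x - Y n t| < e / 3 by near: t; exact: Hc.
have -> : Z x - Z t = (Z x - Y n x) + (Y n x - Y n t) - (Z t - Y n t) by ring.
rewrite (le_lt_trans (ler_normB _ _))//.
have := ler_normD (Z x - Y n x) (Y n x - Y n t).
by lra.
Unshelve. all: by end_near. Qed.

Lemma is_derive_expR_weight (R : realType) (c l x : R) :
  is_derive x 1 (fun x => expR (l * (c - x))) (- l * expR (l * (c - x))).
Proof.
have h : is_derive x 1 (fun x => l * (c - x)) (- l).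
  apply: (is_derive_eq (is_deriveZ l (is_deriveB (is_derive_cst c x 1) (is_derive_id x 1)))).
  by rewrite sub0r /GRing.scale/= mulrN1.
apply: (is_derive_eq (is_derive1_comp (is_derive_expR _) h)).
by rewrite mulrC.
Qed.

(** One Picard step in an exponentially weighted norm. Integrating the bound on [dd] divides by the
    rate [2 L], twice the Lipschitz constant, so each step halves the bound whatever the length of
    the interval. *)
Lemma exponential_bound (R : realType) (d dd : R -> R) (B L x c : R) :
  x <= c -> d c = 0 -> 0 <= B ->
  (forall t, x <= t <= c -> is_derive t 1 d (dd t)) ->
  (forall t, x <= t <= c -> `|dd t| <= L * B * expR (2 * L * (c - t))) ->
  `|d x| <= B / 2 * expR (2 * L * (c - x)).
Proof.
move=> xc dc B0 dP ddB.
pose E t := B / 2 * expR (2 * L * (c - t)).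
have EP (t : R) : is_derive t 1 E (- (L * B * expR (2 * L * (c - t)))).
  apply: (is_derive_eq (is_deriveZ (B / 2) (is_derive_expR_weight c (2 * L) t))).
  by rewrite /GRing.scale/=; field.
have Ec : 0 <= E c by rewrite /E mulr_ge0 ?divr_ge0// expR_ge0.
have sub t : x < t < c -> x <= t <= c by move=> /andP[h1 h2]; rewrite !ltW.
rewrite ler_norml; apply/andP; split.
- have : (E + d) c <= (E + d) x.
    apply: (@le0_is_derive_ge _ (E + d)
       (fun t => - (L * B * expR (2 * L * (c - t))) + dd t)) => [//|t|t].
      by move=> /dP h; apply: is_deriveD.
    by move=> /sub /ddB; rewrite ler_norml => /andP[]; lra.
  by rewrite !fctE dc; rewrite /E in Ec *; lra.
- have : (E - d) c <= (E - d) x.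
    apply: (@le0_is_derive_ge _ (E - d)
       (fun t => - (L * B * expR (2 * L * (c - t))) - dd t)) => [//|t|t].
      by move=> /dP h; apply: is_deriveB.
    by move=> /sub /ddB; rewrite ler_norml => /andP[]; lra.
  by rewrite !fctE dc; rewrite /E in Ec *; lra.
Qed.

(* Freezing the argument at [min x c] lets the solution be differentiable on
   both sides of [c] while only the estimates to the left of [c] matter. *)
Lemma picard_backward (R : realType) (G : R -> R -> R) (L M y0 a b c : R) :
  a < c < b -> 0 < L ->
  (forall y : R -> R, (forall x, a < x < b -> {for x, continuous y}) ->
     forall x, a < x < b -> {for x, continuous (fun x => G x (y x))}) ->
  (forall x s t, `|G x s - G x t| <= L * `|s - t|) ->
  (forall x, `|G x y0| <= M) ->
  exists2 y : R -> R, y c = y0 &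
    forall x, a < x <= c -> is_derive x 1 y (G x (y x)).
Proof.
move=> /andP[ac cb] L0 Gc GL GM.
pose ok (y : R -> R) := forall x, a < x < b -> {for x, continuous y}.
have minc (y : R -> R) : ok y -> ok (fun x => y (Num.min x c)).
  move=> yc x /andP[ax xb].
  apply: (@continuous_comp _ _ _ (fun x => Num.min x c) y); last first.
    apply: yc; rewrite lt_min ax ac/= gt_min cb orbT//.
  have -> : (fun x : R => Num.min x c) = (fun x : R => Num.min (idfun x) (cst c x)) by [].
  by apply: continuous_min; [exact: cvg_id|exact: cvg_cst].
have TP (y : R -> R) : exists Ty : R -> R, ok y ->
   Ty c = y0 /\ forall x, a < x < b -> is_derive x 1 Ty (G x (y (Num.min x c))).
  case: (pselect (ok y)) => [yc|]; last by exists y.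
  have [F F0 FP] := @continuous_primitive R (fun x => G x (y (Num.min x c))) a b c
    (ltac:(by rewrite ac)) (Gc _ (minc _ yc)).
  exists (fun x => F x + y0) => _; split; first by rewrite F0 add0r.
  move=> x /FP h; apply: (is_derive_eq (is_deriveD h (is_derive_cst y0 x 1))).
  by rewrite addr0.
have [T HT] := choice TP.
have okT y : ok y -> ok (T y).
  by move=> /HT [_ h] x /h; exact: is_derive_continuous.
pose Y n := iter n T (cst y0).
have okY n : ok (Y n).
  by elim: n => [|n IH]; [move=> x _; exact: cvg_cst|exact: okT].
pose E x := expR (2 * L * (c - x)).
have E1 x : x <= c -> 1 <= E x.
  by move=> xc; rewrite -expR0 /E ler_expR mulr_ge0// ?subr_ge0// mulr_ge0// ltW.
have M0 : 0 <= M by exact: le_trans (GM c).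
(* The first increment has slope at most [M = L B], the form required to start the halving. *)
pose B := M / L.
have B0 : 0 <= B by rewrite divr_ge0// ltW.
have stepB n x : a < x <= c -> `|Y n.+1 x - Y n x| <= B * E x / 2 ^+ n.+1.
  elim: n x => [|n IH] x /andP[ax xc].
    have [Y1c Y1P] := HT _ (okY 0).
    have -> : B * E x / 2 ^+ 1 = B / 2 * E x by rewrite expr1; field.
    apply: (@exponential_bound _ (fun x => Y 1 x - Y 0 x)
      (fun x => G x y0 - 0)); [exact: xc| |exact: B0| |].
    - by rewrite [Y 1 c]Y1c subrr.
    - move=> t /andP[xt tc]; apply: is_deriveB.
        by apply: Y1P; rewrite (lt_le_trans ax xt) (le_lt_trans tc cb).
    - move=> t /andP[xt tc]; rewrite subr0 (le_trans (GM _))//.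
      rewrite /B mulrCA mulfV ?gt_eqF// mulr1 ler_peMr//; exact: E1.
  have [Y1c Y1P] := HT _ (okY n); have [Y2c Y2P] := HT _ (okY n.+1).
  have -> : B * E x / 2 ^+ n.+2 = (B / 2 ^+ n.+1) / 2 * E x.
    by rewrite (exprS _ n.+1); field; rewrite expf_neq0.
  have dom t : x <= t -> t <= c -> a < t < b.
    by move=> xt tc; rewrite (lt_le_trans ax xt) (le_lt_trans tc cb).
  apply: (@exponential_bound _ (fun x => Y n.+2 x - Y n.+1 x)
      (fun x => G x (Y n.+1 (Num.min x c)) - G x (Y n (Num.min x c)))); [exact: xc| | | |].
  - by rewrite [Y n.+1 c]Y1c [Y n.+2 c]Y2c subrr.
  - by rewrite divr_ge0 ?exprn_ge0.
  - by move=> t /andP[xt tc]; apply: is_deriveB; [apply: Y2P|apply: Y1P]; exact: dom.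
  - move=> t /andP[xt tc]; rewrite (min_l tc) (le_trans (GL _ _ _))//.
    rewrite -mulrA ler_pM2l// mulrAC; apply: IH.
    by rewrite tc andbT (lt_le_trans ax).
have limP x : exists l, a < x <= c -> forall n, `|l - Y n x| <= B * E x / 2 ^+ n.
  case: (boolP (a < x <= c)) => [axc|]; last by exists 0.
  have [|l lP] := @geometric_cauchy _ (fun n => Y n x) (B * E x) _ (fun n => stepB n x axc).
    by rewrite mulr_ge0// expR_ge0.
  by exists l.
have [Yl YlP] := choice limP.
pose Z x := Yl (Num.min x c).
have domc x : a < x -> a < Num.min x c <= c.
  by move=> ax; rewrite lt_min ax ac ge_min lexx orbT.
have okZ : ok Z.
  move=> x /andP[ax xb].
  (* The weight [E] decreases, so its value at [a'] makes the convergence uniform on a neighbourhood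
     of [x]. *)
  pose a' := (a + Num.min x c) / 2.
  have axm := domc x ax.
  have a'x : a < a' < Num.min x c.
    by rewrite /a'; have /andP[h1 h2] := axm; apply/andP; split; lra.
  have a'x' : a' < x < b.
    by rewrite xb andbT; have /andP[_] := a'x; rewrite lt_min => /andP[].
  apply: (@geometric_limit_continuous _ (fun n t => Y n (Num.min t c)) Z
    (B * E a') a' b x a'x').
    move=> n t /andP[a't _]; have /andP[h1 h2] := a'x.
    rewrite (le_trans (YlP _ (domc t (lt_trans h1 a't)) n))//.
    rewrite ler_pM2r ?invr_gt0 ?exprn_gt0//.
    rewrite ler_wpM2l// /E ler_expR ler_pM2l ?mulr_gt0//.
    rewrite lerD2l lerN2 le_min (ltW a't)/=.
    by move: h2; rewrite lt_min => /andP[_ /ltW].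
  by move=> n; apply: (minc _ (okY n)); rewrite ax.
have [Tc TZP] := HT _ okZ.
(* The limit is a fixed point: it and its image under [T] are both geometrically close to
   [Y n.+1]. *)
have TZE x : a < x <= c -> T Z x = Yl x.
  move=> /andP[ax xc].
  apply/eqP; rewrite -subr_eq0 -normr_eq0 eq_le normr_ge0 andbT.
  apply/ler_addgt0Pr => e e0; rewrite add0r.
  have [n Hn] := geometric_small (B * E x) (ltac:(rewrite divr_gt0 ?e0//) : 0 < e / 2).
  have [Y1c Y1P] := HT _ (okY n).
  have h1 : `|T Z x - Y n.+1 x| <= (B / 2 ^+ n) / 2 * E x.
    apply: (@exponential_bound _ (fun x => T Z x - Y n.+1 x)
      (fun x => G x (Z (Num.min x c)) - G x (Y n (Num.min x c)))); [exact: xc| | | |].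
    - by rewrite Tc [Y n.+1 c]Y1c subrr.
    - by rewrite divr_ge0 ?exprn_ge0.
    - move=> t /andP[xt tc]; apply: is_deriveB; [apply: TZP|apply: Y1P];
      by rewrite (lt_le_trans ax xt) (le_lt_trans tc cb).
    - move=> t /andP[xt tc]; rewrite (le_trans (GL _ _ _))//.
      rewrite -mulrA ler_pM2l// mulrAC /Z (min_l tc) (min_l tc).
      by apply: YlP; rewrite tc andbT (lt_le_trans ax).
  have h2 := YlP x (ltac:(by rewrite ax xc)) n.+1.
  have e1 : B * E x / 2 ^+ n.+1 = (B * E x / 2 ^+ n) / 2.
    by rewrite exprS; field; rewrite expf_neq0.
  have e2 : (B / 2 ^+ n) / 2 * E x = (B * E x / 2 ^+ n) / 2 by field; rewrite expf_neq0.
  rewrite e1 in h2; rewrite e2 in h1.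
  have -> : T Z x - Yl x = (T Z x - Y n.+1 x) - (Yl x - Y n.+1 x) by ring.
  by rewrite (le_trans (ler_normB _ _))//; lra.
exists (T Z) => // x axc; have /andP[ax xc] := axc.
rewrite TZE//.
have := TZP x (ltac:(by rewrite ax (le_lt_trans xc cb))).
by rewrite /Z (min_l xc) (min_l xc).
Qed.

(** * Powers and their Lipschitz truncation *)

Lemma le0_ger_powR (R : realType) (r x y : R) : r <= 0 -> 0 < x -> x <= y ->
  y `^ r <= x `^ r.
Proof.
move=> r0 x0 xy; rewrite -(opprK r) powRN (powRN x) lef_pV2 ?posrE ?powR_gt0//.
  by apply: ge0_ler_powR; rewrite ?oppr_ge0// nnegrE ltW// (lt_le_trans x0).
exact: lt_le_trans xy.
Qed.

(** Since [s^r = s s^(r - 1)] and [r - 1 < 0], each of [s] and [t] gets a smaller factor when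
    [(s + t)^(r - 1)] replaces its own power. *)
Lemma powR_subadditive (R : realType) (r s t : R) : 0 < r < 1 ->
  0 <= s -> 0 <= t -> (s + t) `^ r <= s `^ r + t `^ r.
Proof.
move=> /andP[r0 r1] s0 t0.
have [->|sn0] := eqVneq s 0; first by rewrite add0r powR0 ?add0r// gt_eqF.
have [->|tn0] := eqVneq t 0; first by rewrite addr0 powR0 ?addr0// gt_eqF.
have sp : 0 < s by rewrite lt_def sn0.
have tp : 0 < t by rewrite lt_def tn0.
have stp : 0 < s + t by rewrite addr_gt0.
rewrite -(mulr_powRB1 (ltW stp) r0) -(mulr_powRB1 s0 r0) -(mulr_powRB1 t0 r0).
by rewrite mulrDl lerD// ler_wpM2l//; apply: le0_ger_powR => //; lra.
Qed.

Lemma powR_holder (R : realType) (r s t : R) : 0 < r < 1 ->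
  0 <= s -> 0 <= t -> `|s `^ r - t `^ r| <= `|s - t| `^ r.
Proof.
move=> r01; wlog st : s t / t <= s.
  move=> H s0 t0; case: (leP t s) => [ts|/ltW st]; first exact: H.
  by rewrite distrC (distrC s); exact: H.
move=> s0 t0; have r0 : 0 <= r by case/andP: r01 => /ltW.
rewrite !ger0_norm ?subr_ge0//; last by apply: ge0_ler_powR; rewrite ?nnegrE.
rewrite lerBlDr.
by have := powR_subadditive r01 (ltac:(by rewrite subr_ge0) : 0 <= s - t) t0; rewrite subrK.
Qed.

(** Taking the positive part makes the power continuous at 0 from both sides, so that limits of
    powers follow by composition even where a nonnegative function tends to 0. *)
Lemma continuous_powR_max0 (R : realType) (r x : R) : 0 < r ->
  {for x, continuous (fun s : R => Num.max s 0 `^ r)}.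
Proof.
move=> r0; have [x0|x0|->] := ltgtP x 0.
- rewrite /prop_for /continuous_at max_r ?(ltW x0)//.
  apply: cvg_near_cst.
  by near=> t; rewrite max_r//; apply: ltW; near: t; exact: lt_nbhsl.
- have : {for x, continuous (@powR R ^~ r)}.
    by apply: is_derive_continuous; exact: is_derive1_powR.
  rewrite /prop_for /continuous_at (max_l (ltW x0)) => h.
  apply: cvg_trans h; apply: near_eq_cvg; near=> t.
  by rewrite max_l//; apply: ltW; near: t; exact: lt_nbhsr.
- rewrite /prop_for /continuous_at maxxx powR0 ?gt_eqF//.
  apply/cvgr0Pnorm_lt => e e0.
  near=> t; rewrite ger0_norm ?powR_ge0//.
  have h : Num.max t 0 < e `^ r^-1.
    rewrite gt_max powR_gt0// andbT; near: t.
    by apply: lt_nbhsl; exact: powR_gt0.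
  have -> : e = (e `^ r^-1) `^ r.
    by rewrite -powRrM mulVf ?gt_eqF// powRr1// ltW.
  by apply: gt0_ltr_powR; rewrite ?nnegrE ?powR_ge0// le_max lexx orbT.
Unshelve. all: by end_near. Qed.

(** A Lipschitz, nondecreasing substitute for [w^r], off by at most [e^r] when [w >= 0]. Subtracting
    [e^r] makes it vanish below [e]: where [w < 0] the truncated equation reads [w' = - F <= 0],
    which keeps the solutions starting backward from 0 nonnegative. *)
Definition trunc_pow (R : realType) (r e w : R) : R :=
  Num.max w e `^ r - e `^ r.

Section trunc_pow.
Variables (R : realType) (r e : R).
Hypotheses (r01 : 0 < r < 1) (e0 : 0 < e).

Let r0 : 0 < r. Proof. by case/andP: r01. Qed.

Lemma trunc_pow_le (w : R) : w <= e -> trunc_pow r e w = 0.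
Proof. by move=> we; rewrite /trunc_pow max_r ?subrr. Qed.

Lemma trunc_pow_ge0 (w : R) : 0 <= trunc_pow r e w.
Proof.
rewrite subr_ge0; apply: ge0_ler_powR; rewrite ?nnegrE ?le_max ?lexx ?orbT//.
- exact: ltW.
- exact: ltW.
- by rewrite (ltW e0) orbT.
Qed.

Lemma trunc_pow_homo : {homo trunc_pow r e : s t / s <= t}.
Proof.
move=> s t st; rewrite /trunc_pow lerD2r; apply: ge0_ler_powR; first exact: ltW.
- by rewrite nnegrE le_max (ltW e0) orbT.
- by rewrite nnegrE le_max (ltW e0) orbT.
- by rewrite ge_max !le_max st lexx orbT.
Qed.

Lemma trunc_pow_bounds (w : R) : 0 <= w ->
  w `^ r - e `^ r <= trunc_pow r e w <= w `^ r.
Proof.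
move=> w0; rewrite /trunc_pow lerD2r; apply/andP; split.
  by apply: ge0_ler_powR; rewrite ?nnegrE ?le_max ?w0 ?lexx// ltW.
case: (leP w e) => we; first by rewrite subrr powR_ge0.
by rewrite lerBlDr lerDl powR_ge0.
Qed.

(** Bernoulli's inequality at [a / b] is the tangent bound for the concave power at [b >= e], and
    the slope there is largest when [b = e]. *)
Lemma trunc_pow_lipschitz (s t : R) :
  `|trunc_pow r e s - trunc_pow r e t| <= r * e `^ (r - 1) * `|s - t|.
Proof.
wlog st : s t / t <= s.
  move=> H; case: (leP t s) => [ts|/ltW st]; first exact: H.
  by rewrite distrC (distrC s); exact: H.
rewrite !ger0_norm ?subr_ge0//; last exact: trunc_pow_homo.
rewrite /trunc_pow opprB addrA subrK.
set a := Num.max s e; set b := Num.max t e.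
have eb : e <= b by rewrite le_max lexx orbT.
have b0 : 0 < b by exact: lt_le_trans eb.
have ba : b <= a by rewrite ge_max !le_max st lexx orbT.
have a0 : 0 < a by exact: lt_le_trans ba.
have ab : a - b <= s - t.
  by rewrite /a /b; case: (leP s e); case: (leP t e) => h1 h2; lra.
have -> : a = b * (a / b) by rewrite mulrCA mulfV ?mulr1// gt_eqF.
rewrite (powRM _ (ltW b0) (ltW (divr_gt0 a0 b0))).
have := bernoulli_powR (divr_gt0 a0 b0) r01.
rewrite -(ler_pM2l (powR_gt0 r b0)) => h.
have e1 : b `^ r * (1 + r * (a / b - 1)) = b `^ r + r * b `^ (r - 1) * (a - b).
  rewrite -[in LHS](mulr_powRB1 (ltW b0) r0) -[X in _ = X + _](mulr_powRB1 (ltW b0) r0).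
  by field; rewrite gt_eqF.
rewrite e1 in h.
have h2 : b `^ (r - 1) <= e `^ (r - 1).
  by apply: le0_ger_powR => //; case/andP: r01; lra.
have h3 : r * b `^ (r - 1) * (a - b) <= r * e `^ (r - 1) * (s - t).
  apply: ler_pM => //; last by rewrite ler_pM2l.
    by rewrite mulr_ge0 ?powR_ge0// ltW.
  by rewrite subr_ge0.
by lra.
Qed.

End trunc_pow.

(* Every solution of [w' = A w^r - F] with [w 1 = 0] is unique backward from 1
   because the right-hand side is nondecreasing in [w]; this also makes the
   solutions of the truncated equations a Cauchy family. *)
Lemma singular_ode_backward (R : realType) (F : R -> R) (A M r : R) :
  0 < A -> 0 < r < 1 -> (forall x, {for x, continuous F}) ->
  (forall x, 0 <= F x <= M) ->
  exists w : R -> R,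
    (forall u : R, -1 < u <= 1 -> 0 <= w u <= M * (1 - u)) /\
    (forall u : R, -1 < u < 1 -> is_derive u 1 w (A * w u `^ r - F u)).
Proof.
move=> A0 r01 Fc FM; have /andP[r0 r1] := r01.
have solve e : exists w : R -> R, 0 < e -> w 1 = 0 /\
    forall u : R, -1 < u <= 1 -> is_derive u 1 w (A * trunc_pow r e (w u) - F u).
  case: (ltP 0 e) => e0; last by exists F.
  pose l := r * e `^ (r - 1).
  have l0 : 0 < l by rewrite mulr_gt0// powR_gt0.
  (* Solving down to -1 makes 0 an interior point, so that the solution will have a limit there. *)
  have [||||w w1 wP] := @picard_backward R (fun x y => A * trunc_pow r e y - F x)
    (A * l) M 0 (-1) 2 1 _ (mulr_gt0 A0 l0).
  - by apply/andP; split; lra.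
  - move=> y yc x xab; apply: cvgB; last exact: Fc.
    apply: cvgMr; apply/cvgrPdist_lt => d d0.
    have := yc x xab; move/cvgrPdist_lt => /(_ (d / l)); rewrite divr_gt0// => /(_ isT).
    apply: filterS => t h.
    rewrite (le_lt_trans (trunc_pow_lipschitz r01 e0 _ _))//.
    by rewrite mulrC -ltr_pdivlMr.
  - move=> x s t; rewrite opprB addrA subrK -mulrBr normrM gtr0_norm// -mulrA ler_pM2l//.
    exact: trunc_pow_lipschitz.
  - move=> x; rewrite trunc_pow_le ?(ltW e0)// mulr0 sub0r normrN.
    by have /andP[h1 h2] := FM x; rewrite ger0_norm.
  by exists w => _.
have [w0 w0P] := choice solve.
(* Chosen so that [e n ^ r = 2^(- n)]: the truncation errors are geometric. *)
pose e n : R := (1 / 2 ^+ n) `^ r^-1.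
have e0 n : 0 < e n by rewrite powR_gt0// divr_gt0// exprn_gt0.
have er n : e n `^ r = 1 / 2 ^+ n.
  by rewrite -powRrM mulVf ?gt_eqF// powRr1// divr_ge0// exprn_ge0.
pose w n := w0 (e n).
have w1 n : w n 1 = 0 by have [] := w0P _ (e0 n).
have wP n (u : R) : -1 < u <= 1 -> is_derive u 1 (w n) (A * trunc_pow r (e n) (w n u) - F u).
  by have [_ h] := w0P _ (e0 n); exact: h.
have dom (x t : R) : -1 < x -> x <= t <= 1 -> -1 < t <= 1.
  by move=> x1 /andP[xt t1]; rewrite t1 (lt_le_trans x1).
have wge0 n (x : R) : -1 < x <= 1 -> 0 <= w n x.
  move=> /andP[x1 x2]; rewrite leNgt; apply/negP => wx.
  have := @positive_part_growth R (- w n)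
    (fun t => - (A * trunc_pow r (e n) (w n t) - F t)) x 1 x2.
  rewrite !fctE w1 oppr0 oppr_le0 oppr_gt0.
  rewrite leNgt wx => /(_ _ _ isT) h; suff : ~~ true by [].
  apply: h => [t /(dom _ _ x1) /wP h|t /andP[t1 t2]]; first exact: is_deriveN.
  rewrite oppr_gt0 => wt; rewrite trunc_pow_le ?mulr0 ?sub0r ?opprK.
    by have /andP[] := FM t.
  by rewrite (le_trans (ltW wt))// ltW.
have wM n (x : R) : -1 < x <= 1 -> w n x <= M * (1 - x).
  move=> /andP[x1 x2]; rewrite -subr_le0.
  have -> : 0 = w n 1 - M * (1 - 1) by rewrite w1; ring.
  apply: (@ge0_is_derive_le R (fun t => w n t - M * (1 - t))
    (fun t => A * trunc_pow r (e n) (w n t) - F t - M * (0 - 1))) => [//|t xt|t /andP[xt t1]].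
    by apply: is_deriveB; apply: wP; exact: dom xt.
  have /andP[_ h] := FM t.
  have : 0 <= A * trunc_pow r (e n) (w n t).
    by rewrite mulr_ge0 ?(ltW A0)// trunc_pow_ge0.
  by lra.
(* Where the gap exceeds [A tau (1 - t)], monotonicity of the power makes the excess nondecreasing,
   whereas it vanishes at 1. The factor 2 bounds [1 - x]. *)
have cmp i j (x tau : R) : e i `^ r <= tau -> -1 < x <= 1 -> w i x - w j x <= A * tau * 2.
  move=> etau /andP[x1 x2]; rewrite leNgt; apply/negP => hx.
  have tau0 : 0 <= tau by apply: le_trans etau; exact: powR_ge0.
  have At0 : 0 <= A * tau by rewrite mulr_ge0// ltW.
  have := @positive_part_growth R (fun t => w i t - w j t - A * tau * (1 - t))
    (fun t => A * trunc_pow r (e i) (w i t) - F t - (A * trunc_pow r (e j) (w j t) - F t)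
       - A * tau * (0 - 1)) x 1 x2.
  rewrite !w1 !subrr mulr0 subrr.
  have pos : 0 < w i x - w j x - A * tau * (1 - x) by nra.
  move=> h; have := h _ _ pos; rewrite leNgt pos => {}h; suff : ~~ true by [].
  apply: h => [t xt|t /andP[t1 t2] h].
    have tt := dom _ _ x1 xt.
    by apply: is_deriveB; apply: is_deriveB; exact: wP.
  have tt : -1 < t <= 1 by rewrite (ltW t2) (lt_trans x1).
  have h1 : w j t <= w i t by nra.
  have /andP[h2 _] := trunc_pow_bounds (e i) r01 (wge0 i t tt).
  have /andP[_ h3] := trunc_pow_bounds (e j) r01 (wge0 j t tt).
  have h4 : w j t `^ r <= w i t `^ r.
    by apply: ge0_ler_powR; rewrite ?nnegrE ?wge0// ltW.
  have : A * trunc_pow r (e j) (w j t) <= A * (trunc_pow r (e i) (w i t) + tau).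
    rewrite (ler_pM2l A0) (le_trans h3)// (le_trans h4)// -lerBlDr.
    by rewrite (le_trans _ h2)// lerD2l lerN2.
  move: (trunc_pow _ _ (w j t)) (trunc_pow _ _ (w i t)) (F t); clear => a b c h.
  by lra.
have limP (x : R) : exists l, -1 < x <= 1 -> forall n, `|l - w n x| <= 4 * A / 2 ^+ n.
  case: (boolP (-1 < x <= 1)) => [x1|]; last by exists 0.
  have [|n|l lP] := @geometric_cauchy _ (fun n => w n x) (4 * A).
  - by rewrite mulr_ge0// ltW.
  - have -> : 4 * A / 2 ^+ n.+1 = A * (1 / 2 ^+ n) * 2.
      by rewrite exprS; field; rewrite expf_neq0.
    rewrite ler_norml; apply/andP; split.
      rewrite lerNl opprB; apply: cmp => //; by rewrite er.
    apply: cmp => //; rewrite er ler_pM2l// lef_pV2 ?posrE ?exprn_gt0//.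
    by rewrite ler_eXn2l// ltr1n.
  - by exists l.
have [W WP] := choice limP.
have small (d : R) : 0 < d -> exists n, 1 / 2 ^+ n < d /\ (4 * A / 2 ^+ n) < d.
  move=> d0; have [n Hn] := geometric_small (4 * A + 1) d0.
  have p0 : 0 < (2:R) ^- n by rewrite invr_gt0 exprn_gt0.
  by exists n; split; apply: le_lt_trans Hn; rewrite ler_pM2r//; lra.
have WM (u : R) : -1 < u <= 1 -> 0 <= W u <= M * (1 - u).
  move=> u1; apply/andP; split; apply/ler_addgt0Pr => d d0.
    have [n [_ Hn]] := small _ d0; have := WP u u1 n; have := wge0 n u u1.
    by rewrite ler_norml => h1 /andP[h2 h3]; lra.
  have [n [_ Hn]] := small _ d0; have := WP u u1 n; have := wM n u u1.
  by rewrite ler_norml => h1 /andP[h2 h3]; lra.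
have sub (u : R) : -1 < u < 1 -> -1 < u <= 1 by move=> /andP[-> /ltW].
have Wc (u : R) : -1 < u < 1 -> {for u, continuous W}.
  move=> u1; apply: (@geometric_limit_continuous _ w W (4 * A) (-1) 1 u u1).
    by move=> n t /sub /WP.
  by move=> n; apply: is_derive_continuous (wP n u (sub u u1)).
pose H u := A * Num.max (W u) 0 `^ r - F u.
have HE (u : R) : -1 < u <= 1 -> H u = A * W u `^ r - F u.
  by move=> /WM /andP[h _]; rewrite /H max_l.
have Hc (u : R) : -1 < u < 1 -> {for u, continuous H}.
  move=> u1; apply: cvgB; last exact: Fc.
  apply: cvgMr; apply: (@continuous_comp _ _ _ W (fun s => Num.max s 0 `^ r)).
    exact: Wc.
  exact: continuous_powR_max0.
have [Z _ ZP] := @continuous_primitive R H (-1) 1 0 (ltac:(apply/andP; split; lra)) Hc.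
have close (d : R) : 0 < d -> exists n, forall u : R, -1 < u <= 1 ->
    `|W u - w n u| <= d /\ `|A * trunc_pow r (e n) (w n u) - F u - H u| <= A * (2 * d).
  move=> d0; have [n [n1 n2]] := small (Num.min d (d `^ r^-1))
    (ltac:(by rewrite lt_min d0 powR_gt0)).
  move: n1 n2; rewrite !lt_min => /andP[n1 n1'] /andP[n2 n2'].
  exists n => u u1; have h := WP u u1 n; split; first by rewrite (le_trans h)// ltW.
  rewrite HE//; have -> : A * trunc_pow r (e n) (w n u) - F u - (A * W u `^ r - F u)
    = A * (trunc_pow r (e n) (w n u) - W u `^ r) by ring.
  rewrite normrM gtr0_norm// ler_pM2l//.
  have h1 := trunc_pow_bounds (e n) r01 (wge0 n u u1); rewrite er in h1.
  have h2 : `|w n u `^ r - W u `^ r| <= d.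
    have /andP[W0 _] := WM u u1.
    rewrite (le_trans (powR_holder r01 (wge0 n u u1) W0))//.
    have -> : d = (d `^ r^-1) `^ r.
      by rewrite -powRrM mulVf ?gt_eqF// powRr1// ltW.
    apply: ge0_ler_powR; rewrite ?nnegrE ?powR_ge0 ?(ltW r0)//.
    by rewrite distrC (le_trans h)// ltW.
  by move: h1 h2; rewrite !ler_norml => /andP[h3 h4] /andP[h5 h6]; apply/andP; split; lra.
(* By [close], the slopes of [w n] approach [H] uniformly, so the mean value theorem transfers the
   increments of [Z] to [W]. *)
have WZ (x y : R) : -1 < x < 1 -> -1 < y < 1 -> x < y -> W x - Z x = W y - Z y.
  move=> /andP[x1 x2] /andP[y1 y2] xy.
  apply/eqP; rewrite -subr_eq0 -normr_eq0 eq_le normr_ge0 andbT.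
  apply/ler_addgt0Pr => d d0; rewrite add0r.
  have K0 : 0 < 2 + 2 * A * (y - x) by have := mulr_gt0 A0 (ltac:(by rewrite subr_gt0) : 0 < y - x); lra.
  have [n Hn] := close _ (divr_gt0 d0 K0).
  set d' := d / _ in Hn.
  have [|c /andP[xc cy] cE] := @MVT_is_derive R (fun t => w n t - Z t)
    (fun t => A * trunc_pow r (e n) (w n t) - F t - H t) x y xy.
    move=> t /andP[xt ty]; have tt : -1 < t < 1 by apply/andP; split; lra.
    by apply: is_deriveB; [apply: wP; exact: sub|exact: ZP].
  have [_ h1] := Hn c (ltac:(apply/andP; split; lra)).
  have [h2 _] := Hn x (ltac:(apply/andP; split; lra)).
  have [h3 _] := Hn y (ltac:(apply/andP; split; lra)).
  have -> : W x - Z x - (W y - Z y) = (W x - w n x) - (W y - w n y)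
     - (w n y - Z y - (w n x - Z x)) by ring.
  rewrite cE (le_trans (ler_normB _ _))//.
  have h4 := ler_normB (W x - w n x) (W y - w n y).
  have h5 : `|(A * trunc_pow r (e n) (w n c) - F c - H c) * (y - x)| <= A * (2 * d') * (y - x).
    by rewrite normrM (gtr0_norm (_ : 0 < y - x)) ?subr_gt0// ler_pM2r ?subr_gt0.
  have -> : d = 2 * d' + A * (2 * d') * (y - x) by rewrite /d'; field; rewrite gt_eqF.
  by lra.
exists W; split => // u u1.
rewrite -HE; last exact: sub.
have /andP[u2 u3] := u1.
apply: (@near_eq_is_derive _ _ _ (fun t => Z t + (W u - Z u))).
  near=> t.
  have t1 : -1 < t < 1.
    by apply/andP; split; near: t; [exact: lt_nbhsr|exact: lt_nbhsl].
  suff -> : W u - Z u = W t - Z t by rewrite addrC subrK.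
  by case: (ltgtP u t) => [ut|tu|->//]; [exact: WZ|exact/esym/WZ].
by rewrite -[H u]addr0; apply: is_deriveD; exact: ZP.
Unshelve. all: by end_near. Qed.

(** * Phase-plane solutions *)

(* [Y] stands for [q^(p - 1)] and [k] for [1 / (p - 1)], so that [F / q] becomes
   [F Y^(- k)]. *)
Definition phase_solution (R : realType) (F : R -> R) (C k : R) (Y : R -> R) :=
  forall u : R, 0 < u < 1 ->
    0 < Y u /\ is_derive u 1 Y (C - F u * Y u `^ (- k)).

Lemma phase_solution_ext (R : realType) (F G : R -> R) (C k : R) (Y : R -> R) :
  (forall u, 0 < u < 1 -> F u = G u) ->
  phase_solution F C k Y -> phase_solution G C k Y.
Proof. by move=> FG YP u u01; rewrite -FG//; exact: YP. Qed.

(** As [- F y^(- k)] is nondecreasing in [y], a gap [Y > z] cannot shrink to the right; this is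
    incompatible with [Y] tending to 0 at 1 and [z > 0]. *)
Lemma phase_le_super (R : realType) (F : R -> R) (C k : R) (Y z dz : R -> R) :
  0 < k -> (forall u, 0 < u < 1 -> 0 <= F u) ->
  phase_solution F C k Y -> Y x @[x --> (1:R)^'-] --> 0 ->
  (forall u : R, 0 < u < 1 -> [/\ 0 < z u, is_derive u 1 z (dz u) &
     dz u <= C - F u * z u `^ (- k)]) ->
  forall u, 0 < u < 1 -> Y u <= z u.
Proof.
move=> k0 F0 YP Y1 zP u /andP[u0 u1]; rewrite leNgt; apply/negP => zY.
have d0 : 0 < Y u - z u by rewrite subr_gt0.
have grow (t : R) : u <= t < 1 -> Y u - z u <= Y t - z t.
  move=> /andP[ut t1].
  have dom s : u <= s <= t -> 0 < s < 1.
    by move=> /andP[us st]; rewrite (lt_le_trans u0 us) (le_lt_trans st t1).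
  apply: (@positive_part_growth R (fun s => Y s - z s)
    (fun s => C - F s * Y s `^ (- k) - dz s)); [exact: ut| | |exact: d0].
    by move=> s /dom s01; have [_ h1] := YP s s01; have [_ h2 _] := zP s s01;
      exact: is_deriveB.
  move=> s /andP[us st]; have s01 := dom s (ltac:(by rewrite !ltW)).
  rewrite subr_gt0 => h; have [z0 _ h2] := zP s s01.
  rewrite subr_ge0 (le_trans h2)// lerD2l lerN2 ler_wpM2l ?F0//.
  by apply: le0_ger_powR => //; [rewrite oppr_le0 ltW|exact: ltW].
have : \forall t \near (1:R)^'-, Y t < Y u - z u.
  exact: (Y1 _ (lt_nbhsl d0)).
move=> [e /= e0 He].
pose t := Num.max u (1 - e / 2).
have tu : u <= t by rewrite le_max lexx.
have t1 : t < 1 by rewrite gt_max u1/=; lra.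
have := He t; rewrite /= gtr0_norm ?subr_gt0// => /(_ _ t1).
have te : 1 - e / 2 <= t by rewrite le_max lexx orbT.
move=> /(_ ltac:(lra)); apply/negP; rewrite -leNgt.
rewrite (le_trans (grow t _)) ?tu// gerBl ltW//.
by have [] := zP t (ltac:(by rewrite (lt_le_trans u0 tu) t1)).
Qed.

(** A solution for [C1] is a supersolution for [C2]. With [C1 = C2] this says that a solution
    vanishing at 1 is the smallest of all. *)
Lemma phase_antitone (R : realType) (F : R -> R) (C1 C2 k : R) (Y1 Y2 : R -> R) :
  0 < k -> (forall u, 0 < u < 1 -> 0 <= F u) -> C1 <= C2 ->
  phase_solution F C1 k Y1 -> phase_solution F C2 k Y2 ->
  Y2 x @[x --> (1:R)^'-] --> 0 ->
  forall u, 0 < u < 1 -> Y2 u <= Y1 u.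
Proof.
move=> k0 F0 C12 P1 P2 Y21.
apply: (phase_le_super (dz := fun u => C1 - F u * Y1 u `^ (- k)) k0 F0 P2 Y21).
by move=> u u01; have [h1 h2] := P1 u u01; split => //; rewrite lerD2r.
Qed.

(** The corrector [(C2 - C1) (1 - u)] lowers the slope of [Y2] by exactly [C2 - C1], so the sum is a
    supersolution for [C1]. This continuity in the speed carries estimates from [c < cstar] to
    [cstar]. *)
Lemma phase_lipschitz (R : realType) (F : R -> R) (C1 C2 k : R) (Y1 Y2 : R -> R) :
  0 < k -> (forall u, 0 < u < 1 -> 0 <= F u) -> C1 <= C2 ->
  phase_solution F C1 k Y1 -> phase_solution F C2 k Y2 ->
  Y1 x @[x --> (1:R)^'-] --> 0 ->
  forall u, 0 < u < 1 -> Y1 u <= Y2 u + (C2 - C1).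
Proof.
move=> k0 F0 C12 P1 P2 Y11 u u01.
have C0 : 0 <= C2 - C1 by rewrite subr_ge0.
apply: (@le_trans _ _ (Y2 u + (C2 - C1) * (1 - u))); last first.
  by rewrite lerD2l ler_piMr//; have /andP[h1 h2] := u01; lra.
apply: (phase_le_super (z := fun u => Y2 u + (C2 - C1) * (1 - u))
  (dz := fun u => C2 - F u * Y2 u `^ (- k) + (C2 - C1) * (0 - 1)) k0 F0 P1 Y11) => // {u01}u u01.
have [h1 h2] := P2 u u01.
have h3 : Y2 u <= Y2 u + (C2 - C1) * (1 - u).
  by rewrite lerDl mulr_ge0//; have /andP[? ?] := u01; lra.
split; first exact: lt_le_trans h3.
  exact: is_deriveD.
have : F u * (Y2 u + (C2 - C1) * (1 - u)) `^ (- k) <= F u * Y2 u `^ (- k).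
  by rewrite ler_wpM2l ?F0//; apply: le0_ger_powR => //; rewrite oppr_le0 ltW.
by move: (_ `^ _) (_ `^ _) => a b; lra.
Qed.

(* [w = Y^(1 + k)] solves [w' = (1 + k) (C w^r - F)] with [r = k / (1 + k) < 1],
   which is no longer singular where [w] vanishes. *)
Lemma phase_solution_exists (R : realType) (F : R -> R) (M C k : R) :
  0 < C -> 0 < k -> (forall x, {for x, continuous F}) ->
  (forall x, 0 <= F x <= M) -> (forall u, 0 < u < 1 -> 0 < F u) ->
  exists Y : R -> R, [/\ phase_solution F C k Y, Y x @[x --> (1:R)^'-] --> 0 &
    exists2 l : R, 0 <= l & Y x @[x --> (0:R)^'+] --> l].
Proof.
move=> C0 k0 Fc FM Fpos.
have k1 : 0 < 1 + k by rewrite addr_gt0.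
pose r := k / (1 + k); pose s := 1 / (1 + k).
have r01 : 0 < r < 1 by rewrite divr_gt0//= ltr_pdivrMr// mul1r ltrDr.
have s0 : 0 < s by rewrite divr_gt0.
have [||w [wM wP]] := @singular_ode_backward R (fun x => (1 + k) * F x)
    ((1 + k) * C) ((1 + k) * M) r (mulr_gt0 k1 C0) r01.
- by move=> x; apply: cvgMr; exact: Fc.
- by move=> x; have /andP[h1 h2] := FM x; rewrite mulr_ge0 ?(ltW k1)//= ler_pM2l.
have sub (u : R) : 0 < u < 1 -> -1 < u < 1 by move=> /andP[u0 ->]; rewrite (lt_trans _ u0)// oppr_lt0.
(* At an interior zero the nonnegative [w] has a minimum, so [w' = 0], whereas the equation gives
   [w' = - (1 + k) F < 0]. *)
have wpos (u : R) : 0 < u < 1 -> 0 < w u.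
  move=> u01; have /andP[u0 u1] := u01.
  have /andP[w0 _] := wM u (ltac:(by rewrite (ltW u1) (lt_trans _ u0)// oppr_lt0)).
  rewrite lt_def w0 andbT; apply/eqP => wu0.
  have := @derive1_at_min R w 0 1 u ler01.
  have h : is_derive u 1 w ((1 + k) * C * w u `^ r - (1 + k) * F u) by apply: wP; exact: sub.
  have d1 t : t \in `]0, 1[ -> derivable w t 1.
    by rewrite in_itv/= => /sub /wP [].
  have u01' : u \in `]0, 1[ by rewrite in_itv/= u01.
  have mn t : t \in `]0, 1[ -> w u <= w t.
    rewrite in_itv/= => /andP[t0 t1]; rewrite wu0.
    by have /andP[] := wM t (ltac:(by rewrite (ltW t1) (lt_trans _ t0)// oppr_lt0)).
  move=> /(_ d1 u01' mn) h0.
  have : (1 + k) * C * w u `^ r - (1 + k) * F u = 0.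
    by rewrite -(@derive_val _ _ _ _ _ _ _ h) (@derive_val _ _ _ _ _ _ _ h0).
  rewrite wu0 powR0 ?gt_eqF//; last by case/andP: r01.
  rewrite mulr0 sub0r => /eqP; rewrite oppr_eq0 gt_eqF//.
  by rewrite mulr_gt0// Fpos.
exists (fun u => w u `^ s); split.
- move=> u u01; have w0 := wpos u u01; split; first exact: powR_gt0.
  apply: (is_derive_eq (is_derive1_comp (is_derive1_powR s w0) (wP u (sub u u01)))).
  have -> : s - 1 = - r by rewrite /s /r; field; rewrite gt_eqF.
  have -> : (w u `^ s) `^ (- k) = w u `^ (- r).
    by rewrite -powRrM; congr (_ `^ _); rewrite /s /r; field; rewrite gt_eqF.
  have : w u `^ (- r) * w u `^ r = 1.
    by rewrite -powRD ?(gt_eqF w0) ?implybT// addNr powRr0.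
  have : s * (1 + k) = 1 by rewrite /s; field; rewrite gt_eqF.
  move: (w u `^ (- r)) (w u `^ r) => a b h1 h2.
  have -> : s * a * ((1 + k) * C * b - (1 + k) * F u) =
    (s * (1 + k)) * (C * (a * b) - F u * a) by ring.
  by rewrite h1 h2 mul1r mulr1.
- have w1 : w u @[u --> (1:R)^'-] --> 0.
    apply: (@squeeze_cvgr _ _ _ _ (cst 0) (fun u => (1 + k) * M * (1 - u))).
    + near=> u; apply: wM; apply/andP; split; last by apply: ltW; near: u; exact: nbhs_left_lt.
      by near: u; apply: nbhs_left_gt; lra.
    + exact: cvg_cst.
    + have e : (1 + k) * M * (1 - 1) = 0 by ring.
      rewrite -[X in _ --> X]e.
      apply: cvgMr; apply: cvgB; first exact: cvg_cst.
      by apply: cvg_at_left_filter; exact: cvg_id.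
  have : (fun u => Num.max (w u) 0 `^ s) u @[u --> (1:R)^'-] --> Num.max (0:R) 0 `^ s.
    exact: (@cvg_comp _ _ _ w (fun t => Num.max t 0 `^ s) _ _ _ w1 (continuous_powR_max0 s0)).
  rewrite maxxx powR0 ?gt_eqF//; apply: cvg_trans; apply: near_eq_cvg.
  near=> u; have /andP[h _] : 0 <= w u <= (1 + k) * M * (1 - u).
    apply: wM; apply/andP; split; last by apply: ltW; near: u; exact: nbhs_left_lt.
    by near: u; apply: nbhs_left_gt; lra.
  by rewrite max_l.
- exists (w 0 `^ s); first exact: powR_ge0.
  have w0 : 0 <= w 0 by have /andP[] := wM 0 (ltac:(apply/andP; split; lra)).
  have wc : w u @[u --> (0:R)^'+] --> w 0.
    apply: cvg_at_right_filter; apply: is_derive_continuous (wP 0 _).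
    by apply/andP; split; lra.
  have : (fun u => Num.max (w u) 0 `^ s) u @[u --> (0:R)^'+] --> Num.max (w 0) 0 `^ s.
    exact: (@cvg_comp _ _ _ w (fun t => Num.max t 0 `^ s) _ _ _ wc (continuous_powR_max0 s0)).
  rewrite max_l//; apply: cvg_trans; apply: near_eq_cvg.
  near=> u; have /andP[h _] : 0 <= w u <= (1 + k) * M * (1 - u).
    apply: wM; apply/andP; split; last by apply: ltW; near: u; apply: nbhs_right_lt.
    by rewrite (@lt_trans _ _ 0)//; near: u; exact: nbhs_right_gt.
  by rewrite max_l.
Unshelve. all: by end_near. Qed.

(** * The reaction term *)

Lemma C1_unit_itv_continuous (R : realType) (f df : R -> R) (x e : R) :
  C1_unit_itv f df -> 0 <= x <= 1 -> 0 < e ->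
  \forall y \near x, 0 <= y <= 1 -> `|f x - f y| < e.
Proof.
move=> [fdf _] x01 e0.
have /cvgrPdist_lt/(_ 1 ltr01) := fdf x (ltac:(by rewrite in_itv/=)).
move=> [d /= d0 Hd].
pose K := `|df x| + 1; have K0 : 0 < K by rewrite /K ltr_pwDr.
exists (Num.min d (e / K)) => /=; first by rewrite lt_min d0 divr_gt0.
move=> y /=; rewrite lt_min => /andP[yd ye] y01.
have [->|yx] := eqVneq y x; first by rewrite subrr normr0.
have /= h := Hd y yd yx (ltac:(by rewrite /= in_itv/=)).
have q : `|(f y - f x) / (y - x)| < K.
  have -> : (f y - f x) / (y - x) = df x - (df x - (f y - f x) / (y - x)) by ring.
  by rewrite (le_lt_trans (ler_normB _ _))// ltrD2l.
have yx0 : 0 < `|y - x| by rewrite normr_gt0 subr_eq0.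
move: q; rewrite normrM normfV ltr_pdivrMr// distrC => q.
by rewrite (lt_trans q)// mulrC -ltr_pdivlMr// distrC.
Qed.

Lemma C1_unit_itv_continuous_oo (R : realType) (f df : R -> R) (x : R) :
  C1_unit_itv f df -> 0 < x < 1 -> {for x, continuous f}.
Proof.
move=> fC /andP[x0 x1]; apply/cvgrPdist_lt => e e0.
have := @C1_unit_itv_continuous R f df x e fC (ltac:(by rewrite !ltW)) e0.
move=> h; near=> y; have : 0 <= y <= 1 -> `|f x - f y| < e by near: y.
by apply; apply/andP; split; apply: ltW; near: y; [exact: lt_nbhsr|exact: lt_nbhsl].
Unshelve. all: by end_near. Qed.

Lemma C1_unit_itv_derive0 (R : realType) (f df : R -> R) :
  C1_unit_itv f df -> f 0 = 0 -> f y / y @[y --> (0:R)^'+] --> df 0.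
Proof.
move=> [fdf _] f0; have := fdf 0 (ltac:(by rewrite in_itv/= lexx ler01)).
move=> h A /h [d /= d0 Hd].
exists (Num.min d 1) => /=; first by rewrite lt_min d0 ltr01.
move=> y /= + y0; rewrite lt_min => /andP[yd y1].
have := Hd y yd; rewrite f0 !subr0; apply; first by rewrite gt_eqF.
rewrite /= in_itv/= (ltW y0)/=; move: y1; rewrite sub0r normrN => /ltW.
by apply: le_trans; exact: ler_norm.
Qed.

Lemma concave_ray (R : realType) (f : R -> R) (t u : R) :
  concave_unit_itv f -> f 0 = 0 -> 0 <= t <= 1 -> 0 <= u <= 1 ->
  t * f u <= f (t * u).
Proof.
move=> fc f0 /andP[t0 t1] u01.
have h : - f (t * u + (1 - t) * 0) <= t * - f u + (1 - t) * - f 0.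
  by apply: (fc (Itv01 t0 t1) u 0); rewrite inE/= in_itv/= ?u01 ?lexx ?ler01.
by move: h; rewrite f0 oppr0 !mulr0 !addr0 mulrN lerN2.
Qed.

(** Concavity and [f 0 = 0] make the slope [f y / y] of the chord from the origin nonincreasing; its
    limit at 0 is [df 0]. *)
Lemma concave_le_derive0 (R : realType) (f df : R -> R) (u : R) :
  C1_unit_itv f df -> concave_unit_itv f -> f 0 = 0 -> 0 <= u <= 1 ->
  f u <= df 0 * u.
Proof.
move=> fC fc f0 /andP[u0 u1].
have [->|un0] := eqVneq u 0; first by rewrite f0 mulr0.
have up : 0 < u by rewrite lt_def un0.
rewrite -ler_pdivrMr//; apply: (cvgr_to_ge (C1_unit_itv_derive0 fC f0)).
near=> y.
have y0 : 0 < y by near: y; exact: nbhs_right_gt.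
have yu : y <= u by near: y; exact: nbhs_right_le.
have yu1 : 0 <= y / u <= 1 by rewrite divr_ge0 ?ler_pdivrMr ?mul1r ?(ltW y0).
have := concave_ray fc f0 yu1 (ltac:(by rewrite u0) : 0 <= u <= 1).
rewrite divfK// => h.
rewrite ler_pdivlMr//; have -> // : f u / u * y = y / u * f u by ring.
Unshelve. all: by end_near. Qed.

Lemma concave_derive0_gt0 (R : realType) (f df : R -> R) :
  C1_unit_itv f df -> concave_unit_itv f -> f 0 = 0 ->
  (forall u, 0 < u < 1 -> 0 < f u) -> 0 < df 0.
Proof.
move=> fC fc f0 fpos.
have h2 : 0 < (2^-1 : R) < 1 by apply/andP; split; lra.
have := concave_le_derive0 fC fc f0 (ltac:(apply/andP; split; lra) : 0 <= (2^-1:R) <= 1).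
by have := fpos _ h2; lra.
Qed.

Section reaction.
Variables (R : realType) (m p : R) (f df : R -> R).
Hypotheses (hm : 0 < m) (hp : 1 < p) (hC1 : C1_unit_itv f df)
  (hf0 : f 0 = 0) (hf1 : f 1 = 0) (hfpos : forall u, 0 < u < 1 -> 0 < f u)
  (hconc : concave_unit_itv f).

Let mp0 : 0 < m `^ (p - 1). Proof. exact: powR_gt0. Qed.

Lemma reactF_gt0 (u : R) : 0 < u < 1 -> 0 < reactF m p f u.
Proof.
move=> u01; have /andP[u0 _] := u01.
by rewrite /reactF divr_gt0// mulr_gt0 ?powR_gt0// hfpos.
Qed.

Lemma reactF_continuous (u : R) : 0 < u < 1 -> {for u, continuous (reactF m p f)}.
Proof.
move=> u01; have /andP[u0 _] := u01.
apply: cvgMl; apply: cvgM; last exact: (C1_unit_itv_continuous_oo hC1).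
exact: (is_derive_continuous (is_derive1_powR (m - 1) u0)).
Qed.

Lemma reactF_le (u : R) : 0 < u <= 1 ->
  reactF m p f u <= df 0 / m `^ (p - 1) * u `^ m.
Proof.
move=> /andP[u0 u1]; rewrite /reactF -(mulr_powRB1 (ltW u0) hm).
have -> : df 0 / m `^ (p - 1) * (u * u `^ (m - 1)) =
  u `^ (m - 1) * (df 0 * u) / m `^ (p - 1) by ring.
rewrite ler_pM2r ?invr_gt0// ler_pM2l ?powR_gt0//.
by apply: (concave_le_derive0 hC1) => //; rewrite (ltW u0).
Qed.

(** The backward solver asks for a bounded continuous term on the whole line, while [reactF] is
    controlled only on the unit interval; hence the extension by zero. *)
Definition reactF01 (u : R) : R := if 0 <= u <= 1 then reactF m p f u else 0.

Lemma reactF01E (u : R) : 0 < u < 1 -> reactF01 u = reactF m p f u.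
Proof. by move=> /andP[u0 u1]; rewrite /reactF01 !ltW. Qed.

Lemma reactF01_bound (u : R) : 0 <= reactF01 u <= df 0 / m `^ (p - 1).
Proof.
have d0 := concave_derive0_gt0 hC1 hconc hf0 hfpos.
have D0 : 0 <= df 0 / m `^ (p - 1) by rewrite ltW// divr_gt0.
rewrite /reactF01; case: ifPn => [/andP[u0 u1]|]; last by rewrite lexx.
have [->|un0] := eqVneq u 0; first by rewrite /reactF hf0 mulr0 mul0r lexx.
have up : 0 < u by rewrite lt_def un0.
apply/andP; split.
  have [->|un1] := eqVneq u 1; first by rewrite /reactF hf1 mulr0 mul0r.
  by apply/ltW/reactF_gt0; rewrite up lt_neqAle un1.
rewrite (le_trans (reactF_le _)) ?up// ler_piMr//.
by rewrite -(powRr0 u) ger_powR ?up// ltW.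
Qed.

(** The delicate endpoint is 0: for [m < 1] the factor [u^(m - 1)] is unbounded there, and it is the
    bound [reactF_le], of order [u^m], that gives the limit. Near 1 that factor is at most 2 and [f]
    tends to 0. *)
Lemma reactF01_continuous (u : R) : {for u, continuous reactF01}.
Proof.
have d0 := concave_derive0_gt0 hC1 hconc hf0 hfpos.
have D0 : 0 < df 0 / m `^ (p - 1) by rewrite divr_gt0.
have out (x : R) : x < 0 \/ 1 < x -> reactF01 x = 0.
  rewrite /reactF01 => -[x0|x1]; first by rewrite (lt_geF x0).
  by rewrite [x <= 1](lt_geF x1) andbF.
have [u0|u0|u0] := ltgtP u 0.
- rewrite /prop_for /continuous_at out; last by left.
  by apply: cvg_near_cst; near=> x; apply: out; left; near: x; exact: lt_nbhsl.
- have [u1|u1|u1] := ltgtP u 1.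
  + rewrite /prop_for /continuous_at reactF01E ?u0//.
    have h := reactF_continuous (ltac:(by rewrite u0) : 0 < u < 1).
    apply: cvg_trans h; apply: near_eq_cvg; near=> x.
    rewrite reactF01E//; apply/andP; split; near: x; [exact: lt_nbhsr|exact: lt_nbhsl].
  + rewrite /prop_for /continuous_at out; last by right.
    by apply: cvg_near_cst; near=> x; apply: out; right; near: x; exact: lt_nbhsr.
  + rewrite u1 /prop_for /continuous_at.
    have -> : reactF01 1 = 0 by rewrite /reactF01 ler01 lexx /reactF hf1 mulr0 mul0r.
    apply/cvgr0Pnorm_lt => e e0; near=> x.
    have x0 : 2^-1 < x by near: x; apply: lt_nbhsr; lra.
    have xp : 0 < x by lra.
    rewrite /reactF01; case: ifPn => [/andP[_ x1]|]; last by rewrite normr0.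
    rewrite /reactF !normrM normfV (gtr0_norm mp0) ltr_pdivrMr// ger0_norm ?powR_ge0//.
    have h : `|f x| < e * m `^ (p - 1) / 2.
      have /(_ _) : 0 <= x <= 1 -> `|f 1 - f x| < e * m `^ (p - 1) / 2.
        near: x; apply: (C1_unit_itv_continuous hC1); first by rewrite ler01 lexx.
        by rewrite divr_gt0// mulr_gt0.
      by rewrite hf1 sub0r normrN; apply; rewrite x1 ltW.
    have h1 : x `^ (m - 1) <= 2.
      rewrite -(ler_pM2l xp) mulr_powRB1 ?(ltW xp)//.
      have : x `^ m <= 1 by rewrite -(powRr0 x) ger_powR ?xp// ltW.
      lra.
    have h2 : 0 <= x `^ (m - 1) by exact: powR_ge0.
    have := normr_ge0 (f x); move: h h1 h2; move: (`|f x|) (x `^ _) (e * _).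
    by move=> a b c; nra.
- rewrite u0 /prop_for /continuous_at.
  have -> : reactF01 0 = 0 by rewrite /reactF01 ler01 lexx /reactF hf0 mulr0 mul0r.
  apply/cvgr0Pnorm_lt => e e0.
  have h : (fun x : R => df 0 / m `^ (p - 1) * Num.max x 0 `^ m) x @[x --> (0:R)] --> 0.
    have e1 : df 0 / m `^ (p - 1) * Num.max 0 0 `^ m = 0.
      by rewrite maxxx powR0 ?mulr0 ?gt_eqF.
    by rewrite -[X in _ --> X]e1; apply: cvgMr; exact: continuous_powR_max0.
  move: h => /cvgr0Pnorm_lt/(_ e e0); apply: filterS => x.
  apply: le_lt_trans; rewrite ger0_norm; last by have /andP[] := reactF01_bound x.
  apply: le_trans (ler_norm _).
  have [x0|x0|->] := ltgtP x 0.
  + by rewrite out; [rewrite mulr_ge0 ?powR_ge0// ltW|left].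
  + rewrite /reactF01; case: ifPn => [/andP[_ x1]|_].
      by apply: reactF_le; rewrite x0.
    by rewrite mulr_ge0 ?powR_ge0// ltW.
  + by rewrite /reactF01 lexx ler01 /reactF hf0 mulr0 mul0r mulr_ge0 ?powR_ge0// ltW.
Unshelve. all: by end_near. Qed.

Lemma reactF_phase_solution (c : R) : 0 < c ->
  exists Y : R -> R, [/\ phase_solution (reactF m p f) (c / m `^ (p - 1)) (1 / (p - 1)) Y,
    Y x @[x --> (1:R)^'-] --> 0 &
    exists2 l : R, 0 <= l & Y x @[x --> (0:R)^'+] --> l].
Proof.
move=> c0.
have C0 : 0 < c / m `^ (p - 1) by rewrite divr_gt0.
have k0 : 0 < 1 / (p - 1) by rewrite divr_gt0// subr_gt0.
have [|Y [YP Y1 Y0]] := phase_solution_exists C0 k0 reactF01_continuous reactF01_bound.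
  by move=> u u01; rewrite reactF01E// reactF_gt0.
by exists Y; split => //; apply: phase_solution_ext YP; exact: reactF01E.
Qed.

End reaction.

(** * Travelling waves and phase-plane solutions *)

Lemma powR_mulVK (R : realType) (a q : R) : 0 < a -> q != 0 ->
  (a `^ q) `^ q^-1 = a.
Proof. by move=> a0 q0; rewrite -powRrM mulfV// powRr1// ltW. Qed.

Lemma powR_mulVN (R : realType) (a q : R) : 0 < a -> q != 0 ->
  (a `^ q) `^ (- (1 / q)) = a^-1.
Proof. by move=> a0 q0; rewrite powRN div1r powR_mulVK. Qed.

(** [Y] is the reduced flux [v] read as a function of the height of the wave, through the inverse
    [X]. Its limit at 0 comes from two facts: it cannot stay above a positive constant near 0, and
    its slope is at most [C], so one large value near 0 would force it to stay large further
    left. *)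
Lemma travelling_wave_phase (R : realType) (m p : R) (f : R -> R) (c : R)
    (u : R -> R) :
  0 < m -> 1 < p -> 0 < c -> (forall s : R, 0 < s < 1 -> 0 < f s) ->
  travelling_wave m p f c u ->
  exists2 Y : R -> R,
    phase_solution (reactF m p f) (c / m `^ (p - 1)) (1 / (p - 1)) Y &
    Y s @[s --> (0:R)^'+] --> 0.
Proof.
move=> m0 p1 c0 fpos [u01 umono [uNy uy] [wd fluxc _] ode].
have pm0 : 0 < p - 1 by rewrite subr_gt0.
have pm_neq0 : p - 1 != 0 by rewrite gt_eqF.
have mp0 : 0 < m `^ (p - 1) by exact: powR_gt0.
pose w x := u x `^ m.
have wc x : {for x, continuous w} by apply/differentiable_continuous/derivable1_diffP/wd.
have uE : u = fun x => Num.max (w x) 0 `^ m^-1.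
  apply/funext => x; rewrite max_l ?powR_ge0// /w -powRrM mulfV ?gt_eqF// powRr1//.
  by have /andP[] := u01 x.
have uc x : {for x, continuous u}.
  rewrite uE; apply: (@continuous_comp _ _ _ w (fun s => Num.max s 0 `^ m^-1)).
    exact: wc.
  by apply: continuous_powR_max0; rewrite invr_gt0.
have surj (s : R) : 0 < s < 1 -> exists x, u x = s.
  move=> /andP[s0 s1].
  have : \forall x \near -oo, u x < s by apply: (uNy [set y | y < s]); exact: lt_nbhsl.
  move=> [a [_ Ha]].
  have : \forall x \near +oo, s < u x by apply: (uy [set y | s < y]); exact: lt_nbhsr.
  move=> [b [_ Hb]].
  pose a' := Num.min a b - 1; pose b' := Num.max a b + 1.
  have ha : u a' < s by apply: Ha; rewrite /a'; case: (leP a b); lra.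
  have hb : s < u b' by apply: Hb; rewrite /b'; case: (leP a b); lra.
  have ab : a' <= b' by rewrite /a' /b'; case: (leP a b); lra.
  have [||x _ xs] := @IVT R u a' b' s ab.
  - by apply: continuous_subspaceT; exact: uc.
  - by rewrite ge_min le_max (ltW ha) (ltW hb) orbT.
  - by exists x.
have udP x : 0 < u x < 1 -> is_derive x 1 u (derive1 u x).
  by move=> /ode[du _ _ _]; constructor => //; rewrite derive1E.
have incr x y : x < y -> 0 < u x < 1 -> 0 < u y < 1 -> u x < u y.
  move=> xy /andP[x0 x1] /andP[y0 y1].
  have dom z : x <= z <= y -> 0 < u z < 1.
    by move=> /andP[xz zy]; rewrite (lt_le_trans x0 (umono _ _ xz)) (le_lt_trans (umono _ _ zy) y1).
  apply: (@gt0_is_derive_lt _ _ (derive1 u)) => // [z /dom /udP//|z /andP[xz zy]].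
  by have [] := ode z (dom z (ltac:(by rewrite !ltW))).
have inj x y : 0 < u x < 1 -> u x = u y -> x = y.
  move=> x1 xy; have y1 := x1; rewrite xy in y1.
  by case: (ltgtP x y) => // /incr; rewrite x1 y1 xy ltxx => /(_ isT isT).
have [X XP] : exists X : R -> R, forall s : R, 0 < s < 1 -> u (X s) = s.
  have /choice[X XP] : forall s : R, exists x, 0 < s < 1 -> u x = s.
    move=> s; case: (boolP (0 < s < 1)) => [/surj[x xs]|_]; last by exists 0.
    by exists x.
  by exists X.
have Xd (s : R) : 0 < s < 1 -> is_derive s 1 X (derive1 u (X s))^-1.
  move=> s01; have us := XP s s01; have us01 : 0 < u (X s) < 1 by rewrite us.
  rewrite -{1}us; have [_ u'0 _ _] := ode _ us01.
  apply: is_derive_inverse; last by rewrite gt_eqF.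
  - have /andP[us0 us1] := us01.
    near=> y.
    have y01 : 0 < u y < 1.
      apply/andP; split; near: y.
        by apply: (uc _ [set t | 0 < t]); exact: lt_nbhsr.
      by apply: (uc _ [set t | t < 1]); exact: lt_nbhsl.
    by apply: inj; rewrite XP.
  - by near=> y; exact: uc.
  - exact: udP.
pose v s := u s `^ ((m - 1) * (p - 1)) * (derive1 u s) `^ (p - 1).
pose q x := u x `^ (m - 1) * derive1 u x.
have q0 x : 0 < u x < 1 -> 0 < q x.
  move=> x1; have [_ u'0 _ _] := ode _ x1; have /andP[x0 _] := x1.
  by rewrite mulr_gt0// powR_gt0.
have vE x : 0 < u x < 1 -> v x = q x `^ (p - 1).
  move=> x1; have [_ u'0 _ _] := ode _ x1.
  by rewrite /v /q powRM ?powR_ge0 ?(ltW u'0)// powRrM.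
have wE x : 0 < u x < 1 -> is_derive x 1 w (m * q x).
  move=> x1; have /andP[x0 _] := x1.
  by apply: (is_derive_eq (is_derive1_comp (is_derive1_powR m x0) (udP _ x1))); rewrite mulrA.
have w'E x : 0 < u x < 1 -> derive1 w x = m * q x.
  by move=> /wE [_]; rewrite derive1E.
have fluxE x : 0 < u x < 1 -> flux m p u x = m `^ (p - 1) * v x.
  move=> x1; rewrite /flux -/w (w'E _ x1) (vE _ x1).
  have mq0 : 0 < m * q x by rewrite mulr_gt0// q0.
  rewrite gtr0_norm// mulrC.
  have -> : p - 2 = p - 1 - 1 by ring.
  by rewrite mulr_powRB1 ?(ltW mq0)// powRM ?(ltW m0) ?ltW ?q0.
pose Y s := v (X s).
have YP : phase_solution (reactF m p f) (c / m `^ (p - 1)) (1 / (p - 1)) Y.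
  move=> s s01; have us := XP s s01; have us01 : 0 < u (X s) < 1 by rewrite us.
  have [_ u'0 dv eqv] := ode _ us01.
  split; first by rewrite /Y vE// powR_gt0// q0.
  have vd : is_derive (X s) 1 v (derive1 v (X s)).
    by constructor; [exact: dv|rewrite derive1E].
  apply: (is_derive_eq (is_derive1_comp vd (Xd _ s01))).
  have -> : derive1 v (X s) = (c * derive1 u (X s) - f s) / m `^ (p - 1).
    apply: (mulfI (lt0r_neq0 mp0)); rewrite mulrCA mulfV ?gt_eqF// mulr1.
    by rewrite eqv us addrK.
  rewrite /Y vE// powR_mulVN ?q0// /reactF /q us.
  have s0 : 0 < s `^ (m - 1) by rewrite powR_gt0//; case/andP: s01.
  by field; rewrite !gt_eqF.
exists Y => //.
have notbelow (d k : R) : 0 < d < 1 -> 0 < k -> (forall s : R, 0 < s < d -> k <= Y s) -> False.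
  move=> /andP[d0 d1] k0 Yk.
  have vk x : 0 < u x < d -> k <= v x.
    move=> xd; have x1 : 0 < u x < 1 by have /andP[-> h] := xd; exact: lt_trans d1.
    by have := Yk _ xd; rewrite /Y (inj (X (u x)) x)// XP.
  pose b := X (d / 2).
  have ub : u b = d / 2 by rewrite XP//; apply/andP; split; lra.
  (* If the wave reaches 0, the continuity of the flux is contradicted, since the flux vanishes at
     the minimum value 0 of [u^m]. If it stays positive, [(u^m)'] is bounded below on a left
     half-line although [u^m] is bounded. *)
  case: (pselect (exists a, u a = 0)) => [[a ua]|nz].
  - have flux0 x : u x = 0 -> flux m p u x = 0.
      move=> ux; have wx : w x = 0 by rewrite /w ux powR0// gt_eqF.
      have /(_ _ _ _ _)[] := @derive1_at_min R w (x - 1) (x + 1) x.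
      - by lra.
      - by move=> t _; exact: wd.
      - by rewrite in_itv/=; apply/andP; split; lra.
      - by move=> t _; rewrite wx powR_ge0.
      by move=> _; rewrite -derive1E /flux -/w => ->; rewrite mulr0.
    have ab : a <= b.
      by rewrite leNgt; apply/negP => /ltW /umono; rewrite ua ub; lra.
    have fb : m `^ (p - 1) * k <= flux m p u b.
      rewrite fluxE; last by rewrite ub; apply/andP; split; lra.
      by rewrite ler_pM2l// vk// ub; apply/andP; split; lra.
    have K0 : 0 < m `^ (p - 1) * k by rewrite mulr_gt0.
    have [||x] := @IVT R (flux m p u) a b (m `^ (p - 1) * k / 2) ab.
    + by apply: continuous_subspaceT; exact: fluxc.
    + by rewrite flux0// ge_min le_max; apply/andP; split; apply/orP; [left|right]; lra.
    rewrite in_itv/= => /andP[ax xb] fx.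
    have ux : u x <= d / 2 by rewrite -ub umono.
    have /andP[ux0 _] := u01 x.
    have [ux00|uxn0] := eqVneq (u x) 0; first by move: fx; rewrite flux0//; lra.
    have uxp : 0 < u x by rewrite lt_def uxn0.
    move: fx; rewrite fluxE; last by rewrite uxp; lra.
    have := vk x (ltac:(rewrite uxp; lra)); rewrite -(ler_pM2l mp0).
    by lra.
  - have upos x : 0 < u x.
      by have /andP[h _] := u01 x; rewrite lt_def h andbT; apply/eqP => ux; apply: nz; exists x.
    pose K := m * k `^ (p - 1)^-1.
    have K0 : 0 < K by rewrite mulr_gt0// powR_gt0.
    (* On an interval of length [2 / K] the function [w], with values in [[0, 1]], would gain at
       least 2. *)
    pose a := b - 2 / K.
    have ab : a < b by rewrite /a ltrBlDr ltrDl divr_gt0.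
    have dom x : x <= b -> 0 < u x < d.
      by move=> /umono xb; rewrite upos (le_lt_trans xb)// ub; lra.
    have dom1 x : x <= b -> 0 < u x < 1.
      by move=> /dom /andP[-> h]; exact: lt_trans d1.
    have [|z /andP[az zb] e] := @MVT_is_derive R w (fun x => m * q x) a b ab.
      by move=> x /andP[_ xb]; apply: wE; exact: dom1.
    have qz : K <= m * q z.
      rewrite ler_pM2l// -[q z](@powR_mulVK _ _ (p - 1)) ?q0 ?dom1 ?(ltW zb)//.
      apply: ge0_ler_powR; rewrite ?nnegrE ?invr_ge0 ?(ltW pm0) ?(ltW k0) ?powR_ge0//.
      by rewrite -vE ?dom1 ?(ltW zb)// vk// dom// ltW.
    have w1 x : 0 <= w x <= 1.
      have e1 : (1 : R) `^ m = 1 by rewrite powR1.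
      rewrite powR_ge0/= -[X in _ <= X]e1.
      by have /andP[h1 h2] := u01 x; apply: ge0_ler_powR; rewrite ?nnegrE ?(ltW m0).
    have : K * (b - a) <= w b - w a by rewrite e ler_pM2r ?subr_gt0.
    have -> : K * (b - a) = 2 by rewrite /a; field; rewrite gt_eqF.
    by have /andP[_ ?] := w1 b; have /andP[? _] := w1 a; lra.
apply/cvgr0Pnorm_lt => e e0.
pose C := c / m `^ (p - 1); have C0 : 0 < C by rewrite divr_gt0.
(* Makes [C s <= e / 2] for [s < s0], so that [Y s >= e] and [Y' <= C] leave [Y >= e / 2] on all of
   []0, s[]. *)
pose s0 := Num.min (2^-1) (e / (2 * C)).
have s00 : 0 < s0 by rewrite lt_min invr_gt0 ltr0n/= divr_gt0// mulr_gt0.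
have s01 : s0 < 1 by rewrite gt_min; apply/orP; left; lra.
near=> s.
have sp : 0 < s by near: s; exact: nbhs_right_gt.
have ss0 : s < s0 by near: s; exact: nbhs_right_lt.
have slt1 : s < 1 by exact: lt_trans ss0 s01.
have s1 : 0 < s < 1 by rewrite sp.
have [Ys _] := YP s s1.
rewrite gtr0_norm// ltNge; apply/negP => Yse.
have e2 : 0 < e / 2 by rewrite divr_gt0.
apply: (@notbelow s (e / 2) s1 e2).
move=> t /andP[t0 ts].
have : Y s - C * s <= Y t - C * t.
  apply: (@le0_is_derive_ge _ (fun x => Y x - C * x)
    (fun x => C - reactF m p f x * Y x `^ (- (1 / (p - 1))) - C * 1)); first exact: ltW.
    move=> x /andP[tx xs].
    have x1 : 0 < x < 1 by rewrite (lt_le_trans t0 tx) (le_lt_trans xs slt1).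
    have [_ h] := YP x x1.
    exact: is_deriveB.
  move=> x /andP[tx xs]; rewrite mulr1 addrAC subrr add0r oppr_le0.
  have x0 : 0 < x by exact: lt_trans tx.
  have x1 : x < 1 by exact: lt_trans xs slt1.
  by rewrite !mulr_ge0 ?powR_ge0 ?invr_ge0// ltW// fpos// x0.
have : C * s <= e / 2.
  have h : s <= e / (2 * C) by rewrite (le_trans (ltW ss0))// ge_min lexx orbT.
  have -> : e / 2 = C * (e / (2 * C)) by field; rewrite gt_eqF.
  by rewrite ler_pM2l.
have : 0 < C * t by rewrite mulr_gt0.
by move: (C * t) (C * s) (Y t) (Y s) Yse => a b g h; clear => h1 h2 h3 h4; lra.
Unshelve. all: by end_near. Qed.

(** * From a phase-plane solution to a travelling wave *)

Lemma is_derive0_of_bound (R : realType) (W : R -> R) (x : R) :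
  (forall e, 0 < e -> \forall y \near x, `|W y - W x| <= e * `|y - x|) ->
  is_derive x 1 W 0.
Proof.
move=> Wx.
have cv : h^-1 *: (W (h *: (1:R) + x) - W x) @[h --> (0:R)^'] --> (0:R).
  apply/cvgr0Pnorm_lt => e e0.
  have e2 : 0 < e / 2 by rewrite divr_gt0.
  have [d /= d0 Hd] := Wx _ e2.
  exists d => //= h /=; rewrite sub0r normrN => hd h0.
  rewrite /GRing.scale/= mulr1 normrM normfV ltr_pdivrMl ?normr_gt0//.
  have := Hd (h + x); rewrite /= opprD addrCA subrr addr0 normrN => /(_ hd).
  rewrite addrK => /le_lt_trans; apply.
  by rewrite mulrC ltr_pM2l ?normr_gt0//; lra.
split; first by apply/cvg_ex; exists 0.
exact: cvg_lim cv.
Qed.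

(* The profile is the generalized inverse of [X]; it sticks to 0 and to 1
   outside the range of [X], which may or may not be all of R. *)
Lemma inverse_profile (R : realType) (X dX : R -> R) :
  (forall s : R, 0 < s < 1 -> is_derive s 1 X (dX s)) ->
  (forall s : R, 0 < s < 1 -> 0 < dX s) ->
  exists u : R -> R,
  [/\ forall x, 0 <= u x <= 1, {homo u : x y / x <= y},
      (forall s, 0 < s < 1 -> u (X s) = s) /\ (forall x, 0 < u x < 1 -> X (u x) = x),
      (forall x, {for x, continuous u}) /\
      (u x @[x --> -oo] --> (0 : R) /\ u x @[x --> +oo] --> (1 : R)) &
      forall x : R, 0 < u x < 1 -> is_derive x 1 u (dX (u x))^-1].
Proof.
move=> XP dX0.
have Xincr s t : s < t -> 0 < s -> t < 1 -> X s < X t.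
  move=> st s0 t1.
  have dom x : s <= x <= t -> 0 < x < 1.
    by move=> /andP[sx xt]; rewrite (lt_le_trans s0 sx) (le_lt_trans xt t1).
  apply: (@gt0_is_derive_lt _ _ dX) => [//|x /dom /XP//|x /andP[sx xt]].
  by apply/dX0/dom; rewrite !ltW.
have Xle s t : X s <= X t -> 0 < s < 1 -> 0 < t < 1 -> s <= t.
  move=> Xst /andP[s0 s1] /andP[t0 t1]; rewrite leNgt; apply/negP => ts.
  by have := Xincr _ _ ts t0 s1; rewrite ltNge Xst.
(* Adding 0 keeps the set nonempty and gives the value 0 to the left of the range of [X]. *)
pose E x := [set s | s = 0 \/ 0 < s < 1 /\ X s <= x].
have E0 x : E x 0 by left.
have E1 x : ubound (E x) 1 by move=> s [->//|[/andP[_ /ltW]]].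
have supE x : has_sup (E x) by split; [exists 0|exists 1].
pose u x := sup (E x).
(* Together with [uB], this is an order adjunction between [u] and [X], on which continuity, the
   limits and both inverse identities rest. *)
have uA s x : 0 < s < 1 -> x <= X s -> u x <= s.
  move=> s01 xs; apply: ge_sup; first by exists 0.
  move=> t [->|[t01 Xt]]; first by case/andP: s01 => /ltW.
  exact: Xle (le_trans Xt xs) t01 s01.
have uB s x : 0 < s < 1 -> X s <= x -> s <= u x.
  by move=> s01 xs; apply: ub_le_sup; [exists 1|right].
have uA' s x : 0 < s < 1 -> s < u x -> X s < x.
  by move=> s01; apply: contraTT; rewrite -!leNgt; exact: uA.
have uB' s x : 0 < s < 1 -> u x < s -> x < X s.
  by move=> s01; apply: contraTT; rewrite -!leNgt; exact: uB.
have u01 x : 0 <= u x <= 1.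
  apply/andP; split; first by apply: ub_le_sup => //; exists 1.
  by apply: ge_sup; first by exists 0.
have umono : {homo u : x y / x <= y}.
  move=> x y xy; apply: ge_sup; first by exists 0.
  move=> s [->|[s01 Xs]]; first by have /andP[] := u01 y.
  exact: uB (le_trans Xs xy).
have uX s : 0 < s < 1 -> u (X s) = s.
  by move=> s01; apply/eqP; rewrite eq_le uA ?uB.
have between (a b : R) : 0 <= a -> a < b -> b <= 1 -> exists2 s, 0 < s < 1 & a < s < b.
  by move=> a0 ab b1; exists ((a + b) / 2); apply/andP; split; lra.
have uc x : {for x, continuous u}.
  apply/cvgrPdist_lt => e e0; have /andP[ux0 ux1] := u01 x.
  have up : \forall y \near x, u y < u x + e.
    case: (ltP (u x) 1) => u1.
      have [||s s01 /andP[us se]] := between (u x) (Num.min 1 (u x + e)) ux0.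
      - by rewrite lt_min u1 ltrDl.
      - by rewrite ge_min lexx.
      near=> y; have : u y <= s.
        by apply: uA => //; apply: ltW; near: y; apply: lt_nbhsl; exact: uB'.
      by move=> /le_lt_trans; apply; move: se; rewrite lt_min => /andP[].
    near=> y; have /andP[_ h] := u01 y; rewrite (le_lt_trans h)//.
    by rewrite (le_lt_trans u1)// ltrDl.
  have dn : \forall y \near x, u x - e < u y.
    case: (ltP 0 (u x)) => u0.
      have [|||s s01 /andP[es su]] := between (Num.max 0 (u x - e)) (u x).
      - by rewrite le_max lexx.
      - by rewrite gt_max u0 ltrBlDr ltrDl.
      - exact: ux1.
      near=> y; have : s <= u y.
        by apply: uB => //; apply: ltW; near: y; apply: lt_nbhsr; exact: uA'.
      by apply: lt_le_trans; move: es; rewrite gt_max => /andP[].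
    near=> y; have /andP[h _] := u01 y; rewrite (lt_le_trans _ h)//.
    by rewrite subr_lt0 (le_lt_trans u0).
  near=> y; rewrite ltr_norml; apply/andP; split.
    by rewrite ltrBrDl ltrBlDr; near: y.
  by rewrite ltrBlDr -ltrBlDl; near: y.
have XK x : 0 < u x < 1 -> X (u x) = x.
  move=> ux; have /andP[ux0 ux1] := ux.
  have Xc := is_derive_continuous (XP _ ux).
  case: (ltgtP (X (u x)) x) => // h.
  - have : \forall s \near u x, X s < x by apply: (Xc [set t | t < x]); exact: lt_nbhsl.
    move=> [d /= d0 Hd].
    pose s := (u x + Num.min 1 (u x + d)) / 2.
    have us : u x < s by rewrite /s; case: (leP 1 (u x + d)); lra.
    have s1 : s < 1 by rewrite /s; case: (leP 1 (u x + d)); lra.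
    have sd : s - u x < d by rewrite /s; case: (leP 1 (u x + d)); lra.
    have := Hd s; rewrite /= distrC gtr0_norm ?subr_gt0// => /(_ sd) /ltW.
    by move=> /(uB _ _ (ltac:(by rewrite s1 (lt_trans ux0)) : 0 < s < 1)); rewrite leNgt us.
  - have : \forall s \near u x, x < X s by apply: (Xc [set t | x < t]); exact: lt_nbhsr.
    move=> [d /= d0 Hd].
    pose s := (u x + Num.max 0 (u x - d)) / 2.
    have us : s < u x by rewrite /s; case: (leP 0 (u x - d)); lra.
    have s1 : 0 < s by rewrite /s; case: (leP 0 (u x - d)); lra.
    have sd : u x - s < d by rewrite /s; case: (leP 0 (u x - d)); lra.
    have := Hd s; rewrite /= gtr0_norm ?subr_gt0// => /(_ sd) /ltW.
    by move=> /(uA _ _ (ltac:(by rewrite s1 (lt_trans us)) : 0 < s < 1)); rewrite leNgt us.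
exists u; split => //.
- split => //; split.
    apply/cvgr0Pnorm_lt => e e0.
    have [||s s01 /andP[es su]] := between 0 (Num.min 1 e) (lexx 0).
    + by rewrite lt_min ltr01.
    + by rewrite ge_min lexx.
    near=> x; have /andP[h _] := u01 x; rewrite ger0_norm//.
    have : u x <= s by apply: uA => //; near: x; exact: nbhs_ninfty_le.
    by move=> /le_lt_trans; apply; move: su; rewrite lt_min => /andP[].
  apply/cvgrPdist_lt => e e0.
  have [|||s s01 /andP[es su]] := between (Num.max 0 (1 - e)) 1.
  + by rewrite le_max lexx.
  + by rewrite gt_max ltr01 ltrBlDr ltrDl.
  + exact: lexx.
  near=> x; have /andP[_ h] := u01 x; rewrite ger0_norm ?subr_ge0//.
  have : s <= u x by apply: uB => //; near: x; exact: nbhs_pinfty_ge.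
  by move: es; rewrite gt_max => /andP[_]; lra.
- move=> x ux; have /andP[ux0 ux1] := ux.
  have h : is_derive (X (u x)) 1 u (dX (u x))^-1.
    apply: is_derive_inverse; last by rewrite gt_eqF// dX0.
    + near=> s; apply: uX; apply/andP; split; near: s; [exact: lt_nbhsr|exact: lt_nbhsl].
    + near=> s; apply: is_derive_continuous (XP s _).
      by apply/andP; split; near: s; [exact: lt_nbhsr|exact: lt_nbhsl].
    + exact: XP.
  by rewrite XK in h.
Unshelve. all: by end_near. Qed.

(** [D = dH / dX] is the slope of [H] along the wave. Beyond an edge of a finite wave [H \o u] is
    constant; as [D] tends to 0 at both ends, increments from the edge are small relative to the
    distance, so differentiability holds across it. It is applied to [s^m] and to the flux minus
    [c s]. *)
Lemma is_derive_profile (R : realType) (X dX u H dH D : R -> R) :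
  (forall s : R, 0 < s < 1 -> 0 < dX s) ->
  (forall x, 0 <= u x <= 1) -> {homo u : x y / x <= y} ->
  (forall s, 0 < s < 1 -> u (X s) = s) -> (forall x, 0 < u x < 1 -> X (u x) = x) ->
  (forall x, {for x, continuous u}) ->
  (forall x : R, 0 < u x < 1 -> is_derive x 1 u (dX (u x))^-1) ->
  (forall s : R, 0 < s < 1 -> is_derive s 1 H (dH s)) ->
  (forall s : R, 0 < s < 1 -> dH s / dX s = D s) ->
  H s @[s --> (0:R)^'+] --> H 0 -> H s @[s --> (1:R)^'-] --> H 1 ->
  D s @[s --> (0:R)^'+] --> (0:R) -> D s @[s --> (1:R)^'-] --> (0:R) ->
  D 0 = 0 -> D 1 = 0 ->
  forall x : R, is_derive x 1 (H \o u) (D (u x)).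
Proof.
move=> dX0 u01 umono uX XK uc ud HP HD H0 H1 D0 D1 D00 D10 x.
have inner y : 0 < u y < 1 -> is_derive y 1 (H \o u) (D (u y)).
  by move=> uy; rewrite -HD//; apply: is_derive1_comp; [exact: HP|exact: ud].
have MVTu y z e : y < z -> 0 < u y -> u z < 1 ->
    (forall t, y <= t <= z -> `|D (u t)| <= e) ->
    `|H (u z) - H (u y)| <= e * (z - y).
  move=> yz uy0 uz1 De.
  have [|t /andP[yt tz] eq] := @MVT_is_derive R (H \o u) (D \o u) y z yz.
    move=> t /andP[yt tz]; apply: inner.
    by rewrite (lt_le_trans uy0 (umono _ _ yt)) (le_lt_trans (umono _ _ tz) uz1).
  rewrite [H (u z) - _]eq normrM (gtr0_norm (_ : 0 < z - y)) ?subr_gt0//.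
  by rewrite ler_pM2r ?subr_gt0// De// !ltW.
have ltX0 s y : u y = 0 -> 0 < s < 1 -> y < X s.
  move=> uy s01; rewrite ltNge; apply/negP => /umono.
  by rewrite uX// uy leNgt; case/andP: s01 => ->.
have ltX1 s y : u y = 1 -> 0 < s < 1 -> X s < y.
  move=> uy s01; rewrite ltNge; apply/negP => /umono.
  by rewrite uX// uy leNgt; case/andP: s01 => _ ->.
have /andP[ux0 ux1] := u01 x.
have [uxE|uxn0] := eqVneq (u x) 0.
  rewrite uxE D00; apply: is_derive0_of_bound => e e0.
  have : \forall s \near (0:R)^'+, `|D s| < e by move: D0 => /cvgr0Pnorm_lt /(_ e e0).
  move=> [d /= d0 Hd].
  near=> y.
  have uy : u y < Num.min 1 d.
    near: y; apply: (uc _ [set t | t < Num.min 1 d]).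
    by apply: lt_nbhsl; rewrite uxE lt_min ltr01.
  have /andP[uy1 uyd] : (u y < 1) && (u y < d) by rewrite -lt_min.
  have /andP[uy0 _] := u01 y.
  have [uyE|uyn0] := eqVneq (u y) 0.
    by rewrite /= uyE uxE subrr normr0 mulr_ge0 ?(ltW e0)//.
  have uyp : 0 < u y by rewrite lt_def uyn0.
  have xy : x < y.
    by rewrite ltNge; apply/negP => /umono; rewrite uxE leNgt uyp.
  (* The mean value theorem requires points where [0 < u < 1]. It is used between [X s] and [y],
     with [x < X s < y], and the edge value is reached by letting [s] tend to 0. *)
  have cv : `|H (u y) - H s| @[s --> (0:R)^'+] --> `|H (u y) - H 0|.
    by apply: cvg_norm; apply: cvgB H0; exact: cvg_cst.
  rewrite /= uxE; apply: (cvgr_to_le cv); near=> s.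
  have s0 : 0 < s by near: s; exact: nbhs_right_gt.
  have sy : s < u y by near: s; exact: nbhs_right_lt.
  have s01 : 0 < s < 1 by rewrite s0 (lt_trans sy).
  have xX := ltX0 s x uxE s01.
  have Xy : X s < y.
    by rewrite ltNge; apply/negP => /umono; rewrite uX// leNgt sy.
  have := @MVTu (X s) y e Xy; rewrite uX// => /(_ s0 uy1) h.
  apply: (@le_trans _ _ (e * (y - X s))).
    apply: h => t /andP[st ty]; apply/ltW/Hd => /=; last first.
      by rewrite (lt_le_trans s0)// -(uX s s01) umono.
    by rewrite sub0r normrN ger0_norm ?(le_lt_trans (umono _ _ ty))//; have /andP[] := u01 t.
  by rewrite ler_pM2l// gtr0_norm ?subr_gt0// lerD2l lerN2 ltW.
have [uxE|uxn1] := eqVneq (u x) 1.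
  rewrite uxE D10; apply: is_derive0_of_bound => e e0.
  have : \forall s \near (1:R)^'-, `|D s| < e by move: D1 => /cvgr0Pnorm_lt /(_ e e0).
  move=> [d /= d0 Hd].
  near=> y.
  have uy : Num.max 0 (1 - d) < u y.
    near: y; apply: (uc _ [set t | Num.max 0 (1 - d) < t]).
    by apply: lt_nbhsr; rewrite uxE gt_max ltr01 ltrBlDr ltrDl.
  have /andP[uy0 uyd] : (0 < u y) && (1 - d < u y) by rewrite -gt_max.
  have /andP[_ uy1] := u01 y.
  have [uyE|uyn1] := eqVneq (u y) 1.
    by rewrite /= uyE uxE subrr normr0 mulr_ge0 ?(ltW e0)//.
  have uyl : u y < 1 by rewrite lt_neqAle uyn1.
  have yx : y < x.
    by rewrite ltNge; apply/negP => /umono; rewrite uxE leNgt uyl.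
  have cv : `|H (u y) - H s| @[s --> (1:R)^'-] --> `|H (u y) - H 1|.
    by apply: cvg_norm; apply: cvgB H1; exact: cvg_cst.
  rewrite /= uxE; apply: (cvgr_to_le cv); near=> s.
  have s1 : s < 1 by near: s; exact: nbhs_left_lt.
  have sy : u y < s by near: s; exact: nbhs_left_gt.
  have s01 : 0 < s < 1 by rewrite s1 (lt_trans uy0).
  have xX := ltX1 s x uxE s01.
  have Xy : y < X s.
    by rewrite ltNge; apply/negP => /umono; rewrite uX// leNgt sy.
  have := @MVTu y (X s) e Xy; rewrite uX// => /(_ uy0 s1) h.
  rewrite distrC; apply: (@le_trans _ _ (e * (X s - y))).
    apply: h => t /andP[yt ts]; apply/ltW/Hd => /=; last first.
      by rewrite (le_lt_trans _ s1)// -(uX s s01) umono.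
    rewrite ger0_norm ?subr_ge0; last by have /andP[] := u01 t.
    by have := umono _ _ yt; lra.
  by rewrite ler_pM2l// ltr0_norm ?subr_lt0// opprB lerD2r ltW.
by apply: inner; rewrite lt_def uxn0 ux0 lt_neqAle uxn1.
Unshelve. all: by end_near. Qed.

Lemma integral_derive_compact (R : realType) (P dP : R -> R) (M : R) :
  (forall x, {for x, continuous dP}) -> (forall x : R, is_derive x 1 P (dP x)) ->
  (forall x : R, M < `|x| -> P x = 0) ->
  (\int[@lebesgue_measure R]_x dP x)%R = 0.
Proof.
move=> dPc PP P0.
pose L := `|M| + 1.
have ML : M < L by rewrite /L (le_lt_trans (ler_norm _))// ltrDl.
have L0 : 0 < L by rewrite /L ltr_pwDr.
have dP0 (x : R) : x \notin `[- L, L] -> dP x = 0.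
  rewrite in_itv/= -ler_norml -ltNge => xL.
  have h : is_derive x 1 P 0.
    apply: (@near_eq_is_derive _ _ _ (cst 0)).
    near=> y; rewrite P0//; near: y.
    apply: (@norm_continuous _ R^o x [set t | M < t]).
    by apply: lt_nbhsr; exact: lt_trans xL.
  by rewrite -(@derive_val _ _ _ _ _ _ _ (PP x)) (@derive_val _ _ _ _ _ _ _ h).
have -> : (\int[@lebesgue_measure R]_x dP x)%R = (\int[@lebesgue_measure R]_(x in `[- L, L]) dP x)%R.
  rewrite [RHS]Rintegral_mkcond; congr (Rintegral _ _ _); apply/funext => x.
  rewrite patchE; case: ifPn => // xL; apply: dP0; apply: contraNN xL.
  by rewrite inE.
rewrite /Rintegral (@integral_cc_FTC2 R dP P)//=; first last.
  by lra.
by rewrite !P0 ?subrr// ?normrN (gtr0_norm L0).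
Unshelve. all: by end_near. Qed.

(** [dX] is the slope [u^(m - 1) / q] of the position as a function of the height, with [q = Y^k];
    the profile is the inverse of its primitive. Two functions of the height carry the rest: [s^m],
    with slope [m q] along the wave, and [H2], the flux minus [c s], with slope [- f]. As [H2 \o u]
    is differentiable everywhere, the flux is continuous and the weak form integrates a total
    derivative. *)
Lemma phase_travelling_wave (R : realType) (m p : R) (f df : R -> R) (c : R)
    (Y : R -> R) :
  0 < m -> 1 < p -> C1_unit_itv f df -> f 0 = 0 -> f 1 = 0 ->
  phase_solution (reactF m p f) (c / m `^ (p - 1)) (1 / (p - 1)) Y ->
  Y s @[s --> (0:R)^'+] --> 0 -> Y s @[s --> (1:R)^'-] --> 0 ->
  exists u, travelling_wave m p f c u.
Proof.
move=> m0 p1 fC f0 f1 YP Yl Yr.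
have pm0 : 0 < p - 1 by rewrite subr_gt0.
have pm_neq0 : p - 1 != 0 by rewrite gt_eqF.
have mp0 : 0 < m `^ (p - 1) by exact: powR_gt0.
pose k := 1 / (p - 1); have k0 : 0 < k by rewrite divr_gt0.
have kV : k = (p - 1)^-1 by rewrite /k div1r.
pose dX s := s `^ (m - 1) * Y s `^ (- k).
have Y_gt0 (s : R) : 0 < s < 1 -> 0 < Y s by move=> /YP[].
have dX0 (s : R) : 0 < s < 1 -> 0 < dX s.
  move=> s1; have /andP[s0 _] := s1.
  by rewrite mulr_gt0 ?powR_gt0 ?Y_gt0.
have [X _ XP] := @continuous_primitive R dX 0 1 2^-1
  (ltac:(apply/andP; split; lra)) (ltac:(
    move=> s s1; have /andP[s0 _] := s1; have [Ys dY] := YP s s1;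
    apply: cvgM; [exact: (is_derive_continuous (is_derive1_powR (m - 1) s0))|
      exact: (is_derive_continuous (is_derive1_comp (is_derive1_powR (- k) Ys) dY))])).
have [u [u01 umono [uX XK] [uc [uNy uy]] ud]] := inverse_profile XP dX0.
(* The values of [Y] at 0 and 1 are arbitrary, yet a finite wave takes these heights; the value 0
   prolongs [Y] continuously. *)
pose Y0 s := if 0 < s < 1 then Y s else 0.
have Y0E s : 0 < s < 1 -> Y0 s = Y s by rewrite /Y0 => ->.
have Y00 : Y0 0 = 0 by rewrite /Y0 ltxx.
have Y01 : Y0 1 = 0 by rewrite /Y0 ltxx andbF.
have Y0l : Y0 s @[s --> (0:R)^'+] --> 0.
  apply: cvg_trans Yl; apply: near_eq_cvg; near=> s; rewrite Y0E//.
  by apply/andP; split; near: s; [exact: nbhs_right_gt|exact: nbhs_right_lt].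
have Y0r : Y0 s @[s --> (1:R)^'-] --> 0.
  apply: cvg_trans Yr; apply: near_eq_cvg; near=> s; rewrite Y0E//.
  by apply/andP; split; near: s; [exact: nbhs_left_gt|exact: nbhs_left_lt].
have Y0_ge0 s : 0 <= Y0 s by rewrite /Y0; case: ifPn => // /Y_gt0/ltW.
have powk (F : set_system R) (FF : Filter F) : Y0 s @[s --> F] --> 0 ->
    m * Y0 s `^ k @[s --> F] --> (0:R).
  move=> h; have e : m * Num.max 0 0 `^ k = 0 by rewrite maxxx powR0 ?mulr0 ?gt_eqF.
  rewrite -[X in _ --> X]e; apply: cvgMr.
  have -> : (fun s => Y0 s `^ k) = (fun s => Num.max (Y0 s) 0 `^ k).
    by apply/funext => s; rewrite max_l.
  exact: (@cvg_comp _ _ _ Y0 (fun t => Num.max t 0 `^ k) _ _ _ h (continuous_powR_max0 k0)).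
have w' (x : R) : is_derive x 1 ((fun s => s `^ m) \o u) (m * Y0 (u x) `^ k).
  apply: (@is_derive_profile R X dX u _ (fun s => m * s `^ (m - 1))
    (fun s => m * Y0 s `^ k) dX0 u01 umono uX XK uc ud).
  - by move=> s /andP[s0 _]; exact: is_derive1_powR.
  - move=> s s1; have /andP[s0 _] := s1; rewrite Y0E// /dX powRN.
    by field; rewrite !gt_eqF ?powR_gt0 ?Y_gt0.
  - by rewrite powR0 ?gt_eqF//; exact: powR_cvg0.
  - by apply: cvg_at_left_filter; exact: (is_derive_continuous (is_derive1_powR m ltr01)).
  - exact: powk.
  - exact: powk.
  - by rewrite Y00 powR0 ?mulr0 ?gt_eqF.
  - by rewrite Y01 powR0 ?mulr0 ?gt_eqF.
have fcl (x : R) : 0 <= x <= 1 -> forall e : R, 0 < e ->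
    \forall y \near x, 0 <= y <= 1 -> `|f x - f y| < e.
  by move=> x1 e e0; exact: (C1_unit_itv_continuous fC).
pose H2 s := m `^ (p - 1) * Y0 s - c * s.
have W' (x : R) : is_derive x 1 (H2 \o u) (- f (u x)).
  apply: (@is_derive_profile R X dX u H2
    (fun s => - (m `^ (p - 1) * (reactF m p f s * Y s `^ (- k))))
    (fun s => - f s) dX0 u01 umono uX XK uc ud).
  - move=> s s1; have /andP[s0 s1'] := s1; have [_ dY] := YP s s1.
    apply: (@near_eq_is_derive _ _ _ (fun s => m `^ (p - 1) * Y s - c * s)).
      near=> t; rewrite /H2 Y0E//.
      by apply/andP; split; near: t; [exact: lt_nbhsr|exact: lt_nbhsl].
    apply: (is_derive_eq (is_deriveB (is_deriveZ (m `^ (p - 1)) dY)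
      (is_deriveZ c (is_derive_id s 1)))).
    by rewrite /GRing.scale/=; field; rewrite gt_eqF.
  - move=> s s1; have /andP[s0 _] := s1; rewrite /dX /reactF.
    by field; rewrite !gt_eqF ?powR_gt0 ?Y_gt0.
  - have e : m `^ (p - 1) * 0 - c * 0 = H2 0 by rewrite /H2 Y00.
    rewrite -[X in _ --> X]e; apply: cvgB; apply: cvgMr; first exact: Y0l.
    by apply: cvg_at_right_filter; exact: cvg_id.
  - have e : m `^ (p - 1) * 0 - c * 1 = H2 1 by rewrite /H2 Y01.
    rewrite -[X in _ --> X]e; apply: cvgB; apply: cvgMr; first exact: Y0r.
    by apply: cvg_at_left_filter; exact: cvg_id.
  - apply/cvgr0Pnorm_lt => e e0.
    have h : \forall y \near (0:R)^'+, 0 <= y <= 1 -> `|f 0 - f y| < e.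
      by apply: cvg_within; apply: fcl; rewrite ?lexx ?ler01.
    near=> s; rewrite normrN -[f s]subr0 -f0 distrC.
    have : 0 <= s <= 1 -> `|f 0 - f s| < e by near: s.
    by apply; apply/andP; split; apply: ltW; near: s; [exact: nbhs_right_gt|exact: nbhs_right_lt].
  - apply/cvgr0Pnorm_lt => e e0.
    have h : \forall y \near (1:R)^'-, 0 <= y <= 1 -> `|f 1 - f y| < e.
      by apply: cvg_within; apply: fcl; rewrite ?lexx ?ler01.
    near=> s; rewrite normrN -[f s]subr0 -f1 distrC.
    have : 0 <= s <= 1 -> `|f 1 - f s| < e by near: s.
    by apply; apply/andP; split; apply: ltW; near: s; [exact: nbhs_left_gt|exact: nbhs_left_lt].
  - by rewrite f0 oppr0.
  - by rewrite f1 oppr0.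
have fuc (x : R) : {for x, continuous (f \o u)}.
  apply/cvgrPdist_lt => e e0.
  near=> y; suff : 0 <= u y <= 1 -> `|f (u x) - f (u y)| < e by apply.
  by near: y; exact: (uc x _ (fcl (u x) (u01 x) e e0)).
have w'E x : derive1 (fun s => u s `^ m) x = m * Y0 (u x) `^ k.
  by have [_] := w' x; rewrite derive1E.
have fluxE x : flux m p u x = m `^ (p - 1) * Y0 (u x).
  rewrite /flux w'E; have [Y0u|Y0u] := eqVneq (Y0 (u x)) 0.
    by rewrite Y0u powR0 ?gt_eqF// !mulr0.
  have Yp : 0 < Y0 (u x) by rewrite lt_def Y0u Y0_ge0.
  have a0 : 0 < m * Y0 (u x) `^ k by rewrite mulr_gt0// powR_gt0.
  rewrite gtr0_norm// mulrC; have -> : p - 2 = p - 1 - 1 by ring.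
  rewrite (mulr_powRB1 (ltW a0) pm0) powRM ?(ltW m0) ?powR_ge0//.
  by rewrite -powRrM kV mulVf// powRr1// ltW.
exists u; split => //.
- split.
  + by move=> x; have [] := w' x.
  + move=> x; have -> : flux m p u = fun x => (H2 \o u) x + c * u x.
      by apply/funext => y; rewrite fluxE /H2 /= subrK.
    apply: cvgD; first exact: (is_derive_continuous (W' x)).
    by apply: cvgMr; exact: uc.
  + move=> phi [phid phic].
    have phi1 (x : R) : is_derive x 1 phi (derive1 phi x).
      by constructor; [exact: (phid 0%N)|rewrite derive1E].
    have phi2 x : {for x, continuous (derive1 phi)}.
      exact/differentiable_continuous/derivable1_diffP/(phid 1%N).
    have [M [_ MP]] := compact_bounded phic.
    (* The integrand is the derivative of [(H2 \o u) phi], because [H2 \o u] has derivative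
       [- f (u)]. *)
    apply: (@integral_derive_compact R (fun x => (H2 \o u) x * phi x) _ (M + 1)).
    * move=> x; apply: cvgB; last by apply: cvgM; [exact: fuc|exact: (is_derive_continuous (phi1 x))].
      apply: cvgM; last exact: phi2.
      have -> : (fun x => flux m p u x - c * u x) = H2 \o u.
        by apply/funext => y; rewrite fluxE.
      rewrite fluxE; exact: (is_derive_continuous (W' x)).
    * move=> x; apply: (is_derive_eq (is_deriveM (W' x) (phi1 x))).
      by rewrite fluxE /GRing.scale/= /H2; ring.
    * move=> x Mx; have [->|phix] := eqVneq (phi x) 0; first by rewrite mulr0.
      have := MP (M + 1) (ltac:(by rewrite ltrDl)) x (subset_closure (phix : [set x | phi x != 0] x)).
      by rewrite /= leNgt Mx.
- move=> x ux; have /andP[ux0 ux1] := ux.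
  have u'E y : 0 < u y < 1 -> derive1 u y = (dX (u y))^-1.
    by move=> /ud [_]; rewrite derive1E.
  have dXx := dX0 _ ux.
  have vE y : 0 < u y < 1 ->
      u y `^ ((m - 1) * (p - 1)) * (derive1 u y) `^ (p - 1) = Y (u y).
    move=> uy1; have /andP[uy0 _] := uy1; have Yu := Y_gt0 _ uy1.
    rewrite u'E// powRrM -powRM ?powR_ge0 ?invr_ge0 ?(ltW (dX0 _ uy1))//.
    have -> : u y `^ (m - 1) * (dX (u y))^-1 = Y (u y) `^ k.
      rewrite /dX powRN; field.
      by rewrite !gt_eqF ?powR_gt0.
    by rewrite -powRrM kV mulVf// powRr1// ltW.
  have [Yu dY] := YP _ ux.
  have vd := is_derive1_comp dY (ud x ux).
  have vd' : is_derive x 1 (fun s => u s `^ ((m - 1) * (p - 1)) * (derive1 u s) `^ (p - 1))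
     ((c / m `^ (p - 1) - reactF m p f (u x) * Y (u x) `^ (- k)) * (dX (u x))^-1).
    apply: near_eq_is_derive vd; near=> y; rewrite vE//.
    apply/andP; split; near: y.
      by apply: (uc _ [set t | 0 < t]); exact: lt_nbhsr.
    by apply: (uc _ [set t | t < 1]); exact: lt_nbhsl.
  split.
  + by have [] := ud x ux.
  + by rewrite u'E// invr_gt0.
  + by have [] := vd'.
  + have -> : derive1 (fun s => u s `^ ((m - 1) * (p - 1)) * (derive1 u s) `^ (p - 1)) x =
      (c / m `^ (p - 1) - reactF m p f (u x) * Y (u x) `^ (- k)) * (dX (u x))^-1.
      by rewrite derive1E; have [_] := vd'.
    rewrite u'E// /dX /reactF powRN; field.
    by rewrite !gt_eqF ?powR_gt0.
Unshelve. all: by end_near. Qed.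

(** * Trial functions and the functional *)

Definition int01 (R : realType) (f : R -> R) : \bar R :=
  (\int[@lebesgue_measure R]_(u in `]0%R, 1%R[) (f u)%:E)%E.

Section int01.
Variable R : realType.
Implicit Types f g : R -> R.

Definition cont01 f := forall u : R, 0 < u < 1 -> {for u, continuous f}.
Definition ge01 f := forall u : R, 0 < u < 1 -> 0 <= f u.

Lemma int01_measurable f : cont01 f ->
  measurable_fun (`]0%R, 1%R[%classic : set (measurableTypeR R)) (fun u => (f u)%:E).
Proof.
move=> fc; apply/measurable_EFinP; apply: open_continuous_measurable_fun => //.
by move=> x; rewrite inE/= in_itv/=; exact: fc.
Qed.

Lemma int01_ge0 f : ge01 f -> (0 <= int01 f)%E.
Proof.
by move=> f0; apply: integral_ge0 => u; rewrite /= in_itv/= lee_fin; exact: f0.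
Qed.

Lemma int01_ext f g : (forall u, 0 < u < 1 -> f u = g u) -> int01 f = int01 g.
Proof.
by move=> fg; apply: eq_integral => u; rewrite inE/= in_itv/= => /fg ->.
Qed.

Lemma int01_scale f a : 0 <= a -> cont01 f -> ge01 f ->
  int01 (fun u => a * f u) = (a%:E * int01 f)%E.
Proof.
move=> a0 fc f0; rewrite /int01 -ge0_integralZl_EFin//.
- exact: int01_measurable.
Qed.

Lemma int01_add f g : cont01 f -> ge01 f -> cont01 g -> ge01 g ->
  int01 (fun u => f u + g u) = (int01 f + int01 g)%E.
Proof.
move=> fc f0 gc g0; rewrite /int01 -ge0_integralD//.
- exact: int01_measurable.
- exact: int01_measurable.
Qed.

Lemma int01_le f g : cont01 f -> ge01 f -> cont01 g ->
  (forall u, 0 < u < 1 -> f u <= g u) -> (int01 f <= int01 g)%E.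
Proof.
move=> fc f0 gc fg; apply: ge0_le_integral => //.
- exact: int01_measurable.
- exact: int01_measurable.
Qed.

Lemma int01_cst (a : R) : int01 (cst a) = a%:E.
Proof.
rewrite /int01 (integral_cst _ _ (a%:E))//= lebesgue_measure_itv/= lte_fin ltr01.
by rewrite -EFinB subr0 mule1.
Qed.

Lemma int01_eq0 f : cont01 f -> ge01 f -> (int01 f <= 0)%E ->
  forall u, 0 < u < 1 -> f u = 0.
Proof.
move=> fc f0 If u u01; apply/eqP; rewrite eq_le f0// andbT leNgt; apply/negP => fu.
have /andP[u0 u1] := u01.
have : \forall x \near u, f u / 2 < f x.
  by apply: (fc _ u01 [set t | f u / 2 < t]); apply: lt_nbhsr; lra.
move=> [d /= d0 Hd].
pose e := Num.min (d / 2) (Num.min (u / 2) ((1 - u) / 2)).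
have e0 : 0 < e by rewrite /e !lt_min; apply/and3P; split; lra.
have ed : e <= d / 2 by rewrite /e ge_min lexx.
have eu : e <= u / 2 by rewrite /e !ge_min lexx orbT.
have e1 : e <= (1 - u) / 2 by rewrite /e !ge_min lexx !orbT.
have := @integral_oo_ge R f (cst (f u / 2)) (fun x => f u / 2 * x) u (u + e) fc f0 u0.
rewrite ltrDl => /(_ e0 ltac:(lra) ltac:(by move=> x _; exact: cvg_cst)).
have dom x : u <= x <= u + e -> 0 <= f u / 2 <= f x.
  move=> /andP[ux xe]; rewrite divr_ge0 ?(ltW fu)//=; apply/ltW/Hd => /=.
  by rewrite distrC ger0_norm ?subr_ge0//; lra.
have der x : u <= x <= u + e -> is_derive x 1 (fun x => f u / 2 * x) (f u / 2).
  move=> _; apply: (is_derive_eq (is_deriveZ (f u / 2) (is_derive_id x 1))).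
  by rewrite /GRing.scale/= mulr1.
move=> /(_ dom der) h.
have := le_trans h If; rewrite lee_fin.
have -> : f u / 2 * (u + e) - f u / 2 * u = f u / 2 * e by ring.
by rewrite leNgt mulr_gt0// divr_gt0.
Qed.

End int01.

Section trial.
Variables (R : realType) (g : R -> R).
Hypothesis gD : trial_fun g.

Let h u := - derive1 g u.

Lemma trial_is_derive (u : R) : 0 < u < 1 -> is_derive u 1 g (derive1 g u).
Proof.
move=> u01; have [gd _ _ _] := gD.
by have [d _] := gd u u01; constructor; [exact: d|rewrite derive1E].
Qed.

Lemma trial_cont : cont01 g.
Proof. by move=> u /trial_is_derive; exact: is_derive_continuous. Qed.

Lemma trial_slope_cont : cont01 h.
Proof.
by move=> u u01; have [gd _ _ _] := gD; have [_ d] := gd u u01; exact: cvgN.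
Qed.

Lemma trial_slope_gt0 (u : R) : 0 < u < 1 -> 0 < h u.
Proof. by have [_ _ h0 _] := gD; exact: h0. Qed.

Lemma trial_decr (u v : R) : 0 < u -> u < v -> v < 1 -> g v < g u.
Proof.
move=> u0 uv v1; have dom x : u <= x <= v -> 0 < x < 1.
  by move=> /andP[ux xv]; rewrite (lt_le_trans u0 ux) (le_lt_trans xv v1).
apply: (@lt0_is_derive_gt _ _ (derive1 g)) => [//|x /dom|x /andP[ux xv]].
  exact: trial_is_derive.
rewrite -oppr_gt0; apply: trial_slope_gt0.
by apply: dom; rewrite !ltW.
Qed.

Lemma trial_gt0 (u : R) : 0 < u < 1 -> 0 < g u.
Proof.
move=> /andP[u0 u1]; have [_ g0 _ _] := gD.
apply: (@le_lt_trans _ _ (g ((u + 1) / 2))); last by apply: trial_decr; lra.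
by apply: g0; rewrite in_itv/=; apply/andP; split; lra.
Qed.

Lemma trial_ge0 : ge01 g.
Proof. by move=> u /trial_gt0/ltW. Qed.

Lemma trial_int : exists2 s : R, 0 < s & int01 g = s%:E.
Proof.
have [_ _ _ gfin] := gD.
have fn : int01 g \is a fin_num.
  by rewrite ge0_fin_numE//; apply: int01_ge0; exact: trial_ge0.
exists (fine (int01 g)); last by rewrite fineK.
rewrite fine_gt0//; apply/andP; split; last exact: gfin.
rewrite ltNge; apply/negP => /(int01_eq0 trial_cont trial_ge0).
have h2 : 0 < (2^-1 : R) < 1 by apply/andP; split; lra.
by move=> /(_ _ h2) e; have := trial_gt0 h2; rewrite e ltxx.
Qed.

(* [g] is decreasing and integrable, so [(u/2) g(u)] is bounded by the mass of
   [g] between [u/2] and [u]. *)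
Lemma trial_small_at0 : u * g u @[u --> (0:R)^'+] --> 0.
Proof.
have [s s0 sE] := trial_int.
have [P _ PP] := @continuous_primitive R g 0 1 2^-1
  (ltac:(apply/andP; split; lra)) trial_cont.
have Ps a b : 0 < a -> a < b -> b < 1 -> P b - P a <= s.
  move=> a0 ab b1; rewrite -lee_fin -sE.
  have dom x : a <= x <= b -> 0 < x < 1.
    by move=> /andP[ux xv]; rewrite (lt_le_trans a0 ux) (le_lt_trans xv b1).
  apply: (@integral_oo_ge R g g P a b trial_cont trial_ge0) => //.
  - by move=> x /dom; exact: trial_cont.
  - by move=> x /dom/trial_ge0 ->; rewrite lexx.
  - by move=> x /dom; exact: PP.
have Pincr a b : 0 < a -> a <= b -> b < 1 -> P a <= P b.
  move=> a0 ab b1; apply: (@ge0_is_derive_le _ P g a b ab) => x /andP[ax xb].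
    by apply: PP; rewrite (lt_le_trans a0 ax) (le_lt_trans xb).
  by apply: trial_ge0; rewrite (lt_trans a0 ax) (lt_trans xb).
(* [P] is nondecreasing with increments at most the mass [s], so near 0 it is bounded below and
   close to its infimum; the mass of [g] on [[u / 2, u]] is then small. *)
pose E := [set P x | x in [set x : R | 0 < x < 2^-1]].
have infE : has_inf E.
  split; first by exists (P 4^-1); exists 4^-1 => //=; apply/andP; split; lra.
  exists (P 2^-1 - s) => _ [x /andP[x0 x2] <-].
  have := Ps x 2^-1 x0 x2 (ltac:(lra)); lra.
apply/cvgr0Pnorm_lt => e e0.
have e2 : 0 < e / 2 by rewrite divr_gt0.
have [_ [x0 /andP[x00 x02] <-] Px0] := inf_adherent e2 infE.
near=> u.
have u0 : 0 < u by near: u; exact: nbhs_right_gt.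
have ux0 : u < x0 by near: u; exact: nbhs_right_lt.
have u1 : 0 < u < 1 by rewrite u0; lra.
rewrite ger0_norm; last by rewrite mulr_ge0 ?(ltW u0)//; exact: trial_ge0.
have low : inf E <= P (u / 2).
  apply: ge_inf; first by case: infE.
  by exists (u / 2) => //=; apply/andP; split; lra.
have up : P u <= P x0 by apply: Pincr; lra.
have h2 : u / 2 < u by lra.
have [|z /andP[z1 z2] zE] := @MVT_is_derive R P g (u / 2) u h2.
  by move=> x /andP[h3 h4]; apply: PP; apply/andP; split; lra.
have gz : g u < g z by apply: trial_decr; lra.
have : u / 2 * g u < e / 2.
  apply: (@lt_trans _ _ (P u - P (u / 2))); last by lra.
  have -> : P u - P (u / 2) = u / 2 * g z by rewrite zE; field.
  by rewrite ltr_pM2l// divr_gt0.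
by lra.
Unshelve. all: by end_near. Qed.

End trial.

(** * The functional and the phase-plane density *)

Section functional.
Variables (R : realType) (m p : R) (f : R -> R).
Hypotheses (hm : 0 < m) (hp : 1 < p).
Hypotheses (Fc : cont01 (reactF m p f))
  (F0 : forall u : R, 0 < u < 1 -> 0 < reactF m p f u).

Let F := reactF m p f.
Let k := 1 / (p - 1).
Let pm0 : 0 < p - 1. Proof. by rewrite subr_gt0. Qed.
Let p0 : 0 < p. Proof. exact: lt_trans hp. Qed.
Let k0 : 0 < k. Proof. by rewrite divr_gt0. Qed.
Let mp0 : 0 < m `^ (p - 1). Proof. exact: powR_gt0. Qed.

(** The sharp constant of [young_powR]; the prefactor of [J] is this constant times [m^(p - 1)]. *)
Definition young_cst := p / (p - 1) `^ ((p - 1) / p).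

Definition J_density (g : R -> R) (u : R) : R := young_cst *
  ((- derive1 g u) `^ (1 / p) * reactF m p f u `^ ((p - 1) / p) *
   g u `^ ((p - 1) / p)).

Definition phase_density (g Y : R -> R) (u : R) : R :=
  - derive1 g u * Y u + g u * reactF m p f u * Y u `^ (- (1 / (p - 1))).

Lemma young_cst_gt0 : 0 < young_cst.
Proof. by rewrite divr_gt0// powR_gt0. Qed.

Lemma powR_cont01 (y : R -> R) (a : R) : cont01 y ->
  (forall u : R, 0 < u < 1 -> 0 < y u) -> cont01 (fun u => y u `^ a).
Proof.
move=> yc y0 u u01; apply: (@continuous_comp _ _ _ y (fun t => t `^ a)).
  exact: yc.
exact: (is_derive_continuous (is_derive1_powR a (y0 u u01))).
Qed.

Lemma J_density_cont (g : R -> R) : trial_fun g -> cont01 (J_density g).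
Proof.
move=> gD u u01; apply: cvgMr; apply: cvgM; first apply: cvgM.
- exact: (@powR_cont01 (fun u => - derive1 g u) (1 / p) (trial_slope_cont gD)
    (fun v => @trial_slope_gt0 R g gD v) u u01).
- exact: (@powR_cont01 (reactF m p f) ((p - 1) / p) Fc F0 u u01).
- exact: (@powR_cont01 g ((p - 1) / p) (trial_cont gD)
    (fun v => @trial_gt0 R g gD v) u u01).
Qed.

Lemma J_density_ge0 (g : R -> R) : ge01 (J_density g).
Proof.
move=> u _; apply: mulr_ge0; first exact: ltW young_cst_gt0.
by rewrite !mulr_ge0 ?powR_ge0.
Qed.

Section with_trial.
Variables (g : R -> R).
Hypothesis gD : trial_fun g.

Lemma J_int01 (s : R) : 0 < s -> int01 g = s%:E ->
  J m p f g = ((s / m `^ (p - 1))^-1%:E * int01 (J_density g))%E.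
Proof.
move=> s0 gs; have kp := young_cst_gt0.
pose I u := (- derive1 g u) `^ (1 / p) * F u `^ ((p - 1) / p) * g u `^ ((p - 1) / p).
have Ic : cont01 I.
  move=> u u01; have h := J_density_cont gD u01.
  have -> : I = fun u => young_cst^-1 * J_density g u.
    by apply/funext => v; rewrite /J_density mulKf// (gt_eqF kp).
  exact: cvgMr.
have -> : int01 (J_density g) = (young_cst%:E * int01 I)%E.
  apply: int01_scale => //; first exact: ltW.
  by move=> u _; rewrite !mulr_ge0 ?powR_ge0.
rewrite /J -/(int01 I) -/(int01 g) gs inver gt_eqF//.
rewrite [(int01 I * _)%E]muleC !muleA -!EFinM; congr (_%:E * _)%E.
rewrite /young_cst; field.
by rewrite !gt_eqF// powR_gt0.
Qed.

Lemma J_le (c : R) : (J m p f g <= c%:E)%E =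
  (int01 (J_density g) <= (c / m `^ (p - 1))%:E * int01 g)%E.
Proof.
have [s s0 gs] := trial_int gD.
rewrite (J_int01 s0 gs) lee_pdivrMl ?divr_gt0// gs -!EFinM.
by congr (_ <= _%:E)%E; ring.
Qed.

Lemma J_ge (c : R) : (c%:E <= J m p f g)%E =
  ((c / m `^ (p - 1))%:E * int01 g <= int01 (J_density g))%E.
Proof.
have [s s0 gs] := trial_int gD.
rewrite (J_int01 s0 gs) lee_pdivlMl ?divr_gt0// gs -!EFinM.
by congr (_%:E <= _)%E; ring.
Qed.

(** Young's inequality for [h Y] and [u q Y^(- k)]: the powers of [Y] cancel in the product because
    [k (p - 1) / p = 1 / p], so [Y] is a free parameter of the upper bound. *)
Lemma J_density_le (h q u Y : R) : 0 < h -> 0 < q -> 0 < u -> 0 < Y ->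
  young_cst * (h `^ (1 / p) * q `^ ((p - 1) / p) * u `^ ((p - 1) / p)) <=
  h * Y + u * q * Y `^ (- k) ?= iff (u * q * Y `^ (- k) == (p - 1) * (h * Y)).
Proof.
move=> h0 q0 u0 Y0.
have b0 : 0 < u * q * Y `^ (- k) by rewrite !mulr_gt0// powR_gt0.
suff -> : h `^ (1 / p) * q `^ ((p - 1) / p) * u `^ ((p - 1) / p) =
    (h * Y) `^ (1 / p) * (u * q * Y `^ (- k)) `^ ((p - 1) / p).
  exact: young_powR (mulr_gt0 h0 Y0) b0.
rewrite (powRM _ (ltW h0) (ltW Y0)) (powRM _ (mulr_ge0 (ltW u0) (ltW q0))) ?powR_ge0//.
rewrite (powRM _ (ltW u0) (ltW q0)) -powRrM.
have -> : - k * ((p - 1) / p) = - (1 / p) by rewrite /k; field; rewrite !gt_eqF.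
rewrite powRN; field.
by rewrite gt_eqF// powR_gt0.
Qed.

Section with_phase.
Variables (C : R) (Y : R -> R).
Hypothesis YP : phase_solution (reactF m p f) C (1 / (p - 1)) Y.

Let Yc : cont01 Y.
Proof. by move=> u /YP[_]; exact: is_derive_continuous. Qed.

Lemma phase_density_cont : cont01 (phase_density g Y).
Proof.
move=> u u01; apply: cvgD; apply: cvgM.
- exact: trial_slope_cont.
- exact: Yc.
- by apply: cvgM; [exact: trial_cont|exact: Fc].
- by apply: powR_cont01 => // v /YP[].
Qed.

Lemma phase_density_ge0 : ge01 (phase_density g Y).
Proof.
move=> u u01; have [Y0 _] := YP u01; have h0 := trial_slope_gt0 gD u01.
apply: addr_ge0; first by rewrite mulr_ge0// ltW.
apply: mulr_ge0; last exact: powR_ge0.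
by apply: mulr_ge0; apply: ltW; [exact: trial_gt0|exact: F0].
Qed.

Lemma J_density_phase u : 0 < u < 1 ->
  J_density g u <= phase_density g Y u
  ?= iff (g u * F u * Y u `^ (- k) == (p - 1) * (- derive1 g u * Y u)).
Proof.
move=> u01; have [Y0 _] := YP u01.
by apply: J_density_le => //; [exact: trial_slope_gt0|exact: F0|exact: trial_gt0].
Qed.

Lemma is_derive_trial_phase (u : R) : 0 < u < 1 ->
  is_derive u 1 (fun u => g u * Y u) (C * g u - phase_density g Y u).
Proof.
move=> u01; have [Y0 dY] := YP u01.
apply: (is_derive_eq (is_deriveM (trial_is_derive gD u01) dY)).
by rewrite /GRing.scale/= /phase_density; ring.
Qed.

(** [Y' <= C] and [Y] starts from 0. This reduces the boundary term [g Y] at 0 to [u g(u)], which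
    tends to 0 for trial functions. *)
Lemma phase_le_linear : 0 <= C -> Y u @[u --> (0:R)^'+] --> 0 ->
  forall u, 0 < u < 1 -> Y u <= C * u.
Proof.
move=> C0 Yl u /andP[u0 u1].
have cv : Y s - C * s @[s --> (0:R)^'+] --> (0:R).
  have e : 0 - C * 0 = 0 :> R by rewrite mulr0 subr0.
  rewrite -[X in _ --> X]e; apply: cvgB => //; apply: cvgMr.
  by apply: cvg_at_right_filter; exact: cvg_id.
rewrite -subr_le0; apply: (cvgr_to_ge cv); near=> s.
have s0 : 0 < s by near: s; exact: nbhs_right_gt.
have su : s <= u by near: s; exact: nbhs_right_le.
have dom x : s <= x <= u -> 0 < x < 1.
  by move=> /andP[sx xu]; rewrite (lt_le_trans s0 sx) (le_lt_trans xu u1).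
apply: (@le0_is_derive_ge _ (fun x => Y x - C * x)
  (fun x => C - F x * Y x `^ (- k) - C * 1) s u su).
  move=> x /dom/YP[_ dx]; apply: is_deriveB.
move=> x /andP[sx xu]; have x01 : 0 < x < 1 by apply: dom; rewrite !ltW.
rewrite mulr1 addrAC subrr add0r oppr_le0 mulr_ge0 ?powR_ge0//.
by rewrite ltW// F0.
Unshelve. all: by end_near. Qed.

(** The difference of the integrands is the derivative of [- g Y]. The boundary term at 1 has a
    favourable sign, and the one at 0 is at most [C x g(x)]. *)
Lemma phase_int_le : 0 <= C -> Y u @[u --> (0:R)^'+] --> 0 ->
  (int01 (phase_density g Y) <= C%:E * int01 g)%E.
Proof.
move=> C0 Yl; rewrite -int01_scale//; [|exact: trial_cont|exact: trial_ge0].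
apply: (@integral_oo_le R _ _ (fun u => - (g u * Y u))).
- exact: phase_density_cont.
- exact: phase_density_ge0.
- by move=> u u01; apply: cvgMr; exact: (trial_cont gD).
- by move=> u u01; rewrite mulr_ge0// trial_ge0.
- move=> u /is_derive_trial_phase h.
  by apply: (is_derive_eq (is_deriveN h)); rewrite opprB.
move=> e e0.
have cv : C * (u * g u) @[u --> (0:R)^'+] --> 0.
  by rewrite -[X in _ --> X](mulr0 C); apply: cvgMr; exact: trial_small_at0.
have h : \forall u \near (0:R)^'+, C * (u * g u) < e.
  by apply: (cv [set t | t < e]); exact: lt_nbhsl.
near=> x.
have x01 : 0 < x < 1.
  by apply/andP; split; near: x; [exact: nbhs_right_gt|exact: nbhs_right_lt].
have x01' : 0 < 1 - x < 1 by have /andP[h1 h2] := x01; apply/andP; split; lra.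
have [Y1 _] := YP x01'; have g1 := trial_gt0 gD x01'.
rewrite opprK (le_trans (y := g x * Y x))// ?gerDr ?oppr_le0 ?mulr_ge0 ?(ltW g1) ?(ltW Y1)//.
apply: (@le_trans _ _ (C * (x * g x))); last by apply: ltW; near: x.
rewrite mulrA mulrC ler_pM2r ?trial_gt0//.
exact: phase_le_linear.
Unshelve. all: by end_near. Qed.

(** Mirror image of the upper bound: the boundary term at 0 now has the favourable sign, and the one
    at 1 is at most [M Y(1 - x)]. *)
Lemma phase_int_ge (M : R) : (forall u, 0 < u < 1 -> g u <= M) ->
  0 <= C -> Y u @[u --> (1:R)^'-] --> 0 ->
  (C%:E * int01 g <= int01 (phase_density g Y))%E.
Proof.
move=> gM C0 Yr; rewrite -int01_scale//; [|exact: trial_cont|exact: trial_ge0].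
apply: (@integral_oo_le R _ _ (fun u => g u * Y u)).
- by move=> u u01; apply: cvgMr; exact: (trial_cont gD).
- by move=> u u01; rewrite mulr_ge0// trial_ge0.
- exact: phase_density_cont.
- exact: phase_density_ge0.
- exact: is_derive_trial_phase.
move=> e e0.
have h2 : 0 < (2^-1 : R) < 1 by apply/andP; split; lra.
have M0 : 0 < M by rewrite (lt_le_trans (trial_gt0 gD h2))// gM.
have [d /= d0 Hd] : \forall u \near (1:R)^'-, Y u < e / M.
  by apply: (Yr [set t | t < e / M]); apply: lt_nbhsl; rewrite divr_gt0.
near=> x.
have x01 : 0 < x < 1.
  by apply/andP; split; near: x; [exact: nbhs_right_gt|exact: nbhs_right_lt].
have x01' : 0 < 1 - x < 1 by have /andP[h1 h3] := x01; apply/andP; split; lra.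
have [Y0 _] := YP x01; have g0 := trial_gt0 gD x01.
have [Y1 _] := YP x01'.
rewrite (le_trans (y := g (1 - x) * Y (1 - x)))// ?gerDl ?oppr_le0 ?mulr_ge0 ?(ltW g0) ?(ltW Y0)//.
have : Y (1 - x) < e / M.
  apply: Hd => /=; last by case/andP: x01'.
  rewrite opprB addrC subrK gtr0_norm; last by case/andP: x01.
  by near: x; exact: nbhs_right_lt.
rewrite ltr_pdivlMr// mulrC => /ltW; apply: le_trans.
by rewrite ler_pM2r// gM.
Unshelve. all: by end_near. Qed.

End with_phase.
End with_trial.

Lemma J_le_phase (c : R) (Y g : R -> R) : 0 <= c ->
  phase_solution (reactF m p f) (c / m `^ (p - 1)) (1 / (p - 1)) Y ->
  Y u @[u --> (0:R)^'+] --> 0 -> trial_fun g -> (J m p f g <= c%:E)%E.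
Proof.
move=> c0 YP Yl gD; rewrite J_le//.
apply: le_trans (phase_int_le gD YP _ Yl); last by rewrite divr_ge0// ltW.
apply: int01_le.
- exact: J_density_cont.
- exact: J_density_ge0.
- exact: (phase_density_cont gD YP).
- by move=> u u01; have [] := J_density_phase gD YP u01.
Qed.

(** The value [c] forces the integrals of both densities to coincide, so their nonnegative
    continuous difference vanishes pointwise: Young's inequality is an equality on all of []0,
    1[]. *)
Lemma J_eq_phase (c : R) (Y g : R -> R) : 0 <= c ->
  phase_solution (reactF m p f) (c / m `^ (p - 1)) (1 / (p - 1)) Y ->
  Y u @[u --> (0:R)^'+] --> 0 -> trial_fun g -> J m p f g = c%:E ->
  forall u, 0 < u < 1 ->
    g u * F u * Y u `^ (- k) = (p - 1) * (- derive1 g u * Y u).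
Proof.
move=> c0 YP Yl gD Jc u u01.
have C0 : 0 <= c / m `^ (p - 1) by rewrite divr_ge0// ltW.
have h1 : (int01 (phase_density g Y) <= int01 (J_density g))%E.
  by apply: le_trans (phase_int_le gD YP C0 Yl) _; rewrite -J_ge// Jc.
pose D u := phase_density g Y u - J_density g u.
have Dc : cont01 D.
  by move=> v v01; apply: cvgB; [exact: (phase_density_cont gD YP)|exact: J_density_cont].
have D0 : ge01 D.
  by move=> v v01; rewrite subr_ge0; have [] := J_density_phase gD YP v01.
have AE : int01 (phase_density g Y) = (int01 (J_density g) + int01 D)%E.
  rewrite -int01_add//; [|exact: J_density_cont|exact: J_density_ge0].
  by apply: int01_ext => v _; rewrite /D addrC subrK.
(* Finiteness permits cancelling this integral in the extended reals. *)
have Jfin : int01 (J_density g) \is a fin_num.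
  rewrite ge0_fin_numE; last by apply: int01_ge0; exact: J_density_ge0.
  have := J_le gD c; rewrite Jc lexx => /esym h.
  have [s s0 gs] := trial_int gD; rewrite gs -EFinM in h.
  by rewrite (le_lt_trans h)// ltry.
have ID : (int01 D <= 0)%E.
  by move: h1; rewrite AE -[X in (_ <= X)%E]adde0 leeD2lE.
have Du := int01_eq0 Dc D0 ID u01.
have [_ e] := J_density_phase gD YP u01.
by apply/eqP; rewrite -e; move/eqP: Du; rewrite subr_eq0 eq_sym.
Qed.

Lemma J_ge_phase (c M : R) (Y g : R -> R) : 0 <= c ->
  phase_solution (reactF m p f) (c / m `^ (p - 1)) (1 / (p - 1)) Y ->
  Y u @[u --> (1:R)^'-] --> 0 -> trial_fun g ->
  (forall u, 0 < u < 1 -> g u <= M) ->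
  (forall u, 0 < u < 1 ->
    g u * F u * Y u `^ (- k) = (p - 1) * (- derive1 g u * Y u)) ->
  (c%:E <= J m p f g)%E.
Proof.
move=> c0 YP Yr gD gM geq; rewrite J_ge//.
have C0 : 0 <= c / m `^ (p - 1) by rewrite divr_ge0// ltW.
suff -> : int01 (J_density g) = int01 (phase_density g Y).
  exact: (phase_int_ge gD YP gM C0 Yr).
apply: int01_ext => u u01; have [_ e] := J_density_phase gD YP u01.
by apply/eqP; rewrite e geq.
Qed.

End functional.

(** * The minimal speed *)

Lemma derive1_01 (R : realType) (g dg : R -> R) :
  (forall u : R, 0 < u < 1 -> is_derive u 1 g (dg u)) ->
  forall u : R, 0 < u < 1 -> derive1 g u = dg u.
Proof. by move=> gP u /gP [_ e]; rewrite derive1E. Qed.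

Lemma trial_fun_intro (R : realType) (g dg : R -> R) :
  (forall u : R, 0 < u < 1 -> is_derive u 1 g (dg u)) -> cont01 dg ->
  ge01 g -> (forall u : R, 0 < u < 1 -> dg u < 0) -> (int01 g < +oo)%E ->
  trial_fun g.
Proof.
move=> gP dgc g0 dg0 gfin; split.
- move=> u; rewrite in_itv/= => u01; split; first by have [] := gP u u01.
  have /andP[u0 u1] := u01.
  rewrite /prop_for /continuous_at (derive1_01 gP u01).
  apply: cvg_trans (dgc u u01); apply: near_eq_cvg; near=> v.
  apply/esym/(derive1_01 gP).
  by apply/andP; split; near: v; [exact: lt_nbhsr|exact: lt_nbhsl].
- by move=> u; rewrite in_itv/=; exact: g0.
- by move=> u; rewrite in_itv/= => u01; rewrite (derive1_01 gP u01) oppr_gt0 dg0.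
- exact: gfin.
Unshelve. all: by end_near. Qed.

(* [Y] stays above the line [a u] as long as the line is a strict subsolution,
   since [Y] starts above it. *)
Lemma phase_ge_line (R : realType) (F : R -> R) (C k a d l : R) (Y : R -> R) :
  phase_solution F C k Y -> 0 < l -> Y u @[u --> (0:R)^'+] --> l ->
  0 < a -> d < 1 ->
  (forall u : R, 0 < u <= d -> a < C - F u * (a * u) `^ (- k)) ->
  forall u : R, 0 < u <= d -> a * u <= Y u.
Proof.
move=> YP l0 Yl a0 d1 sub u /andP[u0 ud]; rewrite leNgt; apply/negP => Yu.
have : \forall s \near (0:R)^'+, l / 2 < Y s.
  by apply: (Yl [set t | l / 2 < t]); apply: lt_nbhsr; lra.
move=> [e /= e0 He].
(* Small enough for the line to start below [Y]: [a s <= l / 2 < Y s]. *)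
pose s := Num.min (Num.min (u / 2) (e / 2)) (l / (2 * a)).
have s0 : 0 < s by rewrite /s !lt_min !divr_gt0// mulr_gt0.
have su : s < u.
  by rewrite (@le_lt_trans _ _ (u / 2))//; [rewrite /s !ge_min lexx|lra].
have se : s < e.
  by rewrite (@le_lt_trans _ _ (e / 2))//; [rewrite /s !ge_min lexx orbT|lra].
have sl : a * s <= l / 2.
  have -> : l / 2 = a * (l / (2 * a)) by field; rewrite gt_eqF.
  by rewrite ler_pM2l// /s ge_min lexx orbT.
have Ys : l / 2 < Y s by apply: He => //=; rewrite sub0r normrN gtr0_norm.
have der x : s <= x <= u ->
    is_derive x 1 (fun x => a * x - Y x) (a * 1 - (C - F x * Y x `^ (- k))).
  move=> /andP[sx xu]; have x01 : 0 < x < 1 by rewrite (lt_le_trans s0 sx); lra.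
  by have [_ h] := YP x x01; exact: is_deriveB.
have ds : a * s - Y s < 0 by lra.
have du : 0 <= a * u - Y u by lra.
(* At this meeting point the slope of the line is at least that of [Y], against the strict
   inequality satisfied by the subsolution. *)
have [x /andP[sx xu] [dx0 ddx]] :=
  @ge0_derive_at_crossing R (fun x => a * x - Y x) _ s u su der ds du.
have x0 : 0 < x by exact: lt_trans sx.
have := sub x (ltac:(by rewrite x0 (le_trans xu))).
have -> : a * x = Y x by apply/eqP; rewrite -subr_eq0 dx0.
by move: ddx; rewrite mulr1; move: (_ * _ `^ _) => t h1 h2; lra.
Qed.

Section wave_speed.
Variables (R : realType) (m p : R) (f df : R -> R) (cstar : R).
Hypotheses (hm : 0 < m) (hp : 1 < p) (hC1 : C1_unit_itv f df)
  (hf0 : f 0 = 0) (hf1 : f 1 = 0)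
  (hfpos : forall u : R, 0 < u < 1 -> 0 < f u)
  (hconc : concave_unit_itv f) (hcstar : minimal_speed m p f cstar).

Let F := reactF m p f.
Let k := 1 / (p - 1).
Let pm0 : 0 < p - 1. Proof. by rewrite subr_gt0. Qed.
Let k0 : 0 < k. Proof. by rewrite divr_gt0. Qed.
Let mp0 : 0 < m `^ (p - 1). Proof. exact: powR_gt0. Qed.
Let c0 : 0 < cstar. Proof. by have [] := hcstar. Qed.
Let D := df 0 / m `^ (p - 1).
Let D0 : 0 < D.
Proof. by rewrite divr_gt0// (concave_derive0_gt0 hC1 hconc hf0 hfpos). Qed.
Let Fc : cont01 F.
Proof. by move=> u u01; exact: (@reactF_continuous R m p f df hC1 u u01). Qed.
Let F0 (u : R) : 0 < u < 1 -> 0 < F u.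
Proof. by move=> u01; exact: reactF_gt0. Qed.
Let F_ge0 (u : R) : 0 < u < 1 -> 0 <= F u.
Proof. by move=> /F0/ltW. Qed.
Let F_le (u : R) : 0 < u < 1 -> F u <= D * u `^ m.
Proof.
by move=> /andP[u0 u1]; apply: (reactF_le p hm hC1 hf0 hconc); rewrite u0 ltW.
Qed.

Lemma no_wave_phase_limit (c : R) (Y : R -> R) : 0 < c -> c < cstar ->
  phase_solution F (c / m `^ (p - 1)) k Y ->
  Y u @[u --> (0:R)^'+] --> 0 -> Y u @[u --> (1:R)^'-] --> 0 -> False.
Proof.
move=> cp cc YP Yl Yr; have [_ _ nowave] := hcstar.
by apply: (nowave c cp cc); exact: (phase_travelling_wave hm hp hC1 hf0 hf1 YP Yl Yr).
Qed.

(** The wave of speed [cstar] supplies a solution [Z] vanishing at 0. The solution built backward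
    from 1 is the smallest, so it lies below [Z] and vanishes at 0 as well. *)
Lemma minimal_phase : exists Y : R -> R,
  [/\ phase_solution F (cstar / m `^ (p - 1)) k Y,
      Y u @[u --> (0:R)^'+] --> 0 & Y u @[u --> (1:R)^'-] --> 0].
Proof.
have [_ wave _] := hcstar; have [u uW] := wave _ (lexx cstar).
have [Z ZP Zl] := travelling_wave_phase hm hp c0 hfpos uW.
have [Y [YP Yr [l l0 Yl]]] := reactF_phase_solution hm hp hC1 hf0 hf1 hfpos hconc c0.
exists Y; split => //.
apply: (@squeeze_cvgr _ _ _ _ (cst 0) Z) => //; last exact: cvg_cst.
near=> s; have s01 : 0 < s < 1.
  by apply/andP; split; near: s; [exact: nbhs_right_gt|exact: nbhs_right_lt].
have [Ys _] := YP s s01; rewrite /= ltW//=.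
exact: (phase_antitone k0 F_ge0 (lexx _) ZP YP Yr).
Unshelve. all: by end_near. Qed.

Lemma J_le_cstar (g : R -> R) : trial_fun g -> (J m p f g <= cstar%:E)%E.
Proof.
have [Y [YP Yl _]] := minimal_phase.
by move=> gD; exact: (J_le_phase hm hp Fc F0 (ltW c0) YP Yl gD).
Qed.

Section slow_diffusion.
Hypothesis hgamma : 0 < gamma m p.

Let mk : 0 < m - k.
Proof.
have -> : m - k = gamma m p / (p - 1) by rewrite /gamma /k; field; rewrite gt_eqF.
by rewrite divr_gt0.
Qed.

(* Below the minimal speed the phase solution vanishing at 1 starts from a
   positive height, hence stays above the line; let the speed increase to
   [cstar]. The line is a subsolution near 0 because [F (a u)^(- k)] is
   [O(u^(m - k))]. *)
Lemma minimal_phase_ge_line (Y : R -> R) :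
  phase_solution F (cstar / m `^ (p - 1)) k Y -> Y u @[u --> (1:R)^'-] --> 0 ->
  exists2 a : R, 0 < a & exists2 d : R, 0 < d < 1 &
    forall u, 0 < u <= d -> a * u <= Y u.
Proof.
move=> YP Yr.
have [C CE] : exists C, C = cstar / m `^ (p - 1) by eexists.
rewrite -CE in YP.
have C0 : 0 < C by rewrite CE divr_gt0.
(* A quarter of [C] leaves room: the constant loses [e' <= a], the reaction term takes less than
   [a], and more than [a] remains for the slope. *)
have [a aE] : exists a, a = C / 4 by eexists.
have a0 : 0 < a by rewrite aE divr_gt0.
have Da : 0 < D * a `^ (- k) by rewrite mulr_gt0// powR_gt0.
have B0 : 0 < a / (D * a `^ (- k)) by rewrite divr_gt0.
(* Below the root of [D a^(- k) d^(m - k) = a] the left-hand side is less than [a], because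
   [m > k]. *)
have [d [d0 d1 dB]] : exists d, [/\ 0 < d, d < 1 &
    d < (a / (D * a `^ (- k))) `^ (m - k)^-1].
  have b0 : 0 < (a / (D * a `^ (- k))) `^ (m - k)^-1 by exact: powR_gt0.
  move: b0; move: (_ `^ (m - k)^-1) => b b0.
  exists (Num.min 2^-1 (b / 2)); rewrite lt_min !gt_min divr_gt0// andbT; split.
  - lra.
  - by apply/orP; left; lra.
  - by apply/orP; right; lra.
exists a => //; exists d; first by rewrite d0.
have small u : 0 < u <= d -> F u * (a * u) `^ (- k) < a.
  move=> /andP[u0 ud].
  apply: (@le_lt_trans _ _ (D * a `^ (- k) * u `^ (m - k))).
    rewrite (powRM _ (ltW a0) (ltW u0)).
    have -> : D * a `^ (- k) * u `^ (m - k) = (D * u `^ m) * (a `^ (- k) * u `^ (- k)).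
      by rewrite powRD ?(gt_eqF u0) ?implybT//; ring.
    by rewrite ler_wpM2r ?mulr_ge0 ?powR_ge0// F_le// u0 (le_lt_trans ud).
  rewrite mulrC -ltr_pdivlMr//.
  have -> : a / (D * a `^ (- k)) = ((a / (D * a `^ (- k))) `^ (m - k)^-1) `^ (m - k).
    by rewrite -powRrM mulVf ?gt_eqF// powRr1// ltW.
  by apply: gt0_ltr_powR; rewrite ?nnegrE ?powR_ge0 ?(ltW u0)// (le_lt_trans ud).
move=> u /andP[u0 ud]; have u01 : 0 < u < 1 by rewrite u0 (le_lt_trans ud).
apply/ler_addgt0Pr => e e0.
have [e' [e'0 e'a e'e]] : exists e', [/\ 0 < e', e' <= a & e' <= e].
  by exists (Num.min e a); rewrite lt_min e0 a0 !ge_min !lexx orbT.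
have eC : 2 * a < C - e'.
  apply: (@lt_le_trans _ _ (C - a)); last by rewrite lerD2l lerN2.
  have -> : C - a = 3 * a by rewrite aE; field.
  by rewrite ltr_pM2r// ltr_nat.
have [c cE] : exists c, c = (C - e') * m `^ (p - 1) by eexists.
have cE' : c / m `^ (p - 1) = C - e' by rewrite cE mulfK// gt_eqF.
have Ce0 : 0 < C - e' by apply: lt_trans eC; rewrite mulr_gt0.
have cp : 0 < c by rewrite cE mulr_gt0.
have cc : c < cstar.
  have -> : cstar = C * m `^ (p - 1) by rewrite CE divfK// gt_eqF.
  by rewrite cE ltr_pM2r// ltrBlDr ltrDl.
have [Yc [YcP Ycr [l l0 Ycl]]] := reactF_phase_solution hm hp hC1 hf0 hf1 hfpos hconc cp.
have lp : 0 < l.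
  rewrite lt_def l0 andbT; apply/eqP => lE; rewrite lE in Ycl.
  exact: (no_wave_phase_limit cp cc YcP Ycl Ycr).
rewrite cE' in YcP.
have h1 : a * u <= Yc u.
  apply: (phase_ge_line YcP lp Ycl a0 d1) => [v vd|]; last by rewrite u0.
  have h := small v vd; rewrite ltrBrDr (lt_trans _ eC)// mulr_natl mulr2n.
  by rewrite ltrD2l.
have CC : C - e' <= C by rewrite lerBlDr lerDl ltW.
(* The solution with constant [C - e'] exceeds [Y] by at most [e'], itself at most the arbitrary
   [e]. *)
have h2 := phase_lipschitz k0 F_ge0 CC YcP YP Ycr u01.
by rewrite (le_trans h1)// (le_trans h2)// lerD2l opprB addrC subrK.
Qed.

(* [g' / g = psi] is the case of equality in Young's inequality. As [Y] dominates
   a line, [psi] is integrable at 0 and [g] is bounded. *)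
Lemma maximizer_exists : exists2 g : R -> R, trial_fun g &
  (cstar%:E <= J m p f g)%E /\
  forall g1, trial_fun g1 -> J m p f g1 = cstar%:E ->
    exists b : R, forall u, 0 < u < 1 -> g1 u = b * g u.
Proof.
have [Y [YP Yl Yr]] := minimal_phase.
have Y0 (u : R) : 0 < u < 1 -> 0 < Y u by move=> /YP[].
have Yc : cont01 Y by move=> u /YP[_]; exact: is_derive_continuous.
have [a a0 [d /andP[d0 d1] Ya]] := minimal_phase_ge_line YP Yr.
pose psi u := - ((p - 1)^-1 * (F u * Y u `^ (- (1 + k)))).
have psic : cont01 psi.
  move=> u u01; apply: cvgN; apply: cvgMr; apply: cvgM; first exact: Fc.
  exact: (powR_cont01 Yc Y0 u01).
have h12 : 0 < (2^-1 : R) < 1 by apply/andP; split; lra.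
have [Phi _ PhiP] := continuous_primitive h12 psic.
pose g u := expR (Phi u).
have gP (u : R) : 0 < u < 1 -> is_derive u 1 g (g u * psi u).
  by move=> /PhiP h; exact: (is_derive1_comp (is_derive_expR _) h).
have gc : cont01 g by move=> u /gP; exact: is_derive_continuous.
have psi0 u : 0 < u < 1 -> psi u < 0.
  move=> u01; rewrite oppr_lt0; apply: mulr_gt0; first by rewrite invr_gt0.
  by apply: mulr_gt0; [exact: F0|apply: powR_gt0; exact: Y0].
have gdecr (u v : R) : 0 < u -> u <= v -> v < 1 -> g v <= g u.
  move=> u0 uv v1.
  apply: (@le0_is_derive_ge _ g (fun x => g x * psi x) u v uv) => x /andP[ux xv].
    by apply: gP; rewrite (lt_le_trans u0 ux) (le_lt_trans xv).
  rewrite nmulr_lle0 ?expR_ge0// psi0//.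
  by rewrite (lt_trans u0 ux) (lt_trans xv).
(* From [F <= D u^m] and [Y >= a u], [- psi] is at most the derivative of [B u^(m - k)] on []0, d[];
   so [Phi + B u^(m - k)] is nondecreasing there, which bounds [Phi] above near 0. *)
pose B := (p - 1)^-1 * D * a `^ (- (1 + k)) / (m - k).
have B0 : 0 < B.
  rewrite divr_gt0//; apply: mulr_gt0; last exact: powR_gt0.
  by apply: mulr_gt0; first rewrite invr_gt0.
pose M := expR (Phi d + B * d `^ (m - k)).
have gM u : 0 < u < 1 -> g u <= M.
  move=> /andP[u0 u1]; case: (leP d u) => du.
    rewrite (le_trans (gdecr d u d0 du u1))// ler_expR lerDl.
    by rewrite mulr_ge0 ?powR_ge0// ltW.
  rewrite ler_expR (@le_trans _ _ (Phi u + B * u `^ (m - k)))//.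
    by rewrite lerDl mulr_ge0 ?powR_ge0// ltW.
  apply: (@ge0_is_derive_le _ (fun x => Phi x + B * x `^ (m - k))
    (fun x => psi x + B * ((m - k) * x `^ (m - k - 1))) u d (ltW du)).
    move=> x /andP[ux xd]; have x0 : 0 < x by exact: lt_le_trans ux.
    apply: is_deriveD; first by apply: PhiP; rewrite x0 (le_lt_trans xd).
    by apply: is_deriveZ; exact: is_derive1_powR.
  move=> x /andP[ux xd]; have x0 : 0 < x by exact: lt_trans ux.
  have x01 : 0 < x < 1 by rewrite x0 (lt_trans xd).
  rewrite /psi addrC subr_ge0.
  have -> : B * ((m - k) * x `^ (m - k - 1)) = (p - 1)^-1 *
      ((D * x `^ m) * (a * x) `^ (- (1 + k))).
    rewrite (powRM _ (ltW a0) (ltW x0)).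
    have -> : x `^ (m - k - 1) = x `^ m * x `^ (- (1 + k)).
      by rewrite -powRD ?(gt_eqF x0) ?implybT//; congr (_ `^ _); ring.
    by rewrite /B; field; rewrite !gt_eqF.
  rewrite ler_pM2l ?invr_gt0//; apply: ler_pM.
  - exact: F_ge0.
  - exact: powR_ge0.
  - exact: F_le.
  - apply: le0_ger_powR; [by rewrite oppr_le0 addr_ge0// ltW|by rewrite mulr_gt0|].
    by apply: Ya; rewrite x0 ltW.
have gD : trial_fun g.
  apply: (trial_fun_intro gP).
  - by move=> u u01; apply: cvgM; [exact: gc|exact: psic].
  - by move=> u _; exact: expR_ge0.
  - by move=> u u01; rewrite pmulr_rlt0 ?expR_gt0// psi0.
  - apply: (@le_lt_trans _ _ (int01 (cst M))); last by rewrite int01_cst ltry.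
    apply: int01_le => //; first by move=> u _; exact: expR_ge0.
    by move=> u _; exact: cvg_cst.
have geq u : 0 < u < 1 ->
    g u * F u * Y u `^ (- k) = (p - 1) * (- derive1 g u * Y u).
  move=> u01; rewrite (derive1_01 gP u01) /psi.
  have -> : Y u `^ (- k) = Y u `^ (- (1 + k)) * Y u.
    rewrite -[X in _ * X](powRr1 (ltW (Y0 u u01))) -powRD ?(gt_eqF (Y0 u u01)) ?implybT//.
    by congr (_ `^ _); ring.
  by field; rewrite gt_eqF.
exists g => //; split.
  exact: (J_ge_phase hm hp Fc F0 (ltW c0) YP Yr gD gM geq).
move=> g1 g1D g1J.
have g1eq := J_eq_phase hm hp Fc F0 (ltW c0) YP Yl g1D g1J.
exists (g1 2^-1 * expR (- Phi 2^-1)) => u u01.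
(* The quotient [g1 / g] is constant, as both functions satisfy the linear equation [g' = g psi]. *)
have der (x : R) : 0 < x < 1 -> is_derive x 1 (fun x => g1 x * expR (- Phi x)) 0.
  move=> x01.
  have h1 := is_derive1_comp (is_derive_expR ((- Phi) x)) (is_deriveN (PhiP x x01)).
  apply: (is_derive_eq (is_deriveM (trial_is_derive g1D x01) h1)).
  have e : derive1 g1 x = g1 x * psi x.
    have Yx := Y0 x x01; apply: (mulIf (lt0r_neq0 Yx)).
    apply: (mulfI (lt0r_neq0 pm0)); have := g1eq x x01.
    rewrite /psi => /eqP; rewrite mulNr mulrN -eqr_oppLR => /eqP <-.
    have -> : Y x `^ (- k) = Y x `^ (- (1 + k)) * Y x.
      rewrite -[X in _ * X](powRr1 (ltW Yx)) -powRD ?(gt_eqF Yx) ?implybT//.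
      by congr (_ `^ _); ring.
    by rewrite -/F; field; rewrite gt_eqF.
  by rewrite e /GRing.scale/=; ring.
have := is_derive_eq0_cst der h12 u01 => ->.
by rewrite -mulrA /g -expRD addNr expR0 mulr1.
Qed.

End slow_diffusion.
End wave_speed.

(** * The critical case *)

Section g_alpha.
Variables (R : realType) (alpha : R).
Hypothesis alpha01 : 0 < alpha < 1.

Let a0 : 0 < alpha. Proof. by case/andP: alpha01. Qed.
Let a1 : alpha < 1. Proof. by case/andP: alpha01. Qed.
Let a1' : 0 < 1 - alpha. Proof. by rewrite subr_gt0. Qed.

Lemma g_alpha_is_derive (u : R) : 0 < u < 1 ->
  is_derive u 1 (g_alpha alpha) (- (alpha * u `^ (alpha - 2))).
Proof.
move=> /andP[u0 _].
have h := is_deriveB (is_derive1_powR (alpha - 1) u0) (is_derive_cst (1 : R) u 1).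
apply: (is_derive_eq (is_deriveZ (alpha / (1 - alpha)) h)).
rewrite subr0 /GRing.scale/=; have -> : alpha - 1 - 1 = alpha - 2 by ring.
by field; rewrite gt_eqF.
Qed.

Lemma g_alpha_gt0 (u : R) : 0 < u < 1 -> 0 < g_alpha alpha u.
Proof.
move=> /andP[u0 u1]; rewrite mulr_gt0 ?divr_gt0// subr_gt0.
have -> : alpha - 1 = - (1 - alpha) by ring.
rewrite powRN invf_gt1 ?powR_gt0//.
have e1 : (1 : R) `^ (1 - alpha) = 1 by rewrite powR1.
by rewrite -[X in _ < X]e1; apply: gt0_ltr_powR; rewrite ?nnegrE ?(ltW u0).
Qed.

(** The factor [alpha / (1 - alpha)] is the normalization that gives mass 1, so that [J] reduces to
    its numerator. *)
Lemma g_alpha_int : int01 (g_alpha alpha) = 1%:E.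
Proof.
pose G (u : R) := alpha / (1 - alpha) * (alpha^-1 * u `^ alpha - u).
have gc (u : R) : 0 < u < 1 -> {for u, continuous (g_alpha alpha)}.
  by move=> u01; exact: (is_derive_continuous (g_alpha_is_derive u01)).
have g0 (u : R) : 0 < u < 1 -> 0 <= g_alpha alpha u by move=> /g_alpha_gt0/ltW.
have GP (u : R) : 0 < u < 1 -> is_derive u 1 G (g_alpha alpha u).
  move=> /andP[u0 _].
  have h := is_deriveB (is_deriveZ alpha^-1 (is_derive1_powR alpha u0)) (is_derive_id u 1).
  apply: (is_derive_eq (is_deriveZ (alpha / (1 - alpha)) h)).
  by rewrite /GRing.scale/= mulrA mulVf ?gt_eqF// mul1r.
have Gl : G u @[u --> (0:R)^'+] --> (0:R).
  have e : alpha / (1 - alpha) * (alpha^-1 * 0 - 0) = 0 :> R by rewrite mulr0 subr0 mulr0.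
  rewrite -[X in _ --> X]e; apply: cvgMr; apply: cvgB; first by apply: cvgMr; exact: powR_cvg0.
  by apply: cvg_at_right_filter; exact: cvg_id.
have Gr : G u @[u --> (1:R)^'-] --> (1:R).
  have e : alpha / (1 - alpha) * (alpha^-1 * 1 `^ alpha - 1) = 1 :> R.
    by rewrite powR1; field; rewrite !gt_eqF.
  rewrite -[X in _ --> X]e; apply: cvgMr; apply: cvg_at_left_filter.
  apply: cvgB; last exact: cvg_id.
  by apply: cvgMr; exact: (is_derive_continuous (is_derive1_powR alpha ltr01)).
by have := integral_oo_FTC2 gc g0 GP Gl Gr; rewrite subr0.
Qed.

(** For [alpha <= 1/2] and [u <= eta^2], [u^(1 - alpha) <= sqrt u <= eta]: the subtracted 1 costs at
    most a fraction [eta] of the power, uniformly in [alpha]. *)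
Lemma g_alpha_ge (eta u : R) : 0 < eta < 1 -> alpha <= 2^-1 ->
  0 < u <= eta ^+ 2 -> alpha * (1 - eta) * u `^ (alpha - 1) <= g_alpha alpha u.
Proof.
move=> /andP[eta0 eta1] al2 /andP[u0 ue].
have ue' : u `^ (1 - alpha) <= eta.
  have u1 : u < 1 by rewrite (le_lt_trans ue)// expr_lt1// ltW.
  apply: (@le_trans _ _ (u `^ 2^-1)).
    by apply: ger_powR; [rewrite u0 ltW|lra].
  rewrite powR12_sqrt ?(ltW u0)// -(ger0_norm (ltW eta0)) -sqrtr_sqr.
  by rewrite ler_wsqrtr.
have h : 1 <= eta * u `^ (alpha - 1).
  have -> : alpha - 1 = - (1 - alpha) by ring.
  by rewrite powRN ler_pdivlMr ?powR_gt0// mul1r.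
rewrite /g_alpha; apply: (@le_trans _ _ (alpha * (u `^ (alpha - 1) - 1))).
  by rewrite -mulrA ler_pM2l// mulrBl mul1r lerB.
apply: ler_wpM2r.
  rewrite subr_ge0 (le_trans h)// ler_piMl ?powR_ge0//; exact: ltW.
by rewrite ler_pdivlMr// ler_piMr ?(ltW a0)// gerBl (ltW a0).
Qed.

Lemma g_alpha_trial : trial_fun (g_alpha alpha).
Proof.
apply: (trial_fun_intro g_alpha_is_derive).
- move=> u /andP[u0 _]; apply: cvgN; apply: cvgMr.
  exact: (is_derive_continuous (is_derive1_powR (alpha - 2) u0)).
- by move=> u /g_alpha_gt0/ltW.
- by move=> u /andP[u0 _]; rewrite oppr_lt0 mulr_gt0// powR_gt0.
- by rewrite g_alpha_int ltry.
Qed.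

End g_alpha.

Section critical.
Variables (R : realType) (m p : R) (f df : R -> R) (cstar : R).
Hypotheses (hm : 0 < m) (hp : 1 < p) (hC1 : C1_unit_itv f df)
  (hf0 : f 0 = 0) (hf1 : f 1 = 0)
  (hfpos : forall u : R, 0 < u < 1 -> 0 < f u)
  (hconc : concave_unit_itv f) (hcstar : minimal_speed m p f cstar)
  (hgamma : gamma m p = 0).

Let F := reactF m p f.
Let pm0 : 0 < p - 1. Proof. by rewrite subr_gt0. Qed.
Let p0 : 0 < p. Proof. exact: lt_trans hp. Qed.
Let m1 : 0 < m + 1. Proof. by rewrite addr_gt0. Qed.
Let mp0 : 0 < m `^ (p - 1). Proof. exact: powR_gt0. Qed.
Let pm1 : p - 1 = m^-1.
Proof.
apply: (mulfI (lt0r_neq0 hm)); rewrite mulfV ?gt_eqF//.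
by apply/eqP; rewrite -subr_eq0; apply/eqP.
Qed.
Let pE : p = (m + 1) / m.
Proof. by rewrite -(subrK 1 p) pm1; field; rewrite gt_eqF. Qed.
Let kE : 1 / (p - 1) = m. Proof. by rewrite pm1 div1r invrK. Qed.

(* The line [a u] solves [a = C - D u^m (a u)^(- m)] for [C = a + D a^(- m)], which
   is smallest, and equal to [p a], at [a^(m + 1) = m D]. *)
Definition critical_slope := (m * (df 0 / m `^ (p - 1))) `^ (1 / (m + 1)).
Let a := critical_slope.
Let D := df 0 / m `^ (p - 1).
Let D0 : 0 < D.
Proof. by rewrite divr_gt0// (concave_derive0_gt0 hC1 hconc hf0 hfpos). Qed.
Let a0 : 0 < a. Proof. by rewrite powR_gt0// mulr_gt0. Qed.
Let aE : a * a `^ m = m * D.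
Proof.
have mD0 : 0 <= m * D by rewrite ltW// mulr_gt0.
rewrite -{1}(powRr1 (ltW a0)) -powRD ?(gt_eqF a0) ?implybT//.
rewrite -powRrM (_ : 1 / (m + 1) * (1 + m) = 1) ?powRr1//.
by field; rewrite gt_eqF.
Qed.

Definition critical_speed := m `^ (p - 1) * (p * critical_slope).
Let K := critical_speed.
Let K0 : 0 < K. Proof. by rewrite /K /critical_speed !mulr_gt0. Qed.

(** Raising to the power [m + 1] clears the roots: [gamma = 0] gives
    [(p - 1) (m + 1) = 1 + (p - 1)], and [m^(p - 1)] cancels the denominator of [D] in
    [a^(m + 1) = m D]. *)
Lemma critical_speedE : critical_speed = (m ^+ 2 * p `^ (m + 1) * df 0) `^ (1 / (m + 1)).
Proof.
have -> : m ^+ 2 * p `^ (m + 1) * df 0 = K `^ (m + 1).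
  rewrite /K /critical_speed -/a (powRM _ (ltW mp0)) ?mulr_ge0 ?ltW//.
  rewrite (powRM _ (ltW p0) (ltW a0)) -powRrM.
  have -> : (p - 1) * (m + 1) = 1 + (p - 1) by rewrite pm1; field; rewrite gt_eqF.
  rewrite (powRD (x := m)) ?(gt_eqF hm) ?implybT// powRr1 ?(ltW hm)//.
  have -> : a `^ (m + 1) = m * D.
    by rewrite powRD ?(gt_eqF a0) ?implybT// powRr1 ?(ltW a0)// mulrC aE.
  by rewrite /D; field; rewrite gt_eqF.
by rewrite -powRrM mulrC divfK ?gt_eqF// powRr1// ltW.
Qed.

Lemma cstar_le_critical : cstar <= critical_speed.
Proof.
rewrite leNgt; apply/negP => Kc.
have [Y [YP Yr [l l0 Yl]]] := reactF_phase_solution hm hp hC1 hf0 hf1 hfpos hconc K0.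
have Kdiv : critical_speed / m `^ (p - 1) = p * a.
  by rewrite /critical_speed -/a; field; rewrite gt_eqF.
have k0 : 0 < 1 / (p - 1) by rewrite kE.
have Yle u : 0 < u < 1 -> Y u <= a * u.
  apply: (@phase_le_super R F (K / m `^ (p - 1)) (1 / (p - 1)) Y (fun u => a * u) (cst (a * 1)))
    => //.
    by move=> v /(reactF_gt0 p hm hfpos)/ltW.
  move=> v v01; have /andP[v0 v1] := v01; split; first by rewrite mulr_gt0.
    exact: is_deriveZ.
  rewrite mulr1 /K Kdiv kE.
  have : F v * (a * v) `^ (- m) <= (D * v `^ m) * (a * v) `^ (- m).
    rewrite ler_wpM2r ?powR_ge0//; apply: (reactF_le p hm hC1 hf0 hconc).
    by rewrite v0 ltW.
  (* The line is an exact solution when [F] is replaced by its bound [D v^m]: the reaction term is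
     [a / m], and [p a = a + a / m] when [gamma = 0]. *)
  have -> : (D * v `^ m) * (a * v) `^ (- m) = a / m.
    rewrite (powRM _ (ltW a0) (ltW v0)) !powRN.
    have -> : D = a * a `^ m / m by rewrite aE mulrC mulKf// gt_eqF.
    field.
    by rewrite (gt_eqF (powR_gt0 m a0)) (gt_eqF (powR_gt0 m v0)) (gt_eqF hm).
  have -> : p * a = a + a / m by rewrite {1}pE; field; rewrite gt_eqF.
  by rewrite lerBrDr -lerBrDl addrAC subrr add0r.
have Yl0 : Y u @[u --> (0:R)^'+] --> 0.
  apply: (@squeeze_cvgr _ _ _ _ (cst 0) (fun u => a * u)).
  - near=> u; have u01 : 0 < u < 1.
      by apply/andP; split; near: u; [exact: nbhs_right_gt|exact: nbhs_right_lt].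
    by have [Yu _] := YP u u01; rewrite (ltW Yu)/= Yle.
  - exact: cvg_cst.
  - rewrite -[X in _ --> X](mulr0 a); apply: cvgMr.
    by apply: cvg_at_right_filter; exact: cvg_id.
exact: (@no_wave_phase_limit R m p f df cstar hm hp hC1 hf0 hf1 hcstar K Y K0 Kc YP Yl0 Yr).
Unshelve. all: by end_near. Qed.

(** With [D u^m] for [F] and [alpha u^(alpha - 1)] for [g_alpha], the powers of [u] combine to
    [alpha u^(alpha - 1)], with coefficient [young_cst p * D^(1 / (m + 1)) = p a]. Each of the two
    replacements costs a factor [1 - eta], raised to a power at most 1, hence the square. *)
Lemma J_density_g_alpha_ge (eta alpha u : R) : 0 < eta < 1 ->
  0 < alpha <= 2^-1 -> 0 < u <= eta ^+ 2 -> df 0 * (1 - eta) * u <= f u ->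
  p * a * (1 - eta) ^+ 2 * (alpha * u `^ (alpha - 1)) <=
    J_density m p f (g_alpha alpha) u.
Proof.
move=> eta01 /andP[al0 al2] u0e fu; have /andP[eta0 eta1] := eta01.
have al01 : 0 < alpha < 1 by rewrite al0; lra.
have /andP[u0 ue] := u0e.
have u1 : u < 1 by rewrite (le_lt_trans ue)// expr_lt1// ltW.
have q0 : 0 < 1 - eta by rewrite subr_gt0.
have q1 : 1 - eta <= 1 by rewrite gerBl ltW.
have th : (p - 1) / p = 1 / (m + 1).
  by rewrite pm1 pE; field; rewrite (gt_eqF hm) (gt_eqF m1).
have th' : 1 / p = m / (m + 1) by rewrite pE; field; rewrite (gt_eqF hm) (gt_eqF m1).
rewrite /J_density (derive1_01 (g_alpha_is_derive al01)) ?u0// opprK th th'.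
set E := alpha * u `^ (alpha - 2); set t := 1 / (m + 1).
have t0 : 0 < t by rewrite divr_gt0.
have t1 : t <= 1 by rewrite ler_pdivrMr// mul1r lerDr ltW.
have E0 : 0 < E by rewrite mulr_gt0// powR_gt0.
have gu := g_alpha_ge al01 eta01 al2 u0e.
have Fu : D * (1 - eta) * u `^ m <= F u.
  have -> : u `^ m = u `^ (m - 1) * u.
    by rewrite -[X in _ * X](powRr1 (ltW u0)) -powRD ?(gt_eqF u0) ?implybT// subrK.
  rewrite /F /reactF ler_pdivlMr//.
  have -> : D * (1 - eta) * (u `^ (m - 1) * u) * m `^ (p - 1) =
      u `^ (m - 1) * (df 0 * (1 - eta) * u).
    by rewrite /D; field; rewrite (gt_eqF mp0).
  by rewrite ler_wpM2l// powR_ge0.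
have B0 : 0 <= D * (1 - eta) * u `^ m by rewrite mulr_ge0 ?powR_ge0// ltW// mulr_gt0.
have C0 : 0 <= alpha * (1 - eta) * u `^ (alpha - 1).
  by rewrite mulr_ge0 ?powR_ge0// ltW// mulr_gt0.
have Dq0 : 0 < D * (1 - eta) ^+ 2 by rewrite mulr_gt0// exprn_gt0.
have uS (r : R) : u `^ (r + 1) = u `^ r * u.
  by rewrite powRD ?(gt_eqF u0) ?implybT// powRr1 ?(ltW u0).
have FG : E `^ t * (D * (1 - eta) ^+ 2) `^ t * u <= F u `^ t * g_alpha alpha u `^ t.
  have uE : (u `^ (m + 1)) `^ t = u.
    by rewrite -powRrM /t div1r mulfV ?(gt_eqF m1)// powRr1// ltW.
  rewrite -[X in _ * X <= _]uE.
  rewrite -(powRM _ (ltW E0) (ltW Dq0)) -(powRM _ (mulr_ge0 (ltW E0) (ltW Dq0)) (powR_ge0 _ _)).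
  have F0 : 0 <= F u by exact: le_trans Fu.
  have g0 : 0 <= g_alpha alpha u by exact: le_trans gu.
  rewrite -(powRM _ F0 g0).
  have EDu0 := mulr_ge0 (mulr_ge0 (ltW E0) (ltW Dq0)) (powR_ge0 u (m + 1)).
  apply: (ge0_ler_powR (ltW t0)); rewrite ?nnegrE//; first exact: mulr_ge0.
  apply: le_trans (ler_pM B0 C0 Fu gu).
  have -> : alpha - 1 = alpha - 2 + 1 by ring.
  by rewrite /E !uS le_eqVlt; apply/orP; left; apply/eqP; ring.
have EE : E `^ (m / (m + 1)) * E `^ t = E.
  rewrite -powRD ?(gt_eqF E0) ?implybT//.
  by rewrite /t -mulrDl mulfV ?(gt_eqF m1)// powRr1// ltW.
have wE : p * a = young_cst p * D `^ t.
  rewrite /young_cst th pm1 -(powR_inv1 (ltW hm)) -powRrM mulN1r powRN invrK.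
  by rewrite /a /critical_slope (powRM _ (ltW hm) (ltW D0)) mulrA.
have qt : (1 - eta) ^+ 2 <= ((1 - eta) ^+ 2) `^ t.
  rewrite -[X in X <= _]powRr1 ?exprn_ge0 ?(ltW q0)//; apply: ger_powR => //.
  by rewrite exprn_gt0// exprn_ile1// ltW.
rewrite wE -(mulrA (E `^ _)).
rewrite (_ : _ * _ * _ = young_cst p * (D `^ t * (1 - eta) ^+ 2 * alpha * u `^ (alpha - 1))); last by ring.
apply: (ler_wpM2l (ltW (young_cst_gt0 hp))).
apply: (@le_trans _ _ (E `^ (m / (m + 1)) * (E `^ t * (D * (1 - eta) ^+ 2) `^ t * u))); last first.
  by apply: ler_wpM2l FG; exact: powR_ge0.
rewrite (mulrA (E `^ _)) (mulrA (E `^ _)) EE (powRM _ (ltW D0)) ?exprn_ge0 ?(ltW q0)//.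
have -> : alpha - 1 = alpha - 2 + 1 by ring.
have -> : D `^ t * (1 - eta) ^+ 2 * alpha * u `^ (alpha - 2 + 1) =
  D `^ t * E * u * (1 - eta) ^+ 2 by rewrite uS /E; ring.
have -> : E * (D `^ t * ((1 - eta) ^+ 2) `^ t) * u =
  D `^ t * E * u * ((1 - eta) ^+ 2) `^ t by ring.
by apply: ler_wpM2l qt; rewrite !mulr_ge0 ?powR_ge0// ltW.
Qed.

(* [g_alpha] has mass 1, and its density carries almost all of the mass
   [p a] on the interval [[d eta^(1/alpha), d]], which shrinks to 0. *)
Lemma J_g_alpha_lower (eta : R) : 0 < eta < 1 ->
  \forall alpha \near (0:R)^'+,
    ((critical_speed * (1 - eta) ^+ 4)%:E <= J m p f (g_alpha alpha))%E.
Proof.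
move=> eta01; have /andP[eta0 eta1] := eta01.
have q0 : 0 < 1 - eta by rewrite subr_gt0.
have [d0' /= d0'0 Hd] : \forall u \near (0:R)^'+, df 0 * (1 - eta) < f u / u.
  have cv : f y / y @[y --> (0:R)^'+] --> df 0 := C1_unit_itv_derive0 hC1 hf0.
  apply: (cv [set t | df 0 * (1 - eta) < t]).
  apply: lt_nbhsr; rewrite gtr_pMr ?(concave_derive0_gt0 hC1 hconc hf0 hfpos)//.
  by rewrite ltrBlDr ltrDl.
have [d [d0 d1 dd0 deta]] : exists d : R, [/\ 0 < d, d < 1, d < d0' & d <= eta ^+ 2].
  exists (Num.min (2^-1) (Num.min (d0' / 2) (eta ^+ 2))).
  rewrite !lt_min !gt_min !ge_min lexx !orbT exprn_gt0// divr_gt0// !andbT.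
  split=> //; first by lra.
    by apply/or3P; apply: Or32; lra.
(* [d] is fixed before [alpha], so [d^alpha] tends to 1 as [alpha] tends to 0. *)
have dcv : \forall alpha \near (0:R)^'+, 1 - eta < d `^ alpha.
  have c : expR (alpha * ln d) @[alpha --> (0:R)] --> expR (0 * ln d).
    apply: (@continuous_comp _ _ _ (fun alpha : R => alpha * ln d) expR).
      by apply: cvgMl; exact: cvg_id.
    exact: continuous_expR.
  have h : \forall alpha \near (0:R), 1 - eta < expR (alpha * ln d).
    apply: (c [set t | 1 - eta < t]); apply: lt_nbhsr.
    by rewrite mul0r expR0 ltrBlDr ltrDl.
  apply: cvg_within; apply: filterS h => alpha.
  by rewrite /powR gt_eqF.
near=> alpha.
have al0 : 0 < alpha by near: alpha; exact: nbhs_right_gt.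
have al2 : alpha < 2^-1 by near: alpha; apply: nbhs_right_lt; lra.
have dal : 1 - eta < d `^ alpha by near: alpha.
have al01 : 0 < alpha < 1 by rewrite al0; lra.
have gD := g_alpha_trial al01.
have Fc : cont01 (reactF m p f).
  by move=> u u01; exact: (@reactF_continuous R m p f df hC1 u u01).
have F0 (u : R) : 0 < u < 1 -> 0 < reactF m p f u by exact: (reactF_gt0 p hm hfpos).
rewrite (J_ge hm hp Fc F0 gD) g_alpha_int// mule1.
pose W := p * a * (1 - eta) ^+ 2.
have W0 : 0 < W.
  by apply: mulr_gt0; [exact: mulr_gt0|rewrite exprn_gt0].
(* Chosen so that [b^alpha = eta d^alpha]: cutting at [b] loses only a fraction [eta] of the
   primitive at [d]. *)
pose b := d * eta `^ (alpha^-1).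
have b0 : 0 < b by rewrite mulr_gt0// powR_gt0.
have bd : b < d.
  have e1 : (1 : R) `^ (alpha^-1) = 1 by rewrite powR1.
  rewrite gtr_pMr// -[X in _ < X]e1; apply: gt0_ltr_powR => //.
  - by rewrite invr_gt0.
  - by rewrite nnegrE ltW.
  - by rewrite nnegrE.
have bal : b `^ alpha = d `^ alpha * eta.
  rewrite (powRM _ (ltW d0) (powR_ge0 _ _)) -powRrM mulVf ?(gt_eqF al0)//.
  by rewrite powRr1// ltW.
have ub (u : R) : b <= u <= d -> 0 < u by move=> /andP[bu _]; exact: lt_le_trans bu.
have qc (u : R) : b <= u <= d -> {for u, continuous (fun u => W * (alpha * u `^ (alpha - 1)))}.
  move=> /ub u0; apply: cvgMr; apply: cvgMr.
  exact: (is_derive_continuous (is_derive1_powR (alpha - 1) u0)).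
have QP (u : R) : b <= u <= d ->
    is_derive u 1 (fun u => W * u `^ alpha) (W * (alpha * u `^ (alpha - 1))).
  by move=> /ub u0; exact: (is_deriveZ W (is_derive1_powR alpha u0)).
have qle (u : R) : b <= u <= d ->
    0 <= W * (alpha * u `^ (alpha - 1)) <= J_density m p f (g_alpha alpha) u.
  move=> bud; have u0 := ub u bud; have /andP[_ ud] := bud.
  apply/andP; split; first by rewrite mulr_ge0 ?(ltW W0)// mulr_ge0 ?powR_ge0// ltW.
  apply: J_density_g_alpha_ge => //; first by rewrite al0 ltW.
    by rewrite u0 (le_trans ud).
  have := Hd u; rewrite /= sub0r normrN gtr0_norm// => /(_ (le_lt_trans ud dd0) u0).
  by rewrite ltr_pdivlMr// => /ltW.
have Dc := J_density_cont Fc F0 gD.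
have Dge := @J_density_ge0 R m p f hp (g_alpha alpha).
apply: le_trans (integral_oo_ge Dc Dge b0 bd d1 qc qle QP).
(* Of the four factors [1 - eta], two sit in [W], one comes from [d^alpha] and one from the lower
   end [b]. *)
rewrite bal lee_fin.
have -> : critical_speed * (1 - eta) ^+ 4 / m `^ (p - 1) = W * (1 - eta) ^+ 2.
  by rewrite /critical_speed -/a /W; field; rewrite (gt_eqF mp0).
have -> : W * d `^ alpha - W * (d `^ alpha * eta) = W * (d `^ alpha * (1 - eta)) by ring.
by rewrite ler_pM2l// expr2 ler_pM2r// ltW.
Unshelve. all: by end_near. Qed.

Lemma J_g_alpha_near (e : R) : 0 < e ->
  \forall alpha \near (0:R)^'+, ((critical_speed - e)%:E <= J m p f (g_alpha alpha))%E.
Proof.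
move=> e0; have Kp : 0 < critical_speed by exact: K0.
(* The inequality [(1 - eta)^4 >= 1 - 4 eta] turns this choice into a loss of at most [e]. *)
have [eta eta01 etae] : exists2 eta : R, 0 < eta < 1 & 4 * critical_speed * eta <= e.
  exists (Num.min 2^-1 (e / (4 * critical_speed))).
    by rewrite lt_min gt_min divr_gt0 ?mulr_gt0// andbT invr_gt0 ltr0n/=; apply/orP; left; lra.
  by rewrite mulrC -ler_pdivlMr ?mulr_gt0// ge_min lexx orbT.
near=> alpha; apply: (@le_trans _ _ (critical_speed * (1 - eta) ^+ 4)%:E).
  rewrite lee_fin; have b4 : 1 - 4 * eta <= (1 - eta) ^+ 4.
    by have /andP[x0 x1] := eta01; nra.
  apply: (@le_trans _ _ (critical_speed * (1 - 4 * eta))); last by rewrite ler_pM2l.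
  by rewrite mulrBr mulr1 lerB// mulrCA mulrA.
by near: alpha; exact: J_g_alpha_lower.
Unshelve. all: by end_near. Qed.

Lemma J_g_alpha_le (alpha : R) : 0 < alpha < 1 ->
  (J m p f (g_alpha alpha) <= cstar%:E)%E.
Proof.
move=> /g_alpha_trial; exact: (J_le_cstar hm hp hC1 hf0 hf1 hfpos hconc hcstar).
Qed.

(** The trial functions supply the lower bound on [cstar]: [J[g_alpha]] comes within [e] of
    [critical_speed] and never exceeds [cstar]. *)
Lemma cstarE : cstar = critical_speed.
Proof.
apply/le_anti; rewrite cstar_le_critical; apply/ler_addgt0Pr => e e0.
have [alpha [al01 Ja]] : exists alpha, 0 < alpha < 1 /\
    ((critical_speed - e)%:E <= J m p f (g_alpha alpha))%E.
  apply: (@filter_ex _ (0:R)^'+); near=> alpha; split.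
    by apply/andP; split; near: alpha; [exact: nbhs_right_gt|exact: nbhs_right_lt].
  by near: alpha; exact: J_g_alpha_near.
by rewrite -lerBlDr -lee_fin (le_trans Ja)// J_g_alpha_le.
Unshelve. all: by end_near. Qed.

Lemma J_g_alpha_cvg : J m p f (g_alpha alpha) @[alpha --> (0:R)^'+] --> cstar%:E.
Proof.
have bounds (e : R) : 0 < e -> \forall alpha \near (0:R)^'+,
    ((cstar - e)%:E <= J m p f (g_alpha alpha) <= cstar%:E)%E.
  move=> e0; near=> alpha; apply/andP; split.
    by near: alpha; rewrite cstarE; exact: J_g_alpha_near.
  apply: J_g_alpha_le.
  by apply/andP; split; near: alpha; [exact: nbhs_right_gt|exact: nbhs_right_lt].
apply/fine_cvgP; split.
  apply: filterS (bounds 1 ltr01) => alpha /andP[h1 h2].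
  by rewrite fin_numElt (lt_le_trans (ltNyr _) h1) (le_lt_trans h2)// ltry.
apply/cvgrPdist_le => e e0; apply: filterS (bounds e e0) => alpha /=.
case: (J m p f (g_alpha alpha)) => [x| |] //=.
  by rewrite !lee_fin ler_norml => /andP[h1 h2]; apply/andP; split; lra.
by rewrite andbF.
Unshelve. all: by end_near. Qed.

End critical.

Theorem theorem1 (R : realType) (m p : R) (f df : R -> R) (cstar : R)
    (hm : 0 < m) (hp : 1 < p) (hgamma : 0 <= gamma m p)
    (hC1 : C1_unit_itv f df) (hf0 : f 0 = 0) (hf1 : f 1 = 0)
    (hfpos : forall u, 0 < u < 1 -> 0 < f u)
    (hconc : concave_unit_itv f)
    (hcstar : minimal_speed m p f cstar) :
  [/\ cstar%:E = ereal_sup [set J m p f g | g in @trial_fun R],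
      0 < gamma m p ->
        exists gtilde : R -> R,
          [/\ trial_fun gtilde,
              J m p f gtilde = ereal_sup [set J m p f g | g in @trial_fun R] &
              forall g, trial_fun g ->
                J m p f g = ereal_sup [set J m p f g' | g' in @trial_fun R] ->
                exists k : R, forall u, 0 < u < 1 -> g u = k * gtilde u] &
      gamma m p = 0 ->
        [/\ forall alpha : R, 0 < alpha < 1 -> trial_fun (g_alpha alpha),
            J m p f (g_alpha alpha) @[alpha --> (0 : R)^'+] --> cstar%:E &
            cstar = (m ^+ 2 * p `^ (m + 1) * df 0) `^ (1 / (m + 1))] ].
Proof.
have Jle g : trial_fun g -> (J m p f g <= cstar%:E)%E.
  exact: (J_le_cstar hm hp hC1 hf0 hf1 hfpos hconc hcstar).
have maxi := maximizer_exists hm hp hC1 hf0 hf1 hfpos hconc hcstar.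
have supE : cstar%:E = ereal_sup [set J m p f g | g in @trial_fun R].
  apply/eqP; rewrite eq_le; apply/andP; split; last first.
    by apply: ge_ereal_sup => _ [g gD <-]; exact: Jle.
  (* When [gamma > 0] the maximizer attains the bound; when [gamma = 0] it is approached along
     [g_alpha]. *)
  have [g0|/maxi[g gD [cJ _]]] : gamma m p = 0 \/ 0 < gamma m p.
  - by have := hgamma; rewrite le_eqVlt => /orP[/eqP<-|]; [left|right].
  - have cv := J_g_alpha_cvg hm hp hC1 hf0 hf1 hfpos hconc hcstar g0.
    apply: (cvge_to_le cv); near=> alpha; apply: ereal_sup_ubound.
    exists (g_alpha alpha) => //; apply: g_alpha_trial.
    by apply/andP; split; near: alpha; [exact: nbhs_right_gt|exact: nbhs_right_lt].
  - by apply: (le_trans cJ); apply: ereal_sup_ubound; exists g.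
split=> // [/maxi[g gD [cJ guniq]]|g0].
  exists g; split; rewrite -?supE//; first by apply/le_anti; rewrite cJ Jle.
split; first by move=> alpha; exact: g_alpha_trial.
- exact: (J_g_alpha_cvg hm hp hC1 hf0 hf1 hfpos hconc hcstar g0).
- rewrite [LHS](cstarE hm hp hC1 hf0 hf1 hfpos hconc hcstar g0).
  exact: (critical_speedE hm hp hC1 hf0 hfpos hconc g0).
Unshelve. all: by end_near. Qed.
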